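(* Let $\Sigma_\Lambda=\{\Sigma_\lambda=(\gamma_\lambda,f_\lambda,g_\lambda)\}_{\lambda\in\Lambda}$ be a parametrized family of impulsive systems with inputs (with $\Lambda$ an arbitrary nonempty index set). Suppose that the flow maps $f_\lambda$ satisfy: (f-i) there exist $\nu_f\in\mathcal{K}$ and a nondecreasing $N_f:\mathbb{R}_{\ge 0}\to\mathbb{R}_{>0}$ such that $|f_\lambda(t,\xi,\mu)|\le N_f(|\xi|)(1+\nu_f(|\mu|))$ for all $\lambda\in\Lambda$ and $(t,\xi,\mu)\in\mathbb{R}_{\ge 0}\times\mathbb{R}^n\times\mathbb{R}^m$; (f-ii) for every $r>0$ and $\varepsilon>0$ there exists $\delta>0$ such that for all $\lambda\in\Lambda$ and $t\ge 0$, $|f_\lambda(t,\xi,\mu)-f_\lambda(t,\xi,0)|<\varepsilon$ whenever $|\xi|\le r$ and $|\mu|\le\delta$; (f-iii) for every $R>0$ there is $L_R\ge 0$ such that $|f_\lambda(t,\xi_1,0)-f_\lambda(t,\xi_2,0)|\le L_R|\xi_1-\xi_2|$ for all $\lambda\in\Lambda$, $t\ge 0$ and $\xi_1,\xi_2\in\mathbb{R}^n$ with $|\xi_1|,|\xi_2|\le R$; and that the jump maps $g_\lambda$ satisfy: (g-i) there exist $\nu_g\in\mathcal{K}$ and a nondecreasing $N_g:\mathbb{R}_{\ge 0}\to\mathbb{R}_{>0}$ such that $|g_\lambda(t,\xi,\mu)|\le N_g(|\xi|)(1+\nu_g(|\mu|))$ for all $\lambda\in\Lambda$ and $(t,\xi,\mu)\in\mathbb{R}_{\ge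 0}\times\mathbb{R}^n\times\mathbb{R}^m$; (g-ii) for every $r>0$ and $\varepsilon>0$ there exists $\delta>0$ such that for all $\lambda\in\Lambda$ and $t\ge 0$, $|g_\lambda(t,\xi,\mu)-g_\lambda(t,\xi,0)|<\varepsilon$ whenever $|\xi|\le r$ and $|\mu|\le\delta$; (g-iii) for every $R>0$ there is $\omega_R\in\mathcal{K}_\infty$ such that $|g_\lambda(t,\xi_1,0)-g_\lambda(t,\xi_2,0)|\le\omega_R(|\xi_1-\xi_2|)$ for all $\lambda\in\Lambda$, $t\ge 0$ and $\xi_1,\xi_2\in\mathbb{R}^n$ with $|\xi_1|,|\xi_2|\le R$. Then $\Sigma_\Lambda$ is strongly iISS if and only if it is both strongly 0-GUAS and UBEBS.
   Context: Function classes. $\alpha\in\mathcal{K}$ if $\alpha:\mathbb{R}_{\ge 0}\to\mathbb{R}_{\ge 0}$ is continuous, strictly increasing and $\alpha(0)=0$; $\alpha\in\mathcal{K}_\infty$ if in addition $\alpha$ is unbounded. $\beta\in\mathcal{KL}$ if $\beta:\mathbb{R}_{\ge 0}\times\mathbb{R}_{\ge 0}\to\mathbb{R}_{\ge 0}$, $\beta(\cdot,t)\in\mathcal{K}_\infty$ for every $t\ge 0$, and for each fixed $r\ge 0$, $\beta(r,t)$ decreases monotonically to $0$ as $t\to\infty$. $|\cdot|$ is the Euclidean norm. Impulsive systems. $\Gamma$ is the set of impulse-time sequences $\gamma=\{\tau_k\}_{k=1}^N\subset(0,\infty)$, $N$ finite (possibly $\gamma=\emptyset$) or $N=\infty$,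 strictly increasing and with no finite limit point; $\gamma$ is also regarded as a set. $\mathcal{U}$ is the set of inputs, i.e. Lebesgue measurable, locally essentially bounded functions $u:[0,\infty)\to\mathbb{R}^m$; $\mathbf{0}$ is the identically zero input. An impulsive system with inputs $\Sigma=(\gamma,f,g)$ is given by $$\dot x(t)=f(t,x(t),u(t))\ \text{ for } t\notin\gamma,\qquad x(t)=x(t^-)+g(t,x(t^-),u(t))\ \text{ for } t\in\gamma,$$ where $\gamma\in\Gamma$, $f,g:\mathbb{R}_{\ge 0}\times\mathbb{R}^n\times\mathbb{R}^m\to\mathbb{R}^n$, $f(t,0,0)=0$ and $g(t,0,0)=0$ for all $t\ge 0$; moreover $f(t,\xi,\mu)$ is Lebesgue measurable in $t$, continuous in $(\xi,\mu)$, and for every compact interval $I\subset\mathbb{R}_{\ge 0}$ and compact $K\subset\mathbb{R}^n\times\mathbb{R}^m$ there is an integrable $m:I\to\mathbb{R}$ with $|f(t,\xi,\mu)|\le m(t)$ on $I\times K$. The dimensions $n,m$ are the same for all members of a family. Solutions. A solution of $\Sigma$ with initial time $t_0\ge 0$, initial state $x_0\in\mathbb{R}^n$ and input $u\in\mathcal{U}$ is a function $x:[t_0,T_x)\to\mathbb{R}^n$ such that: $x(t_0)=x_0$; $x$ is locally absolutely continuous on each interval $J=[t_1,t_2)\subset[t_0,T_x)$ with no points of $\gamma$ in its interior, with $\dot x(t)=f(t,x(t),u(t))$ for almost all $t\in J$; and for every $t\in\gamma\cap(t_0,T_x)$ the left limit $x(t^-)$ exists, is finite, and $x(t)=x(t^-)+g(t,x(t^-),u(t))$.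 It is maximally defined if no other solution $y:[t_0,T_y)\to\mathbb{R}^n$ has $T_y>T_x$ and coincides with $x$ on $[t_0,T_x)$. $\mathcal{T}_\Sigma(t_0,x_0,u)$ denotes the set of maximally defined solutions (which need not be unique). Norms. For an interval $I\subset[0,\infty)$, $n^\gamma_I:=\#(\gamma\cap I)$. For $u\in\mathcal{U}$ and $\rho_1,\rho_2\in\mathcal{K}_\infty$, $$\|u_I\|_{\rho_1,\rho_2,\gamma}:=\int_I\rho_1(|u(s)|)\,ds+\sum_{s\in\gamma\cap I}\rho_2(|u(s)|).$$ Stability. A family $\Sigma_\Lambda=\{\Sigma_\lambda=(\gamma_\lambda,f_\lambda,g_\lambda)\}_{\lambda\in\Lambda}$ is: - strongly 0-GUAS if there exists $\beta\in\mathcal{KL}$ such that $|x(t)|\le\beta\big(|x_0|,t-t_0+n^{\gamma_\lambda}_{(t_0,t]}\big)$ for all $\lambda\in\Lambda$, $t_0\ge 0$, $x_0\in\mathbb{R}^n$, $x\in\mathcal{T}_{\Sigma_\lambda}(t_0,x_0,\mathbf{0})$ and $t\in[t_0,T_x)$; - strongly iISS if there exist $\beta\in\mathcal{KL}$, $\alpha,\rho_1,\rho_2\in\mathcal{K}_\infty$ such that $\alpha(|x(t)|)\le\beta\big(|x_0|,t-t_0+n^{\gamma_\lambda}_{(t_0,t]}\big)+\|u_{(t_0,t]}\|_{\rho_1,\rho_2,\gamma_\lambda}$; - UBEBS (uniformly bounded-energy input/bounded state) if there exist $\alpha,\rho_1,\rho_2\in\mathcal{K}_\infty$ and $c\ge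 0$ such that $\alpha(|x(t)|)\le|x_0|+\|u_{(t_0,t]}\|_{\rho_1,\rho_2,\gamma_\lambda}+c$; where the last two inequalities hold for all $\lambda\in\Lambda$, $t_0\ge 0$, $x_0\in\mathbb{R}^n$, $u\in\mathcal{U}$, $x\in\mathcal{T}_{\Sigma_\lambda}(t_0,x_0,u)$ and $t\in[t_0,T_x)$. *)

(* Defs.v *)
From mathcomp Require Import all_boot all_order all_algebra finmap.
From mathcomp Require Import all_classical all_reals all_analysis.

Set Implicit Arguments.
Unset Strict Implicit.
Unset Printing Implicit Defensive.

Import Order.TTheory GRing.Theory Num.Theory.
Import numFieldNormedType.Exports.

Local Open Scope classical_set_scope.
Local Open Scope ring_scope.

(* The Euclidean norm. The canonical norm `|v| on row vectors is the sup norm;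
   it is only used through the topology, which is the same. *)
Definition enorm (R : realType) (n : nat) (v : 'rV[R]_n) : R :=
  Num.sqrt (\sum_(i < n) (v ord0 i) ^+ 2).

(* R with the sigma-algebra of Lebesgue (not only Borel) measurable sets, the
   one on which completed_lebesgue_measure is defined. *)
Notation lebesgueR R := (caratheodory_type ((wlength (@idfun R))^*)%mu).

(* Comparison functions. Functions defined on the nonnegative reals are
   represented by total functions whose values at negative arguments are never
   used. Nonnegativity of the values follows from a 0 = 0 and monotonicity. *)
Definition class_K (R : realType) (a : R -> R) : Prop :=
  [/\ {within `[0, +oo[, continuous a},
      {in `[0, +oo[ &, {homo a : r s / r < s}} &
      a 0 = 0].

Definition class_Kinf (R : realType) (a : R -> R) : Prop :=
  class_K a /\ forall M : R, exists2 r : R, 0 <= r & M < a r.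

Definition class_KL (R : realType) (b : R -> R -> R) : Prop :=
  (forall t : R, 0 <= t -> class_Kinf (fun r => b r t)) /\
  (forall r : R, 0 <= r ->
     {in `[0, +oo[ &, {homo b r : s t / s <= t >-> t <= s}} /\
     (b r t @[t --> +oo] --> (0 : R))).

(* gam is the range of a strictly increasing sequence in (0, oo), of length
   N (possibly 0) or infinite, without finite limit point. *)
Definition impulse_times (R : realType) (gam : set R) : Prop :=
  exists (D : set nat) (tau : nat -> R),
    [/\ D = setT \/ (exists N : nat, D = `I_N),
        (forall j k : nat, D j -> D k -> (j < k)%N -> tau j < tau k),
        gam = tau @` D,
        gam `<=` `]0, +oo[ &
        limit_point gam = set0].

Definition input (R : realType) (m : nat) (u : R -> 'rV[R]_m) : Prop :=
  (forall i : 'I_m,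
     measurable_fun (`[0, +oo[ : set (lebesgueR R))
       (fun t : lebesgueR R => u t ord0 i)) /\
  (forall a b : R, 0 <= a -> exists M : R,
     {ae completed_lebesgue_measure,
       forall t, a <= t <= b -> enorm (u t) <= M}).

Record impulsive_system (R : realType) (n m : nat) := ImpulsiveSystem {
  impulses : set R ;
  flow : R -> 'rV[R]_n -> 'rV[R]_m -> 'rV[R]_n ;
  jump : R -> 'rV[R]_n -> 'rV[R]_m -> 'rV[R]_n ;
  impulsesP : impulse_times impulses ;
  flow0 : forall t : R, 0 <= t -> flow t 0 0 = 0 ;
  jump0 : forall t : R, 0 <= t -> jump t 0 0 = 0 ;
  flow_measurable : forall xi mu (i : 'I_n),
    measurable_fun (`[0, +oo[ : set (lebesgueR R))
      (fun t : lebesgueR R => flow t xi mu ord0 i) ;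
  flow_continuous : forall t : R, 0 <= t ->
    continuous (fun p : 'rV[R]_n * 'rV[R]_m => flow t p.1 p.2) ;
  flow_dominated :
    forall (a b : R) (K : set ('rV[R]_n * 'rV[R]_m)), 0 <= a -> compact K ->
    exists2 h : lebesgueR R -> R,
      completed_lebesgue_measure.-integrable (`[a, b] : set (lebesgueR R))
        (EFin \o h) &
      forall t xi mu, a <= t <= b -> K (xi, mu) ->
        enorm (flow t xi mu) <= h t
}.

(* Absolute continuity of x on the compact interval [c, d]. *)
Definition abs_continuous (R : realType) (n : nat) (c d : R)
    (x : R -> 'rV[R]_n) : Prop :=
  forall e : R, 0 < e -> exists2 del : R, 0 < del &
    forall (k : nat) (a b : 'I_k -> R),
      (forall i, [/\ c <= a i, a i <= b i & b i <= d]) ->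
      trivIset setT (fun i => `]a i, b i[%classic) ->
      \sum_(i < k) (b i - a i) < del ->
      \sum_(i < k) enorm (x (b i) - x (a i)) < e.

(* x, restricted to [t0, T), is a solution with initial state x0; the values
   of x outside [t0, T) are irrelevant. In the second clause, J = [t1, t2); the
   derivative is the two-sided one, J and its interior differing by a null
   set. *)
Definition solution (R : realType) (n m : nat) (S : impulsive_system R n m)
    (t0 : R) (x0 : 'rV[R]_n) (u : R -> 'rV[R]_m)
    (x : R -> 'rV[R]_n) (T : \bar R) : Prop :=
  [/\ (t0%:E < T)%E /\ x t0 = x0,
      (forall (t1 : R) (t2 : \bar R),
         t0 <= t1 -> (t1%:E < t2)%E -> (t2 <= T)%E ->
         (forall s, impulses S s -> ~ (t1 < s /\ (s%:E < t2)%E)) ->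
         (forall c d : R, t1 <= c -> c <= d -> (d%:E < t2)%E ->
            abs_continuous c d x) /\
         {ae completed_lebesgue_measure, forall t : R,
            t1 <= t /\ (t%:E < t2)%E ->
            is_derive t 1 x (flow S t (x t) (u t))}) &
      (forall t : R, impulses S t -> t0 < t -> (t%:E < T)%E ->
         exists2 l : 'rV[R]_n, x s @[s --> t^'-] --> l &
           x t = l + jump S t l (u t))].

Definition maximal_solution (R : realType) (n m : nat)
    (S : impulsive_system R n m) (t0 : R) (x0 : 'rV[R]_n) (u : R -> 'rV[R]_m)
    (x : R -> 'rV[R]_n) (T : \bar R) : Prop :=
  solution S t0 x0 u x T /\
  ~ exists (y : R -> 'rV[R]_n) (T' : \bar R),
      [/\ solution S t0 x0 u y T', (T < T')%E &
          forall t : R, t0 <= t -> (t%:E < T)%E -> y t = x t].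

(* Number of impulse times in I. fset_set is set0 on infinite sets, but
   gam `&` I is finite for bounded I, the only case in which it is used. *)
Definition nimpulses (R : realType) (gam I : set R) : nat :=
  #|` fset_set (gam `&` I)|%fset.

Definition input_energy (R : realType) (m : nat) (rho1 rho2 : R -> R)
    (gam I : set R) (u : R -> 'rV[R]_m) : \bar R :=
  (\int[completed_lebesgue_measure]_(s in (I : set (lebesgueR R)))
     (rho1 (enorm (u s)))%:E
   + \esum_(s in gam `&` I) (rho2 (enorm (u s)))%:E)%E.

Section stability.
Variables (R : realType) (n m : nat) (Lambda : Type).
Variable S : Lambda -> impulsive_system R n m.

Definition strongly_0GUAS : Prop :=
  exists2 beta : R -> R -> R, class_KL beta &
  forall (l : Lambda) (t0 : R) (x0 : 'rV[R]_n) x (T : \bar R) (t : R),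
    0 <= t0 -> maximal_solution (S l) t0 x0 (fun=> 0) x T ->
    t0 <= t -> (t%:E < T)%E ->
    enorm (x t) <=
      beta (enorm x0)
        (t - t0 + (nimpulses (impulses (S l)) `]t0, t])%:R).

Definition strongly_iISS : Prop :=
  exists (beta : R -> R -> R) (alpha rho1 rho2 : R -> R),
  [/\ class_KL beta, class_Kinf alpha, class_Kinf rho1, class_Kinf rho2 &
  forall (l : Lambda) (t0 : R) (x0 : 'rV[R]_n) u x (T : \bar R) (t : R),
    0 <= t0 -> input u -> maximal_solution (S l) t0 x0 u x T ->
    t0 <= t -> (t%:E < T)%E ->
    ((alpha (enorm (x t)))%:E <=
      (beta (enorm x0)
        (t - t0 + (nimpulses (impulses (S l)) `]t0, t])%:R))%:E
      + input_energy rho1 rho2 (impulses (S l)) `]t0, t] u)%E].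

Definition UBEBS : Prop :=
  exists (alpha rho1 rho2 : R -> R) (c : R),
  [/\ class_Kinf alpha, class_Kinf rho1, class_Kinf rho2, 0 <= c &
  forall (l : Lambda) (t0 : R) (x0 : 'rV[R]_n) u x (T : \bar R) (t : R),
    0 <= t0 -> input u -> maximal_solution (S l) t0 x0 u x T ->
    t0 <= t -> (t%:E < T)%E ->
    ((alpha (enorm (x t)))%:E <=
      (enorm x0)%:E
      + input_energy rho1 rho2 (impulses (S l)) `]t0, t] u + c%:E)%E].

End stability.

(* Regularity conditions on a family h of flow maps or of jump maps. *)
Section family_conditions.
Variables (R : realType) (n m : nat) (Lambda : Type).
Variable h : Lambda -> R -> 'rV[R]_n -> 'rV[R]_m -> 'rV[R]_n.

Definition uniform_growth_bound : Prop :=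
  exists nu N : R -> R,
  [/\ class_K nu,
      {in `[0, +oo[ &, {homo N : r s / r <= s}},
      (forall r : R, 0 <= r -> 0 < N r) &
      forall l (t : R) xi mu, 0 <= t ->
        enorm (h l t xi mu) <= N (enorm xi) * (1 + nu (enorm mu))].

Definition uniform_continuity_at_zero_input : Prop :=
  forall r e : R, 0 < r -> 0 < e -> exists2 del : R, 0 < del &
    forall l (t : R) xi mu, 0 <= t -> enorm xi <= r -> enorm mu <= del ->
      enorm (h l t xi mu - h l t xi 0) < e.

Definition uniform_local_lipschitz : Prop :=
  forall r : R, 0 < r -> exists2 L : R, 0 <= L &
    forall l (t : R) xi1 xi2, 0 <= t -> enorm xi1 <= r -> enorm xi2 <= r ->
      enorm (h l t xi1 0 - h l t xi2 0) <= L * enorm (xi1 - xi2).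

Definition uniform_local_modulus : Prop :=
  forall r : R, 0 < r -> exists2 omega : R -> R, class_Kinf omega &
    forall l (t : R) xi1 xi2, 0 <= t -> enorm xi1 <= r -> enorm xi2 <= r ->
      enorm (h l t xi1 0 - h l t xi2 0) <= omega (enorm (xi1 - xi2)).

End family_conditions.

(* Main.v *)
(* A trajectory with input stays close to the zero-input trajectory from the
   same state on any window of bounded hybrid time (elapsed time plus number of
   impulses) on which the energy of the input is small: between impulses by
   Gronwall's inequality for the squared distance, at impulses by the moduli of
   continuity of the jump maps. The zero-input trajectory exists globally, since
   Picard iteration prolongs it as long as it is bounded and 0-GUAS bounds it.
   Hence, under 0-GUAS, small initial states and energies give small states, and
   UBEBS improves to an estimate with c = 0. Moreover the energy exceeds a given
   threshold only in boundedly many windows of a fixed hybrid length, so that a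
   long trajectory of bounded total energy passes through a window in which it
   is steered by the zero-input dynamics to a small state. These two estimates
   are the attractivity data from which the iISS comparison functions are built
   as Lipschitz envelopes. The converse holds because a zero input has zero
   energy. *)
Require Import Defs.
From mathcomp Require Import all_boot all_order all_algebra finmap ring lra.
From mathcomp Require Import all_classical all_reals all_analysis.
From mathcomp Require Import measurable_realfun.

Set Implicit Arguments.
Unset Strict Implicit.
Unset Printing Implicit Defensive.

Import Order.TTheory GRing.Theory Num.Theory.
Import numFieldNormedType.Exports.

Local Open Scope classical_set_scope.
Local Open Scope ring_scope.

(** * Euclidean norm *)

(** The stability notions quantify over maximal solutions, whereas the proof constantly truncates
    and restarts trajectories. It therefore works with [response], stated for arbitrary solutions;
    estimates reach these by prolonging them to maximal ones.

    Flow maps and inputs are only Lebesgue measurable in time, and trajectories are differentiable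
    only almost everywhere. Primitives come from one existence lemma, which passes through a Borel
    version of the integrand. The differential estimates all reduce to the monotonicity of an
    absolutely continuous function whose increments are controlled off a null set. Distances are
    squared because the norm is not differentiable where two trajectories meet.

    Lipschitz continuity in the state is assumed at zero input, which dictates the comparison
    trajectory. The deviation is driven by [eta + kappa * rho1 (enorm u)]: [eta] covers small
    inputs, the second term large ones, whose growth the energy must dominate. Hybrid time jumps by
    one at each impulse, so windows cannot have a prescribed length; lengths between [T] and [T + 2]
    are used. *)

Section enorm.
Variables (R : realType) (n : nat).
Implicit Types v w : 'rV[R]_n.

Lemma sumsq_ge0 v : 0 <= \sum_(i < n) (v ord0 i) ^+ 2.
Proof. by apply: sumr_ge0 => i _; exact: sqr_ge0. Qed.

Lemma enorm_ge0 v : 0 <= enorm v.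
Proof. exact: sqrtr_ge0. Qed.

Lemma sqr_enorm v : enorm v ^+ 2 = \sum_(i < n) (v ord0 i) ^+ 2.
Proof. by rewrite sqr_sqrtr// sumsq_ge0. Qed.

Lemma enorm0 : enorm (0 : 'rV[R]_n) = 0.
Proof.
by rewrite /enorm big1 ?sqrtr0// => i _; rewrite mxE expr0n.
Qed.

Lemma enormN v : enorm (- v) = enorm v.
Proof.
by congr (Num.sqrt _); apply: eq_bigr => i _; rewrite mxE sqrrN.
Qed.

Lemma enormZ (a : R) v : enorm (a *: v) = `|a| * enorm v.
Proof.
rewrite /enorm -sqrtr_sqr -sqrtrM ?sqr_ge0//; congr (Num.sqrt _).
by rewrite mulr_sumr; apply: eq_bigr => i _; rewrite mxE exprMn.
Qed.

Lemma enorm_coord v i : `|v ord0 i| <= enorm v.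
Proof.
rewrite -sqrtr_sqr ler_wsqrtr// (bigD1 i)//= lerDl.
by apply: sumr_ge0 => j _; exact: sqr_ge0.
Qed.

Lemma cauchy_schwarz_rV v w :
  \sum_(i < n) v ord0 i * w ord0 i <= enorm v * enorm w.
Proof.
set C := \sum_(i < n) _.
have [we|w0] := eqVneq (enorm w) 0.
  have w_0 i : w ord0 i = 0.
    by apply/eqP; rewrite -normr_le0 -we; exact: enorm_coord.
  by rewrite we mulr0 /C big1// => i _; rewrite w_0 mulr0.
have B0 : 0 < enorm w by rewrite lt_def w0 enorm_ge0.
(* Up to the factor [enorm w ^+ 2], the vector squared here is the component of [v] orthogonal to
   [w]. *)
have : 0 <= \sum_(i < n) (enorm w ^+ 2 * v ord0 i - C * w ord0 i) ^+ 2.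
  by apply: sumr_ge0 => i _; exact: sqr_ge0.
have -> : \sum_(i < n) (enorm w ^+ 2 * v ord0 i - C * w ord0 i) ^+ 2 =
    enorm w ^+ 4 * enorm v ^+ 2 - enorm w ^+ 2 * C ^+ 2.
  transitivity (\sum_(i < n) (enorm w ^+ 4 * (v ord0 i ^+ 2)
     - 2 * enorm w ^+ 2 * C * (v ord0 i * w ord0 i) + C ^+ 2 * w ord0 i ^+ 2)).
    by apply: eq_bigr => i _; ring.
  rewrite big_split/= sumrB -!mulr_sumr -!sqr_enorm -/C; ring.
move=> h.
have {}h : 0 <= enorm w ^+ 2 * ((enorm v * enorm w) ^+ 2 - C ^+ 2).
  by rewrite (le_trans h)// le_eqVlt; apply/orP; left; apply/eqP; ring.
rewrite pmulr_rge0 ?exprn_gt0// subr_ge0 in h.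
apply: le_trans (ler_norm _) _.
rewrite -(ler_pXn2r (n := 2))// ?nnegrE ?mulr_ge0 ?enorm_ge0//.
by rewrite real_normK ?num_real.
Qed.

Lemma enormD v w : enorm (v + w) <= enorm v + enorm w.
Proof.
rewrite -(ler_pXn2r (n := 2))// ?nnegrE ?addr_ge0 ?enorm_ge0//.
rewrite sqr_enorm.
have -> : \sum_(i < n) (v + w) ord0 i ^+ 2 =
   enorm v ^+ 2 + 2 * (\sum_(i < n) v ord0 i * w ord0 i) + enorm w ^+ 2.
  rewrite !sqr_enorm mulr_sumr -!big_split/=.
  by apply: eq_bigr => i _; rewrite mxE; ring.
by have := cauchy_schwarz_rV v w; lra.
Qed.

Lemma enormB v w : enorm (v - w) <= enorm v + enorm w.
Proof. by rewrite (le_trans (enormD _ _))// enormN. Qed.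

Lemma enorm_distC v w : enorm (v - w) = enorm (w - v).
Proof. by rewrite -enormN opprB. Qed.

Lemma enorm_dist_trans v u w : enorm (v - w) <= enorm (v - u) + enorm (u - w).
Proof. by apply: le_trans (enormD _ _); rewrite subrKA. Qed.

Lemma enorm_subr v w : enorm v <= enorm w + enorm (v - w).
Proof. by have := enormD w (v - w); rewrite subrKC. Qed.

Lemma enorm_eq0 v : enorm v <= 0 -> v = 0.
Proof.
move=> v0; apply/rowP => i; rewrite mxE; apply/eqP.
by rewrite -normr_le0 (le_trans (enorm_coord v i)).
Qed.

Lemma enorm_sum I (r : seq I) (P : pred I) (F : I -> 'rV[R]_n) :
  enorm (\sum_(i <- r | P i) F i) <= \sum_(i <- r | P i) enorm (F i).
Proof.
elim/big_ind2 : _ => //; first by rewrite enorm0.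
by move=> x1 x2 y1 y2 h1 h2; rewrite (le_trans (enormD _ _))// lerD.
Qed.

Lemma enorm_le_sum v : enorm v <= \sum_(i < n) `|v ord0 i|.
Proof.
rewrite [X in enorm X]row_sum_delta (le_trans (enorm_sum _ _ _))//.
apply: ler_sum => i _; rewrite enormZ ler_piMr//.
rewrite -[leRHS]sqrtr1 ler_wsqrtr// (bigD1 i)//= big1 ?addr0 ?mxE ?eqxx ?expr1n//.
by move=> j ji; rewrite mxE (negbTE ji) andbF expr0n.
Qed.

Lemma norm_le_enorm v : `|v| <= enorm v.
Proof.
rewrite [leLHS]/Num.Def.normr/= mx_normrE bigmax_le ?enorm_ge0// => -[i j] _ /=.
by rewrite (ord1 i); exact: enorm_coord.
Qed.

Lemma coord_le_norm v i : `|v ord0 i| <= `|v|.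
Proof.
by rewrite [leRHS]/Num.Def.normr/= mx_normrE; exact: (le_bigmax _ _ (ord0, i)).
Qed.

Lemma enorm_le_norm v : enorm v <= n%:R * `|v|.
Proof.
rewrite (le_trans (enorm_le_sum v))//.
rewrite (le_trans (ler_sum _ (fun i _ => coord_le_norm v i)))//.
by rewrite sumr_const card_ord mulr_natl.
Qed.

(** The topology comes from the sup norm, which is equivalent to [enorm] with constants [1] and [n];
    dividing by [n + 1] covers [n = 0]. Limits of trajectories are handled through this form. *)
Lemma cvg_enorm T (F : set_system T) (FF : Filter F) (f : T -> 'rV[R]_n) (l : 'rV[R]_n) :
  (f @ F --> l) <-> forall e : R, 0 < e -> \forall t \near F, enorm (f t - l) <= e.
Proof.
split=> [/cvgrPdist_le h e e0|h].
  have n0 : 0 < n%:R + 1 :> R by rewrite ltr_wpDl.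
  have := h (e / (n%:R + 1)) (divr_gt0 e0 n0).
  apply: filterS => t ht; rewrite enorm_distC.
  rewrite (le_trans (enorm_le_norm _))//.
  rewrite (le_trans (ler_wpM2l _ ht))//.
  by rewrite mulrCA ler_piMr ?(ltW e0)// ler_pdivrMr// mul1r lerDl.
apply/cvgrPdist_le => e e0; apply: filterS (h e e0) => t ht.
by rewrite (le_trans (norm_le_enorm _))// enorm_distC.
Qed.

End enorm.

(** * Comparison functions *)

Section comparison.
Variable R : realType.
Implicit Types a b : R -> R.

Lemma in_nneg (r : R) : 0 <= r -> r \in `[0, +oo[.
Proof. by move=> r0; rewrite in_itv/= andbT. Qed.

Lemma within_nneg_continuousP a :
  {within `[0, +oo[, continuous a} <->
  forall r e : R, 0 <= r -> 0 < e -> exists2 d : R, 0 < d &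
    forall s, 0 <= s -> `|s - r| < d -> `|a s - a r| < e.
Proof.
split=> [/subspace_continuousP h r e r0 e0|h].
  have /h : `[0, +oo[%classic r by rewrite /= in_itv/= r0.
  move=> /cvgrPdist_lt/(_ _ e0); rewrite near_withinE => -[d /= d0 hd].
  exists d => // s s0 sr; rewrite distrC; apply: hd => /=; last first.
    by rewrite in_itv/= s0.
  by rewrite distrC.
apply/subspace_continuousP => r /=; rewrite in_itv/= andbT => r0.
apply/cvgrPdist_lt => e e0; rewrite near_withinE.
have [d d0 hd] := h r e r0 e0.
exists d => //= s /= sr; rewrite in_itv/= andbT => s0; rewrite distrC.
by apply: hd => //; rewrite distrC.
Qed.

Lemma class_K_lt a r s : class_K a -> 0 <= r -> r < s -> a r < a s.
Proof.
by case=> _ h _ r0 rs; apply: h (rs); apply: in_nneg => //; exact: ltW (le_lt_trans r0 rs).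
Qed.

Lemma class_K_le a r s : class_K a -> 0 <= r -> r <= s -> a r <= a s.
Proof.
move=> aK r0; rewrite le_eqVlt => /predU1P[->//|rs].
exact/ltW/class_K_lt.
Qed.

Lemma class_K_ge0 a r : class_K a -> 0 <= r -> 0 <= a r.
Proof. by move=> aK r0; case: (aK) => _ _ <-; exact: class_K_le. Qed.

Lemma class_K_gt0 a r : class_K a -> 0 < r -> 0 < a r.
Proof. by move=> aK r0; case: (aK) => _ _ <-; exact: class_K_lt. Qed.

Lemma class_K_le_inv a r s : class_K a -> 0 <= s -> a r <= a s -> r <= s.
Proof.
by move=> aK s0; apply: contraTT; rewrite -!ltNge => sr; exact: class_K_lt.
Qed.

Lemma class_K_lt_inv a r s : class_K a -> 0 <= s -> a r < a s -> r < s.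
Proof.
by move=> aK s0; apply: contraTT; rewrite -!leNgt => sr; exact: class_K_le.
Qed.

Lemma class_K_small a e : class_K a -> 0 < e ->
  exists2 d : R, 0 < d & forall r, 0 <= r -> r <= d -> a r <= e.
Proof.
move=> aK e0; case: (aK) => /within_nneg_continuousP/(_ 0 e (lexx 0) e0)[d d0 hd] _ a0.
exists (d / 2); first by rewrite divr_gt0.
move=> r r0 rd; apply/ltW/(le_lt_trans (ler_norm _)).
by have := hd r r0; rewrite a0 !subr0; apply; rewrite ger0_norm//; lra.
Qed.

Lemma class_K_add a b : class_Kinf a -> class_K b ->
  class_Kinf (fun r => a r + b r).
Proof.
move=> [aK au] bK; split; last first.
  move=> M; have [r r0 Mr] := au M; exists r => //.
  by rewrite (lt_le_trans Mr)// lerDl class_K_ge0.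
case: (aK) (bK) => [ac ai a0] [bc bi b0]; split.
- apply/within_nneg_continuousP => r e r0 e0.
  move/within_nneg_continuousP : ac => /(_ r (e / 2) r0).
  rewrite divr_gt0// => /(_ isT)[d d0 hd].
  move/within_nneg_continuousP : bc => /(_ r (e / 2) r0).
  rewrite divr_gt0// => /(_ isT)[d' d'0 hd'].
  exists (Num.min d d'); first by rewrite lt_min d0.
  move=> s s0; rewrite lt_min => /andP[/(hd s s0) h /(hd' s s0) h'].
  rewrite opprD addrACA (le_lt_trans (ler_normD _ _))//; lra.
- by move=> r s hr hs rs; rewrite ltrD// ?ai// ?bi.
- by rewrite a0 b0 addr0.
Qed.

Lemma class_Kinf_comp a b : class_Kinf a -> class_Kinf b ->
  class_Kinf (fun r => a (b r)).
Proof.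
move=> [aK au] [bK bu]; split; last first.
  move=> M; have [s s0 Ms] := au M; have [r r0 sr] := bu s.
  by exists r => //; rewrite (lt_trans Ms)// class_K_lt.
case: (aK) (bK) => [ac ai a0] [bc bi b0]; split.
- apply/within_nneg_continuousP => r e r0 e0.
  have br0 := class_K_ge0 bK r0.
  move/within_nneg_continuousP : ac => /(_ (b r) e br0 e0)[d d0 hd].
  move/within_nneg_continuousP : bc => /(_ r d r0 d0)[d' d'0 hd'].
  by exists d' => // s s0 /(hd' s s0); apply: hd; exact: class_K_ge0.
- move=> r s; rewrite !in_itv/= !andbT => r0 s0 rs.
  by apply: class_K_lt => //; [exact: class_K_ge0|exact: class_K_lt].
- by rewrite b0.
Qed.

Lemma class_Kinf_inv a : class_Kinf a -> exists b, [/\ class_Kinf b,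
  forall r, 0 <= r -> b (a r) = r & forall s, 0 <= s -> a (b s) = s].
Proof.
move=> [aK au].
have /choice[b hb] : forall s, exists r, 0 <= s -> 0 <= r /\ a r = s.
  move=> s; have [s0|_] := leP 0 s; last by exists 0.
  have [M M0 sM] := au s.
  case: (aK) => ac _ a0.
  have [] := @IVT R a 0 M s M0.
  - by apply: continuous_subspaceW ac => x /=; rewrite !in_itv/= andbT => /andP[].
  - have := class_K_ge0 aK M0.
    rewrite a0 /Num.min /Num.max; case: ltgtP => //= *; lra.
  - by move=> r; rewrite in_itv/= => /andP[r0 _] <-; exists r.
have b_ge0 s : 0 <= s -> 0 <= b s by move=> /hb[].
have ab s : 0 <= s -> a (b s) = s by move=> /hb[].
have ba r : 0 <= r -> b (a r) = r.
  move=> r0; have ar0 := class_K_ge0 aK r0; apply/eqP.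
  by rewrite eq_le; apply/andP; split; apply: (class_K_le_inv aK); rewrite ?b_ge0 ?ab.
exists b; split => //; split; last first.
  move=> M; have M0 : 0 <= `|M| + 1 by rewrite addr_ge0.
  exists (a (`|M| + 1)); first exact: class_K_ge0.
  by rewrite ba//; have := ler_norm M; lra.
have blt r s : 0 <= r -> 0 <= s -> r < s -> b r < b s.
  move=> r0 s0; rewrite !ltNge; apply: contra => h.
  by rewrite -(ab r)// -(ab s)// class_K_le// b_ge0.
split.
- apply/within_nneg_continuousP => s e s0 e0.
  have b0 := b_ge0 _ s0.
  pose d1 := a (b s + e) - a (b s).
  have d1_gt0 : 0 < d1 by rewrite subr_gt0 class_K_lt// ltrDl.
  (* A margin below is needed only if [b s - e] is nonnegative; otherwise nonnegativity of [b s'] is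
     enough and [d2] is arbitrary. *)
  have [d2 d2_gt0 hd2] : exists2 d2, 0 < d2 & 0 <= b s - e -> d2 <= a (b s) - a (b s - e).
    have [h|h] := leP 0 (b s - e); last by exists 1.
    exists (a (b s) - a (b s - e)) => //.
    by rewrite subr_gt0 class_K_lt// ltrBlDr ltrDl.
  exists (Num.min d1 d2); first by rewrite lt_min d1_gt0.
  move=> s' s'0; rewrite lt_min !ltr_norml => /andP[/andP[_ h1] /andP[h2 _]].
  have b'0 := b_ge0 _ s'0.
  have {}h1 : b s' < b s + e.
    apply: (class_K_lt_inv aK); first by rewrite addr_ge0// ltW.
    by move: h1; rewrite /d1 !ab//; lra.
  have {}h2 : b s - e < b s'.
    have [hs|hs] := leP 0 (b s - e); last exact: lt_le_trans b'0.
    apply: (class_K_lt_inv aK) => //; rewrite ab//.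
    by have := hd2 hs; rewrite ab//; move: h2; lra.
  by apply/andP; split; lra.
- by move=> r s; rewrite !in_itv/= !andbT => r0 s0; exact: blt.
- by case: (aK) => _ _ a0; rewrite -a0 ba.
Qed.

(* The largest [1]-Lipschitz function below the data, made strictly increasing
   by the factor [v / (1 + v)]. *)
Lemma class_Kinf_minorant (P : R -> R -> Prop) :
  (forall s v, P s v -> 0 <= s /\ 0 <= v) ->
  (forall M, exists B, forall s v, P s v -> s <= M -> v <= B) ->
  (forall e : R, 0 < e -> exists2 d : R, 0 < d & forall s v, P s v -> s <= d -> v <= e) ->
  exists2 a, class_Kinf a & forall s v, P s v -> a v <= s.
Proof.
move=> P0 Pbnd Psmall.
(* An infimal convolution: each datum contributes a ramp of slope [1]. The extra member
   [Num.max 0 v] keeps the set nonempty and forces [f 0 = 0]. *)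
pose E (v : R) := [set w | w = Num.max 0 v \/
  exists s' v', P s' v' /\ w = s' + Num.max 0 (v - v')].
pose f (v : R) := inf (E v).
have E0 (v : R) : E v !=set0 by exists (Num.max 0 v); left.
have Elb (v : R) : has_lbound (E v).
  exists 0 => w [->|[s' [v' [/P0[s'0 v'0] ->]]]]; first by rewrite le_max lexx.
  by rewrite addr_ge0// le_max lexx.
have fle s v : P s v -> f v <= s.
  move=> Psv; apply: ge_inf => //; right; exists s, v; split => //.
  by rewrite subrr maxxx addr0.
have maxD (x y : R) : x <= y -> Num.max 0 x <= Num.max 0 y <= Num.max 0 x + (y - x).
  by rewrite /Num.max; do 2 case: ifPn; rewrite -?leNgt; lra.
have fhomo (v1 v2 : R) : v1 <= v2 -> f v1 <= f v2 <= f v1 + (v2 - v1).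
  move=> v12; apply/andP; split.
    apply: lb_le_inf => // w [->|[s' [v' [Psv ->]]]].
      have /andP[h _] := maxD _ _ v12.
      by apply: le_trans h; apply: ge_inf => //; left.
    have /andP[h _] : Num.max 0 (v1 - v') <= Num.max 0 (v2 - v') <= Num.max 0 (v1 - v') + (v2 - v' - (v1 - v')).
      by apply: maxD; rewrite lerB.
    apply: (@le_trans _ _ (s' + Num.max 0 (v1 - v'))); last by rewrite lerD2l.
    by apply: ge_inf => //; right; exists s', v'.
  rewrite -lerBlDr; apply: lb_le_inf => // w [->|[s' [v' [Psv ->]]]].
    rewrite lerBlDr; have /andP[_ h] := maxD _ _ v12.
    by apply: le_trans h; apply: ge_inf => //; left.
  have /andP[_ h] : Num.max 0 (v1 - v') <= Num.max 0 (v2 - v') <= Num.max 0 (v1 - v') + (v2 - v' - (v1 - v')).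
    by apply: maxD; rewrite lerB.
  rewrite lerBlDr (@le_trans _ _ (s' + Num.max 0 (v2 - v')))//; last lra.
  by apply: ge_inf => //; right; exists s', v'.
have f_gt0 (v : R) : 0 < v -> 0 < f v.
  (* Data with [s' <= d] have [v' <= v / 2], so their ramps have risen by [v / 2] at [v]; the
     remaining data contribute more than [d]. *)
  move=> v0; have [|d d0 hd] := Psmall (v / 2); first by rewrite divr_gt0.
  apply: (@lt_le_trans _ _ (Num.min d (v / 2))); first by rewrite lt_min d0 divr_gt0.
  apply: lb_le_inf => // w [->|[s' [v' [Psv ->]]]].
    by rewrite ge_min; apply/orP; right; rewrite le_max; apply/orP; right; lra.
  have [s'0 v'0] := P0 _ _ Psv.
  have [s'd|/ltW s'd] := leP s' d; rewrite ge_min.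
    have := hd _ _ Psv s'd => v'v.
    by apply/orP; right; rewrite -[leLHS]add0r lerD// le_max; apply/orP; right; lra.
  by apply/orP; left; rewrite -[leLHS]addr0 lerD// le_max lexx.
have f0 : f 0 = 0.
  apply/eqP; rewrite eq_le; apply/andP; split.
    by apply: ge_inf => //; left; rewrite maxxx.
  apply: lb_le_inf => // w [->|[s' [v' [/P0[s'0 v'0] ->]]]]; first by rewrite le_max lexx.
  by rewrite addr_ge0// le_max lexx.
have f_ge0 (v : R) : 0 <= v -> 0 <= f v.
  by rewrite le_eqVlt => /predU1P[<-|/f_gt0/ltW//]; rewrite f0.
have f_unbnd M : exists2 v, 0 <= v & M < f v.
  have [B hB] := Pbnd (`|M| + 1).
  exists (`|B| + `|M| + 1); first by rewrite !addr_ge0.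
  apply: (@lt_le_trans _ _ (`|M| + 1)); first by have := ler_norm M; lra.
  apply: lb_le_inf => // w [->|[s' [v' [Psv ->]]]].
    by rewrite le_max; apply/orP; right; have := normr_ge0 B; lra.
  have [s'0 v'0] := P0 _ _ Psv.
  have [s'd|/ltW s'd] := leP s' (`|M| + 1).
    have := hB _ _ Psv s'd => v'v.
    rewrite -[leLHS]add0r lerD// le_max; apply/orP; right.
    by have := ler_norm B; lra.
  by rewrite -[leLHS]addr0 lerD// le_max lexx.
pose g (v : R) := v / (1 + v).
have g_ge0 (v : R) : 0 <= v -> 0 <= g v by move=> v0; rewrite divr_ge0// addr_ge0.
have g_lt1 (v : R) : 0 <= v -> g v < 1.
  by move=> v0; rewrite ltr_pdivrMr ?mul1r ?ltrDr// ltr_wpDr.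
have g_lt (v1 v2 : R) : 0 <= v1 -> v1 < v2 -> g v1 < g v2.
  move=> v10 v12; have v20 : 0 <= v2 by rewrite (le_trans v10)// ltW.
  by rewrite ltr_pdivrMr ?ltr_wpDr// mulrAC ltr_pdivlMr ?ltr_wpDr//; lra.
exists (fun v : R => f v * g v); last first.
  move=> s v Psv; have [s0 v0] := P0 _ _ Psv.
  by apply: le_trans (fle _ _ Psv); rewrite ler_piMr ?f_ge0// ltW ?g_lt1.
split; last first.
  move=> M; have [v v0 Mv] := f_unbnd (2 * `|M|).
  exists (v + 1); first by rewrite addr_ge0.
  have h1 : f v <= f (v + 1) by have := @fhomo v (v + 1); rewrite lerDl => /(_ ler01)/andP[].
  have h2 : 2^-1 <= g (v + 1).
    by rewrite ler_pdivlMr; [lra|lra].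
  apply: (@lt_le_trans _ _ (f v * 2^-1)).
    by have := ler_norm M; rewrite ltr_pdivlMr//; lra.
  by apply: ler_pM; rewrite ?f_ge0.
split.
- apply: continuous_in_subspaceT => r; rewrite inE/= in_itv/= andbT => r0.
  apply: cvgM; last first.
    apply: cvgM => //; apply: cvgV; first by rewrite gt_eqF// ltr_wpDr.
    by apply: cvgD => //; exact: cvg_cst.
  apply/cvgrPdist_le => e e0; exists e => //= s /ltW rs.
  have [h|/ltW h] := leP r s.
    by have := fhomo _ _ h; move: rs; rewrite distrC ger0_norm ?subr_ge0// distrC => rs /andP[h1 h2]; rewrite ger0_norm ?subr_ge0//; lra.
  by have := fhomo _ _ h; move: rs; rewrite ger0_norm ?subr_ge0// => rs /andP[h1 h2]; rewrite ger0_norm ?subr_ge0//; lra.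
- move=> r s; rewrite !in_itv/= !andbT => r0 s0 rs.
  have /andP[h1 _] := fhomo _ _ (ltW rs).
  apply: (@le_lt_trans _ _ (f s * g r)); first by rewrite ler_wpM2r// g_ge0.
  by rewrite ltr_pM2l ?g_lt// f_gt0// (le_lt_trans r0).
- by rewrite f0 mul0r.
Qed.

(* The smallest majorant that is [2]-Lipschitz in [r] and nonincreasing in
   [t]; the data at [s > 2 r] do not contribute to its value at [r]. *)
Lemma class_KL_majorant (P : R -> R -> R -> Prop) :
  (forall s t v, P s t v -> [/\ 0 <= s, 0 <= t & v <= s]) ->
  (forall r e : R, 0 < r -> 0 < e -> exists T, forall s t v, P s t v -> s <= r -> T <= t -> v <= e) ->
  exists2 b, class_KL b & forall s t v, P s t v -> v <= b s t.
Proof.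
move=> P0 Pattr.
(* The slope [2] outweighs [v <= s]: for [s >= r] the contribution is at most [2 * r - s <= r],
   whence [f r t <= r] and [f 0 t = 0]. Only data at times after [t] enter, which makes [f]
   nonincreasing in [t]. *)
pose E (r t : R) := [set w | w = 0 \/
  exists s t' v, [/\ P s t' v, t <= t' & w = v - 2 * Num.max 0 (s - r)]].
pose f (r t : R) := sup (E r t).
have E0 (r t : R) : E r t !=set0 by exists 0; left.
have Eub (r t : R) : 0 <= r -> ubound (E r t) r.
  move=> r0 w [->//|[s [t' [v [/P0[s0 t'0 vs] _ ->]]]]].
  by rewrite /Num.max; case: ifPn; rewrite -?leNgt; lra.
have hub (r t : R) : 0 <= r -> has_ubound (E r t) by move=> r0; exists r; exact: Eub.
have f_ge0 (r t : R) : 0 <= r -> 0 <= f r t by move=> r0; apply: ub_le_sup; [exact: hub|left].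
have f_le (r t : R) : 0 <= r -> f r t <= r.
  by move=> r0; apply: ge_sup => //; exact: Eub.
have fhomo (r1 r2 t : R) : 0 <= r1 -> r1 <= r2 -> f r1 t <= f r2 t <= f r1 t + 2 * (r2 - r1).
  move=> r10 r12; have r20 := le_trans r10 r12.
  apply/andP; split; apply: ge_sup => // w [->|[s [t' [v [Psv tt' ->]]]]].
  - exact: f_ge0.
  - apply: (@le_trans _ _ (v - 2 * Num.max 0 (s - r2))).
      by rewrite /Num.max; do 2 case: ifPn; rewrite -?leNgt; lra.
    by apply: ub_le_sup; [exact: hub|right; exists s, t', v].
  - by have := f_ge0 r1 t r10; lra.
  - rewrite -lerBlDr.
    apply: (@le_trans _ _ (v - 2 * Num.max 0 (s - r1))).
      by rewrite /Num.max; do 2 case: ifPn; rewrite -?leNgt; lra.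
    by apply: ub_le_sup; [exact: hub|right; exists s, t', v].
have f_anti (r t1 t2 : R) : 0 <= r -> t1 <= t2 -> f r t2 <= f r t1.
  move=> r0 t12; apply: ge_sup => // w [->|[s [t' [v [Psv tt' ->]]]]].
    exact: f_ge0.
  apply: ub_le_sup; [exact: hub|right; exists s, t', v; split => //].
  exact: le_trans tt'.
have f_majorant s t v : P s t v -> v <= f s t.
  move=> Psv; have [s0 t0 vs] := P0 _ _ _ Psv.
  apply: ub_le_sup; [exact: hub|right; exists s, t, v; split => //].
  by rewrite subrr maxxx mulr0 subr0.
have f_cvg (r e : R) : 0 <= r -> 0 < e -> exists T, forall t, T <= t -> f r t <= e.
  (* Beyond [2 * r] the contributions are negative; the added [1] provides a positive radius when
     [r = 0]. *)
  move=> r0 e0; have [||T hT] := Pattr (2 * r + 1) e; [lra|by []|].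
  exists T => t Tt; apply: ge_sup => // w [->|[s [t' [v [Psv tt' ->]]]]].
    exact: ltW.
  have [s0 t'0 vs] := P0 _ _ _ Psv.
  have [sr|sr] := leP s (2 * r + 1).
    have := hT _ _ _ Psv sr (le_trans Tt tt').
    by rewrite /Num.max; case: ifPn; rewrite -?leNgt; lra.
  by rewrite /Num.max; case: ifPn; rewrite -?leNgt; lra.
(* The added term makes the function strictly increasing and unbounded in [r], and still vanishes as
   [t] grows. *)
exists (fun r t : R => f r t + r / (1 + t)); last first.
  move=> s t v Psv; have [s0 t0 _] := P0 _ _ _ Psv.
  by rewrite (le_trans (f_majorant _ _ _ Psv))// lerDl divr_ge0// addr_ge0.
have t1_gt0 (t : R) : 0 <= t -> 0 < 1 + t by move=> t0; rewrite ltr_wpDr.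
split=> [t t0|r r0]; last first.
  split=> [t1 t2|].
    rewrite !in_itv/= !andbT => t10 t20 t12.
    rewrite lerD ?f_anti// ler_wpM2l// lef_pV2 ?posrE ?t1_gt0//.
    by rewrite lerD2l.
  apply/cvgrPdist_le => e e0.
  have [|T hT] := f_cvg r (e / 2) r0; first by rewrite divr_gt0.
  near=> t.
  have t0 : 0 <= t by near: t; apply: nbhs_pinfty_ge; rewrite num_real.
  have Tt : T <= t by near: t; apply: nbhs_pinfty_ge; rewrite num_real.
  have rt : 2 * r / e <= t by near: t; apply: nbhs_pinfty_ge; rewrite num_real.
  rewrite sub0r normrN ger0_norm ?addr_ge0 ?f_ge0 ?divr_ge0 ?(ltW (t1_gt0 _ t0))//.
  rewrite (splitr e) lerD ?hT// ler_pdivrMr ?t1_gt0//.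
  move: rt; rewrite ler_pdivrMr//; lra.
split; last first.
  move=> M; exists ((`|M| + 1) * (1 + t)); first by rewrite mulr_ge0 ?addr_ge0.
  rewrite mulfK ?gt_eqF ?t1_gt0//.
  have := f_ge0 ((`|M| + 1) * (1 + t)) t; rewrite mulr_ge0 ?addr_ge0// => /(_ isT).
  by have := ler_norm M; lra.
split.
- apply/within_nneg_continuousP => r e r0 e0.
  exists (e / 3); first by rewrite divr_gt0.
  move=> s s0 rs.
  have t1V : (1 + t)^-1 <= 1 by rewrite invf_le1 ?t1_gt0// lerDl.
  have t1V0 : 0 <= (1 + t)^-1 by rewrite invr_ge0 ltW ?t1_gt0.
  have [h|/ltW h] := leP r s.
    have /andP[h1 h2] := fhomo _ _ t r0 h.
    have h3 : 0 <= (s - r) / (1 + t) <= s - r.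
      by rewrite mulr_ge0 ?subr_ge0//= ler_piMr ?subr_ge0.
    move: h3; rewrite mulrBl => /andP[h3 h4].
    move: rs; rewrite ger0_norm ?subr_ge0// => rs.
    by rewrite ger0_norm ?subr_ge0//; lra.
  have /andP[h1 h2] := fhomo _ _ t s0 h.
  have h3 : 0 <= (r - s) / (1 + t) <= r - s.
    by rewrite mulr_ge0 ?subr_ge0//= ler_piMr ?subr_ge0.
  move: h3; rewrite mulrBl => /andP[h3 h4].
  move: rs; rewrite distrC ger0_norm ?subr_ge0// => rs.
  by rewrite distrC ger0_norm ?subr_ge0//; lra.
- move=> r s; rewrite !in_itv/= !andbT => r0 s0 rs.
  have /andP[h1 _] := fhomo _ _ t r0 (ltW rs).
  by rewrite ler_ltD// ltr_pM2r// invr_gt0 t1_gt0.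
- rewrite mul0r addr0; apply/eqP; rewrite eq_le f_ge0// andbT.
  exact: f_le.
Unshelve. all: by end_near. Qed.

End comparison.

(** * Absolutely continuous functions and almost everywhere derivatives *)

Section ae_calculus.
Variable R : realType.
Implicit Types (a b c d e t : R) (w : R -> R) (E : set R).

(** Both sides amount to vanishing outer measure, so exceptional sets may be covered by open sets
    whichever measure they come from. *)
Lemma completed_negligibleP E :
  (@completed_lebesgue_measure R).-negligible E <->
  (@lebesgue_measure R).-negligible E.
Proof.
split=> [[/= A [mA A0 EA]]|[/= A [mA A0 EA]]].
  apply/negligible_outer_measure/eqP.
  by rewrite eq_le outer_measure_ge0 andbT -A0 le_outer_measure.
by exists A; split => //=; exact: sub_caratheodory.
Qed.

Lemma negligible_open_cover E e :
  (@completed_lebesgue_measure R).-negligible E -> 0 < e ->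
  exists U : set R, [/\ open U, E `<=` U & (lebesgue_measure U <= e%:E)%E].
Proof.
move=> /completed_negligibleP/negligible_outer_measure E0 e0.
have [U [oU EU mU]] := outer_measure_open_le E e0.
by exists U; split => //; move: mU; rewrite E0 add0e.
Qed.

(** The supremum of the points reached is straddled by some [c] with [P c] and a point [d] beyond
    it, unless it is already [b]. Steps straddling a point are what derivatives and open covers both
    provide. *)
Lemma real_induction (P : R -> Prop) a b : a <= b -> P a ->
  (forall t, a <= t <= b -> exists2 r : R, 0 < r &
    forall c d, a <= c -> c <= t -> t <= d -> d <= b -> d - c < r -> P c -> P d) ->
  P b.
Proof.
move=> ab Pa step.
pose A := [set t | a <= t <= b /\ P t].
have A0 : A a by split => //; rewrite lexx.
have Aub : ubound A b by move=> t [/andP[]].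
have supA : has_sup A by split; [exists a|exists b].
have as_ : a <= sup A by apply: ub_le_sup => //; exists b.
have sb : sup A <= b by apply: ge_sup => //; exists a.
have [|r r0 hr] := step (sup A); first by rewrite as_.
have r20 : 0 < r / 2 by rewrite divr_gt0.
have [c [/andP[ac cb] Pc] cs] := sup_adherent r20 supA.
have cs' : c <= sup A by apply: ub_le_sup; [exists b|split => //; rewrite ac].
pose d := Num.min b (sup A + r / 3).
have dle : d <= b by rewrite ge_min lexx.
have sd : sup A <= d by rewrite le_min sb/= lerDl divr_ge0// ltW.
have dr : d <= sup A + r / 3 by rewrite ge_min lexx orbT.
have Pd : P d by apply: (hr c d) => //; lra.
have : d <= sup A.
  by apply: ub_le_sup; [exists b|split => //; rewrite dle (le_trans as_)].
rewrite ge_min => /orP[h|h]; last lra.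
by suff <- : d = b by []; apply/eqP; rewrite eq_le dle (le_trans h).
Qed.

Definition abs_continuous_fun a b w := forall e, 0 < e -> exists2 del : R, 0 < del &
  forall (k : nat) (p q : 'I_k -> R),
    (forall i, [/\ a <= p i, p i <= q i & q i <= b]) ->
    trivIset setT (fun i => `]p i, q i[%classic) ->
    \sum_(i < k) (q i - p i) < del ->
    \sum_(i < k) `|w (q i) - w (p i)| < e.

Lemma sum_length_le (U : set R) k (p q : 'I_k -> R) : open U ->
  (forall i, p i <= q i) -> (forall i, `]p i, q i[ `<=` U) ->
  trivIset setT (fun i => `]p i, q i[%classic) ->
  ((\sum_(i < k) (q i - p i))%:E <= lebesgue_measure U)%E.
Proof.
move=> oU pq sub tI.
have -> : (\sum_(i < k) (q i - p i))%:E =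
    lebesgue_measure (\big[setU/set0]_(i < k) `]p i, q i[%classic).
  rewrite measure_bigsetU_ord//=.
  rewrite -sumEFin; apply: eq_bigr => i _; rewrite lebesgue_measure_itv/= lte_fin.
  case: ltP => // h; suff -> : p i = q i by rewrite subrr.
  by apply/eqP; rewrite eq_le pq.
apply: le_measure; rewrite ?inE.
- by apply: bigsetU_measurable => i _; exact: measurable_itv.
- exact: open_measurable.
- elim/big_ind : _ => //; first by move=> A B sA sB x [/sA|/sB].
Qed.

(* Away from [E] the function increases at most like [e * (d - c)]; the
   intervals meeting [E] are taken in an open set of small measure, so that
   absolute continuity bounds their total contribution. *)
Lemma ae_nonincreasing a b w E : a <= b -> abs_continuous_fun a b w ->
  (@completed_lebesgue_measure R).-negligible E ->
  (forall t, a < t < b -> ~ E t -> forall e, 0 < e -> exists2 r : R, 0 < r &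
    forall c d, a <= c -> c <= t -> t <= d -> d <= b -> d - c < r ->
      w d - w c <= e * (d - c)) ->
  w b <= w a.
Proof.
move=> ab ACw E0 wE.
suff h e : 0 < e -> w b - w a <= e * (b - a) + e.
  rewrite -subr_le0; apply/ler_addgt0Pr => e e0; rewrite add0r.
  have ba0 : 0 < b - a + 1 by lra.
  have := h (e / (b - a + 1)) (divr_gt0 e0 ba0).
  suff -> : e / (b - a + 1) * (b - a) + e / (b - a + 1) = e by [].
  by rewrite -[X in _ + X]mulr1 -mulrDr divfK// gt_eqF.
move=> e0; have [del del0 hdel] := ACw e e0.
(* The increment condition says nothing at the endpoints, so they join the exceptional set. *)
pose E' := E `|` ([set a] `|` [set b]).
have E'0 : (@completed_lebesgue_measure R).-negligible E'.
  apply: negligibleU => //; apply/completed_negligibleP.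
  apply: negligibleU; apply/negligibleP => //=; exact: lebesgue_measure_set1.
have [U [oU EU mU]] := negligible_open_cover E'0 (divr_gt0 del0 (ltr0Sn R 1)).
(* The invariant of the induction: growth at rate [e], plus the variation over finitely many
   disjoint intervals inside [U], to which absolute continuity is applied once at the end. *)
pose P t := exists k (p q : 'I_k -> R), [/\
  forall i, [/\ a <= p i, p i <= q i & q i <= t],
  forall i, `]p i, q i[ `<=` U,
  trivIset setT (fun i => `]p i, q i[%classic) &
  w t - w a <= e * (t - a) + \sum_(i < k) `|w (q i) - w (p i)|].
have [k [p [q [pq pqU tI hw]]]] : P b.
  apply: (@real_induction P a b) => //.
    exists 0, (fun=> 0), (fun=> 0); split; [by case|by case|by move=> []|].
    by rewrite big_ord0 !subrr mulr0 addr0.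
  move=> t /andP[at_ tb].
  have [Ut|nUt] := pselect (U t).
    have [r r0 rU] : exists2 r : R, 0 < r & ball t r `<=` U.
      by move: oU; rewrite openE => /(_ _ Ut)[r /= r0 hr]; exists r.
    exists r => // c d ac ct td db dcr [k [p [q [pq pqU tI hw]]]].
    (* [[c, d]] becomes the last interval of the family; it is disjoint from the others because they
       all end at or before [c]. *)
    pose ext (f : 'I_k -> R) x (i : 'I_k.+1) := if unlift ord_max i is Some j then f j else x.
    have extl f x i : ext f x (lift ord_max i) = f i by rewrite /ext liftK.
    have extm f x : ext f x ord_max = x by rewrite /ext unlift_none.
    exists k.+1, (ext p c), (ext q d); split.
    - move=> i; case: (unliftP ord_max i) => [j ->|->]; rewrite ?extl ?extm.
        by have [h1 h2 h3] := pq j; split => //; lra.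
      by split => //; lra.
    - move=> i; case: (unliftP ord_max i) => [j ->|->]; rewrite ?extl ?extm.
        exact: pqU.
      move=> x /=; rewrite in_itv/= => /andP[cx xd]; apply: rU.
      by rewrite /ball/= ltr_norml; lra.
    - apply/trivIsetP => i j _ _; have [i' ->|->] := unliftP ord_max i; last first.
        have [j' ->|->] := unliftP ord_max j; last by rewrite eqxx.
        move=> _; rewrite !extl !extm; have [_ _ h] := pq j'.
        apply/seteqP; split => // x /= []; rewrite !in_itv/= => /andP[h1 h2] /andP[h3 h4].
        by lra.
      have [j' ->|->] := unliftP ord_max j; last first.
        move=> _; rewrite !extl !extm; have [_ _ h] := pq i'.
        apply/seteqP; split => // x /= []; rewrite !in_itv/= => /andP[h1 h2] /andP[h3 h4].
        by lra.
      rewrite !extl => ij; apply: (trivIsetP.1 tI) => //.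
      by apply: contraNneq ij => ->.
    - rewrite big_ord_recr/= !extm.
      under eq_bigr => i _.
        rewrite (_ : widen_ord _ i = lift ord_max i); last first.
          by apply/val_inj/esym/lift_max.
        rewrite !extl; over.
      have := ler_norm (w d - w c).
      have : 0 <= e * (d - c) by rewrite mulr_ge0 ?(ltW e0)//; lra.
      by move: hw; rewrite !mulrBr; lra.
  have [||r r0 hr] := wE t _ _ e e0.
  - rewrite !lt_neqAle at_ tb !andbT; apply/andP; split.
      by apply/eqP => h; apply: nUt; apply: EU; right; left.
    by apply/eqP => h; apply: nUt; apply: EU; right; right.
  - by move=> Et; apply: nUt; apply: EU; left.
  exists r => // c d ac ct td db dcr [k [p [q [pq pqU tI hw]]]].
  exists k, p, q; split => // [i|].
    by have [h1 h2 h3] := pq i; split => //; lra.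
  by have := hr c d ac ct td db dcr; move: hw; rewrite !mulrBr; lra.
rewrite (le_trans hw)// lerD2l ltW// hdel//.
rewrite -lte_fin (le_lt_trans (sum_length_le oU _ pqU tI))//.
  by move=> i; case: (pq i).
by rewrite (le_lt_trans mU)// lte_fin ltr_pdivrMr// ltr_pMr// ltr1n.
Qed.

End ae_calculus.

(** * Increment estimates from almost everywhere derivatives *)

Section derivatives.
Variable R : realType.

Lemma is_deriveP (V : normedModType R) (f : R -> V) (t : R) (l : V) :
  is_derive t 1 f l <->
  forall e : R, 0 < e -> exists2 r : R, 0 < r &
    forall h, `|h| < r -> `|f (t + h) - f t - h *: l| <= e * `|h|.
Proof.
have key : is_derive t 1 f l <-> h^-1 *: (f (h *: 1 + t) - f t) @[h --> 0^'] --> l.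
  split=> [[/cvg_ex/= [l' h] <-]|h].
    by rewrite /derive /=; move: (h); rewrite (cvg_lim _ h).
  by apply: DeriveDef; [apply/cvg_ex; exists l|apply/cvg_lim].
rewrite key; split => [/cvgrPdist_le h e e0|h].
  have [r /= r0 hr] := h e e0; exists r => // h' h'r.
  have [->|h'0] := eqVneq h' 0; first by rewrite addr0 subrr scale0r subr0 !normr0 mulr0.
  have := hr h'; rewrite /= sub0r normrN => /(_ h'r h'0).
  rewrite (_ : h' *: 1 = h'); last by rewrite /GRing.scale/= mulr1.
  move=> H; rewrite (addrC t) -[X in X - _ *: _](scalerKV h'0) -scalerBr normrZ mulrC.
  by rewrite ler_pM2r ?normr_gt0// distrC.
apply/cvgrPdist_le => e e0; have [r r0 hr] := h e e0.
exists r => //= h' /=; rewrite sub0r normrN => h'r h'0.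
rewrite (_ : h' *: 1 = h'); last by rewrite /GRing.scale/= mulr1.
have := hr h' h'r; rewrite (addrC t) -[X in X - _ *: _](scalerKV h'0) -scalerBr normrZ mulrC.
by rewrite ler_pM2r ?normr_gt0// distrC.
Qed.

(** The straddle lemma: splitting the increment at [t] leaves two one-sided errors whose lengths add
    up to [d - c]. This is the form that [ae_nonincreasing] consumes. *)
Lemma is_derive_straddle (V : normedModType R) (f : R -> V) (t : R) (l : V) :
  is_derive t 1 f l -> forall e : R, 0 < e -> exists2 r : R, 0 < r &
    forall c d, c <= t -> t <= d -> d - c < r ->
      `|f d - f c - (d - c) *: l| <= e * (d - c).
Proof.
move=> /is_deriveP h e e0; have [r r0 hr] := h e e0; exists r => // c d ct td dcr.
have h1 := hr (d - t); have h2 := hr (c - t).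
rewrite !subrKC in h1 h2.
have -> : f d - f c - (d - c) *: l =
    (f d - f t - (d - t) *: l) - (f c - f t - (c - t) *: l).
  have -> : (d - c) *: l = (d - t) *: l - (c - t) *: l.
    by rewrite -scalerBl; congr (_ *: _); ring.
  by rewrite [in RHS]opprD opprK (opprB (f c)) addrACA subrKA opprB (addrC (- _)).
have dt0 : `|d - t| = d - t by rewrite ger0_norm// subr_ge0.
have ct0 : `|c - t| = t - c by rewrite distrC ger0_norm// subr_ge0.
rewrite (le_trans (ler_normB _ _))// (_ : d - c = (d - t) + (t - c)); last by ring.
rewrite mulrDr lerD//.
  by rewrite -[X in _ <= _ * X]dt0 h1// dt0; lra.
by rewrite -[X in _ <= _ * X]ct0 h2// ct0; lra.
Qed.

Variable n : nat.
Implicit Types (a b c d t K M : R) (x z : R -> 'rV[R]_n) (v : 'rV[R]_n) (w : R -> R).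

Lemma is_derive_coord x t v i : is_derive t 1 x v ->
  is_derive t 1 (fun s => x s ord0 i) (v ord0 i).
Proof.
move=> /is_deriveP h; apply/is_deriveP => e e0; have [r r0 hr] := h e e0.
exists r => // h' h'r; apply: le_trans (hr h' h'r).
by apply: le_trans (coord_le_norm _ i); rewrite !mxE.
Qed.

Lemma is_derive_row x t v :
  (forall i, is_derive t 1 (fun s => x s ord0 i) (v ord0 i)) -> is_derive t 1 x v.
Proof.
move=> xv; apply/is_deriveP => e e0.
pose P (i : 'I_n) (h : R) := `|x (t + h) ord0 i - x t ord0 i - h *: v ord0 i| <= e * `|h|.
have : \forall h \near nbhs (0 : R), forall i, P i h.
  apply: filter_forall => i; have /is_deriveP/(_ e e0)[r r0 hr] := xv i.
  by exists r => //= h; rewrite /= sub0r normrN => /hr.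
move=> [r /= r0 hr]; exists r => // h h'r.
rewrite [leLHS]/Num.Def.normr/= mx_normrE bigmax_le ?mulr_ge0 ?(ltW e0)// => -[i j] _ /=.
by rewrite !mxE (ord1 i); apply: (hr h _ j); rewrite /= sub0r normrN.
Qed.

Lemma is_derive_straddle_enorm x t v : is_derive t 1 x v ->
  forall e : R, 0 < e -> exists2 r : R, 0 < r &
    forall c d, c <= t -> t <= d -> d - c < r ->
      enorm (x d - x c - (d - c) *: v) <= e * (d - c).
Proof.
move=> /is_derive_straddle h e e0; have n0 : 0 < n%:R + 1 :> R by rewrite ltr_wpDl.
have [r r0 hr] := h _ (divr_gt0 e0 n0); exists r => // c d ct td dcr.
rewrite (le_trans (enorm_le_norm _))// (le_trans (ler_wpM2l _ (hr c d ct td dcr)))//.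
have dc0 : 0 <= d - c by lra.
rewrite mulrA ler_wpM2r// mulrCA ler_piMr ?(ltW e0)//.
by rewrite ler_pdivrMr// mul1r lerDl.
Qed.

(** Transfers absolute continuity from two trajectories to a scalar quantity built from them. Each
    of the three sums receives a third of [e / (K + 1)], where [K + 1] avoids dividing by zero. *)
Lemma abs_continuous_fun_dominated a b x z w K : 0 <= K ->
  abs_continuous a b x -> abs_continuous a b z ->
  (forall p q, a <= p -> p <= q -> q <= b -> `|w q - w p| <=
     K * (enorm (x q - x p) + enorm (z q - z p) + (q - p))) ->
  abs_continuous_fun a b w.
Proof.
move=> K0 ACx ACz hw e e0.
have e'0 : 0 < e / (K + 1) / 3 by rewrite !divr_gt0// ltr_wpDl.
have [d1 d10 h1] := ACx _ e'0; have [d2 d20 h2] := ACz _ e'0.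
exists (Num.min (Num.min d1 d2) (e / (K + 1) / 3)); first by rewrite !lt_min d10 d20.
move=> k p q pq tI; rewrite !lt_min => /andP[/andP[/(h1 k p q pq tI) s1 /(h2 k p q pq tI) s2] s3].
apply: (@le_lt_trans _ _ (\sum_(i < k) K * (enorm (x (q i) - x (p i)) + enorm (z (q i) - z (p i)) + (q i - p i)))).
  by apply: ler_sum => i _; have [*] := pq i; exact: hw.
rewrite -mulr_sumr big_split big_split/=.
apply: (@le_lt_trans _ _ (K * (e / (K + 1)))).
  by rewrite ler_wpM2l//; move: (e / (K + 1)) s1 s2 s3 => y; lra.
by rewrite mulrCA gtr_pMr// ltr_pdivrMr ?ltr_wpDl// mul1r ltrDl.
Qed.

Lemma lipschitz_abs_continuous a b x M :
  (forall p q, a <= p -> p <= q -> q <= b -> enorm (x q - x p) <= M * (q - p)) ->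
  abs_continuous a b x.
Proof.
move=> xM e e0; have M0 : 0 < `|M| + 1 by rewrite ltr_wpDl.
exists (e / (`|M| + 1)); first by rewrite divr_gt0.
move=> k p q pq tI; rewrite ltr_pdivlMr// => hs.
apply: le_lt_trans hs; rewrite mulrC mulr_sumr; apply: ler_sum => i _.
have [h1 h2 h3] := pq i; rewrite (le_trans (xM _ _ h1 h2 h3))//.
by rewrite ler_wpM2r ?subr_ge0//; have := ler_norm M; lra.
Qed.

(** A mean value inequality, obtained by monotonicity of [enorm (x s - x a) - M * (s - a)]. The
    triangle inequality on straddling intervals replaces differentiation of the norm, which fails at
    zero. *)
Lemma ae_derivative_le a b x M E : a <= b -> 0 <= M -> abs_continuous a b x ->
  (@completed_lebesgue_measure R).-negligible E ->
  (forall t, a < t < b -> ~ E t -> exists2 v, is_derive t 1 x v & enorm v <= M) ->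
  enorm (x b - x a) <= M * (b - a).
Proof.
move=> ab M0 ACx E0 xE.
have := @ae_nonincreasing R a b (fun s => enorm (x s - x a) - M * (s - a)) E ab.
rewrite !subrr enorm0 mulr0 subr0 subr_le0; apply => //.
  apply: (@abs_continuous_fun_dominated a b x x _ (M + 1)) => //; first lra.
  move=> p q ap pq qb.
  have h1 := enorm_dist_trans (x q) (x p) (x a).
  have h2 := enorm_dist_trans (x p) (x q) (x a).
  rewrite (enorm_distC (x p) (x q)) in h2.
  have h3 := enorm_ge0 (x q - x p).
  have h4 : 0 <= M * (q - p) by rewrite mulr_ge0 ?subr_ge0.
  have h5 : 0 <= M * enorm (x q - x p) by rewrite mulr_ge0.
  by rewrite ler_norml; apply/andP; split; lra.
move=> t tab Et e e0; have [v xv vM] := xE t tab Et.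
have [r r0 hr] := is_derive_straddle_enorm xv e0.
exists r => // c d ac ct td db dcr.
have := hr c d ct td dcr.
have h1 := enorm_dist_trans (x d) (x c) (x a).
have := enorm_subr (x d - x c) ((d - c) *: v).
have dc0 : 0 <= d - c by lra.
rewrite enormZ ger0_norm// => h2 h3.
have := ler_wpM2l dc0 vM; lra.
Qed.

End derivatives.

(** * Local existence of Caratheodory solutions *)

Section primitives.
Variable R : realType.

(** The Caratheodory sigma-algebra is the completion of the Borel one. *)
Lemma caratheodory_borel (A : set R) :
  measurable (A : set (lebesgueR R)) ->
  exists2 B : set R, measurable B &
    (@lebesgue_measure R).-negligible ((A `\` B) `|` (B `\` A)).
Proof.
move=> mA; have : ((@completed_algebra_gen _ _ R (@lebesgue_measure R)).-sigma.-measurable A).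
  by rewrite completed_caratheodory_measurable.
rewrite g_sigma_completed_algebra_genE => -[B mB [N N0 <-]].
exists B => //; apply: negligibleS N0 => x [[[Bx|//] nBx]|[Bx nBNx]].
  by [].
by exfalso; apply: nBNx; left.
Qed.

(** The function is the supremum of the rationals whose superlevel set contains the point. Replacing
    each superlevel set by a Borel one alters it on a null set, and there are countably many.
    Clipping to [[m, M]] preserves the bounds everywhere. *)
Lemma borel_version (h : R -> R) (m M : R) :
  measurable_fun setT (h : lebesgueR R -> R) ->
  (forall t, m <= h t <= M) ->
  exists g : R -> R, [/\ measurable_fun setT g, forall t, m <= g t <= M &
    (@lebesgue_measure R).-negligible [set t | g t <> h t]].
Proof.
move=> mh hb.
have mM : m <= M by have /andP[h1 h2] := hb 0; exact: le_trans h2.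
(* An enumeration of the rationals; indices that decode to nothing repeat the rational [0], which is
   harmless. *)
pose q (n : nat) : R := if @choice.unpickle rat n is Some r then ratr r else 0.
have /choice[B hB] : forall n, exists B : set R, measurable B /\
    (@lebesgue_measure R).-negligible (([set t | q n < h t] `\` B) `|` (B `\` [set t | q n < h t])).
  move=> n; have [|B mB B0] := @caratheodory_borel [set t | q n < h t].
    have := mh measurableT `]q n, +oo[%classic (measurable_itv _).
    rewrite setTI; congr (measurable _); apply/seteqP; split => t /=;
    by rewrite in_itv/= andbT.
  by exists B.
pose g_ n t := if t \in B n then Num.max m (Num.min M (q n)) else m.
have g_b n t : m <= g_ n t <= M.
  rewrite /g_; case: ifP => _; last by rewrite lexx.
  by rewrite le_max lexx/= ge_max mM ge_min lexx.
have g_ub t : has_ubound (range (g_ ^~ t)).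
  by exists M => _ [n _ <-]; have /andP[] := g_b n t.
exists (fun t => sups (g_ ^~ t) 0%N); split.
- apply: measurable_fun_sups => // n.
  apply: measurable_fun_ifT => //; try exact: measurable_cst.
  apply: (measurable_fun_bool true); rewrite setTI.
  rewrite [X in measurable X](_ : _ = B n); first exact: (hB n).1.
  by apply/seteqP; split => t /=; [exact: set_mem|exact: mem_set].
- move=> t; apply/andP; split.
    have /andP[h1 _] := g_b 0%N t; apply: le_trans h1 _.
    by apply: ub_le_sup; [exact/has_ubound_sdrop|exists 0%N].
  by apply: ge_sup; [exists (g_ 0%N t), 0%N|move=> _ [n _ <-]; have /andP[] := g_b n t].
- have := negligible_bigcup (fun n => (hB n).2); apply: negligibleS.
  move=> t /=; apply: contra_notP => nt.
  have tB n : t \in B n = (q n < h t).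
    apply/idP/idP => [/set_mem Bt|qt].
      by apply: contrapT => /negP qt; apply: nt; exists n => //; right; split => //; apply/negP.
    by rewrite inE; apply: contrapT => Bt; apply: nt; exists n => //; left.
  have /andP[hm hM] := hb t.
  apply/eqP; rewrite eq_le; apply/andP; split.
    apply: ge_sup; first by exists (g_ 0%N t), 0%N.
    move=> _ [n _ <-]; rewrite /g_ tB; case: ifPn => // /ltW qh.
    by rewrite ge_max hm ge_min qh orbT.
  rewrite leNgt; apply/negP => /rat_in_itvoo[r]; rewrite in_itv/= => /andP[h1 h2].
  have : g_ (choice.pickle r) t <= sups (g_ ^~ t) 0%N.
    by apply: ub_le_sup; [exact/has_ubound_sdrop|exists (choice.pickle r)].
  apply/negP; rewrite -ltNge /g_ tB /q choice.pickleK h2.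
  by rewrite lt_max lt_min h1 (lt_trans h1 (lt_le_trans h2 hM)) orbT.
Qed.

Lemma bounded_integrable (g : R -> R) (m M : R) (A : set R) :
  measurable A -> (lebesgue_measure A < +oo)%E ->
  measurable_fun setT g -> (forall t, m <= g t <= M) ->
  lebesgue_measure.-integrable A (EFin \o g).
Proof.
move=> mA Aoo mg gb; apply: measurable_bounded_integrable => //.
  exact: measurable_funS mg.
exists (`|m| + `|M|); split; first exact: num_real.
move=> y hy t _; apply: le_trans (ltW hy).
have /andP[h1 h2] := gb t; rewrite ler_norml.
have := ler_norm M; have := ler_norm (- m); rewrite normrN.
by have := normr_ge0 m; have := normr_ge0 M; lra.
Qed.

Lemma lebesgue_itv_lty (i : interval R) (a b : R) :
  [set` i] `<=` `[a, b] -> (lebesgue_measure [set` i] < +oo)%E.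
Proof.
move=> sub; have : (lebesgue_measure [set` i] <= lebesgue_measure (`[a, b] : set R))%E.
  by apply: le_measure => //; rewrite inE; exact: measurable_itv.
move/le_lt_trans; apply; rewrite lebesgue_measure_itv/=.
by case: ifPn => // _; rewrite -EFinB ltry.
Qed.

(** The identity map pushes the completed measure forward to the Borel one, so this is a change of
    variables. *)
Lemma integral_completed (g : R -> \bar R) (D : set R) :
  measurable D -> measurable_fun D g -> (forall t, 0 <= g t)%E ->
  (\int[completed_lebesgue_measure]_(t in (D : set (lebesgueR R))) g t =
  \int[lebesgue_measure]_(t in D) g t)%E.
Proof.
move=> mD mg g0.
have mid : measurable_fun setT (idfun : lebesgueR R -> measurableTypeR R).
  by move=> _ A mA; rewrite setTI preimage_id; exact: sub_caratheodory.
rewrite -[LHS]/(\int[completed_lebesgue_measure]_(t in (idfun : lebesgueR R -> measurableTypeR R) @^-1` D) (g \o idfun) t)%E.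
by rewrite -(ge0_integral_pushforward mid).
Qed.

(** The fundamental theorem of calculus is applied to a Borel version of [h], extended by [m]
    outside [[a, b]]; the points where the version differs join the exceptional set. The increment
    bounds later give Lipschitz continuity, and the last clause links the primitive to the
    energy. *)
Lemma exists_primitive (h : R -> R) (a b m M : R) : a <= b ->
  measurable_fun (`[a, b] : set (lebesgueR R)) (h : lebesgueR R -> R) ->
  (forall t, a <= t <= b -> m <= h t <= M) ->
  exists (H : R -> R) (E : set R), [/\ H a = 0,
    forall c d, a <= c -> c <= d -> d <= b -> m * (d - c) <= H d - H c <= M * (d - c),
    (@completed_lebesgue_measure R).-negligible E,
    forall t, a < t < b -> ~ E t -> is_derive t 1 H (h t) &
    0 <= m -> forall t, a <= t <= b ->
      (H t)%:E = (\int[completed_lebesgue_measure]_(s in (`]a, t] : set (lebesgueR R))) (h s)%:E)%E].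
Proof.
move=> ab mh hb.
have mM : m <= M.
  have /andP[h1 h2] : m <= h a <= M by apply: hb; rewrite lexx.
  exact: le_trans h2.
pose h' := fun t : R => if a <= t <= b then h t else m.
have h'b t : m <= h' t <= M.
  by rewrite /h'; case: ifPn => [/hb//|_]; rewrite lexx.
have mh' : measurable_fun setT (h' : lebesgueR R -> R).
  have mab : measurable (`[a, b] : set (lebesgueR R)).
    by apply: sub_caratheodory; exact: measurable_itv.
  rewrite -(setUv (`[a, b] : set R)); apply/measurable_funU => //.
    exact: measurableC.
  split.
    apply: eq_measurable_fun mh => t; rewrite inE/= in_itv/= /h' => ->//.
  apply: (@eq_measurable_fun _ _ _ _ _ (cst m)); last exact: measurable_cst.
  by move=> t; rewrite inE/= in_itv/= /h' => /negP/negbTE ->.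
have [g [mg gb g0]] := borel_version mh' h'b.
have gint (i : interval R) (c d : R) : [set` i] `<=` `[c, d] ->
    lebesgue_measure.-integrable [set` i] (EFin \o g).
  move=> sub; apply: bounded_integrable mg gb; first exact: measurable_itv.
  exact: lebesgue_itv_lty sub.
have glint y : lebesgue_measure.-integrable [set` Interval (BLeft a) (BRight y)] (EFin \o g).
  exact: (gint _ a y).
have gloc : locally_integrable [set: R] g.
  split => //; first exact: openT.
  move=> K _ cK.
  have /integrableP[_] : lebesgue_measure.-integrable K (EFin \o g).
    apply: bounded_integrable mg gb; first exact: compact_measurable.
    exact: compact_finite_measure.
  by [].
have [E [mE E0 hE]] := FTC1 glint gloc.
exists (fun x => \int[lebesgue_measure]_(t in `[a, x]) g t)%R, (E `|` [set t | g t <> h' t]).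
have Hdiff (c d : R) : a <= c -> c <= d ->
    (\int[lebesgue_measure]_(t in `[a, d]) g t - \int[lebesgue_measure]_(t in `[a, c]) g t =
    \int[lebesgue_measure]_(t in `]c, d]) g t)%R.
  by move=> ac cd; rewrite Rintegral_itvB.
have Hcst (c d r : R) : c <= d -> (\int[lebesgue_measure]_(t in `]c, d]) r = r * (d - c))%R.
  move=> cd; rewrite Rintegral_cst//= lebesgue_measure_itv/= lte_fin.
  case: ltP => // dc; rewrite /= mulr0.
  by have -> : d = c by [apply/eqP; rewrite eq_le dc]; rewrite subrr mulr0.
split.
- by rewrite set_itv1 Rintegral_set1.
- move=> c d ac cd db; rewrite Hdiff//.
  have icst (r : R) : lebesgue_measure.-integrable [set` `]c, d]] (EFin \o cst r).
    apply: (@bounded_integrable _ r r) => //; first 1 last.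
      by move=> t; rewrite /= lexx.
    by apply: (@lebesgue_itv_lty _ c d); exact: subset_itv_oc_cc.
  have gi : lebesgue_measure.-integrable [set` `]c, d]] (EFin \o g).
    by apply: (gint _ c d); exact: subset_itv_oc_cc.
  rewrite -(Hcst c d m cd) -(Hcst c d M cd); apply/andP; split; apply: le_Rintegral => //; try exact: icst;
  by move=> t _; have /andP[] := gb t.
- apply: negligibleU; last by apply/completed_negligibleP; exact: g0.
  by apply/completed_negligibleP; exists E; split.
- move=> t /andP[at_ tb] /not_orP[nE /contrapT gh].
  have /contrapT := contra_not (hE t) nE.
  move=> /= hd; have [|dH Hg] := hd; first by rewrite lte_fin.
  apply: DeriveDef => //.
  by rewrite -derive1E Hg gh /h' (ltW at_) (ltW tb).
- move=> m0 t /andP[at_ tb].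
  have sub : `]a, t] `<=` `[a, t] by exact: subset_itv_oc_cc.
  have g_ge0 s : 0 <= g s by have /andP[h1 _] := gb s; exact: le_trans h1.
  have -> : (\int[completed_lebesgue_measure]_(s in (`]a, t] : set (lebesgueR R))) (h s)%:E =
    \int[completed_lebesgue_measure]_(s in (`]a, t] : set (lebesgueR R))) (g s)%:E)%E.
    apply: ge0_ae_eq_integral.
    + by apply: sub_caratheodory; exact: measurable_itv.
    + apply/measurable_EFinP; apply: measurable_funS mh.
        by apply: sub_caratheodory; exact: measurable_itv.
      by move=> s /=; rewrite !in_itv/= => /andP[/ltW -> /le_trans]; apply.
    + apply/measurable_EFinP => _ A mA; apply: sub_caratheodory.
      by have := measurable_funS measurableT (@subsetT _ `]a, t]%classic) mg; apply.
    + move=> s /=; rewrite in_itv/= => /andP[h1 h2]; rewrite lee_fin.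
      have /andP[h3 _] : m <= h s <= M by apply: hb; rewrite (ltW h1) (le_trans h2 tb).
      exact: le_trans h3.
    + by move=> s _; rewrite lee_fin.
    + have /completed_negligibleP : lebesgue_measure.-negligible [set t | g t <> h' t] by exact: g0.
      apply: negligibleS => s /=; apply: contra_not => gh.
      rewrite in_itv/= => /andP[h1 h2].
      by rewrite gh /h' (ltW h1) (le_trans h2 tb).
  rewrite (@integral_completed (fun s => (g s)%:E)); first last.
  - by move=> s; rewrite lee_fin.
  - by apply/measurable_EFinP; exact: measurable_funS mg.
  - exact: measurable_itv.
  have -> : \int[lebesgue_measure]_(s in `[a, t]) g s = \int[lebesgue_measure]_(s in `]a, t]) g s.
    by rewrite -(Hdiff a t)// set_itv1 Rintegral_set1 subr0.
  rewrite /Rintegral fineK//; apply: integrable_fin_num => //.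
  by apply: (gint _ a t).
Qed.

End primitives.

(** * Picard iteration for right-hand sides measurable in time *)

Section caratheodory.
Variables (R : realType) (n : nat).

(** Sampling [z] on a grid of step [1 / (k + 1)] freezes the state on each cell, where measurability
    in [t] alone suffices; continuity in the state then gives pointwise convergence. *)
Lemma measurable_caratheodory_comp (F : R -> 'rV[R]_n -> R) (z : R -> 'rV[R]_n)
    (a b M : R) : 0 <= a ->
  (forall xi, measurable_fun (`[0, +oo[ : set (lebesgueR R))
     (fun t : lebesgueR R => F t xi)) ->
  (forall t : R, 0 <= t -> continuous (F t)) ->
  (forall p q, a <= p -> p <= q -> q <= b -> enorm (z q - z p) <= M * (q - p)) ->
  measurable_fun (`[a, b] : set (lebesgueR R)) (fun t : lebesgueR R => F t (z t)).
Proof.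
move=> a0 mF cF zM.
have mitv (i : interval R) : measurable ([set` i] : set (lebesgueR R)).
  by apply: sub_caratheodory; exact: measurable_itv.
pose s (k : nat) : R := k.+1%:R.
have s0 k : 0 < s k by [].
(* The grid point to the left of [t], clipped at [a] because [z] is controlled only on [[a, b]]. *)
pose c (k : nat) (t : R) := Num.max a ((Num.truncn (t * s k))%:R / s k).
apply: (@measurable_fun_cvg _ _ _ _ (fun k (t : lebesgueR R) => F t (z (c k t)))).
- move=> k.
  have -> : (`[a, b] : set R)%classic =
      \bigcup_j (`[a, b] `&` `[j%:R / s k, j.+1%:R / s k[)%classic.
    apply/seteqP; split => [t tab|t [j _ []]//].
    exists (Num.truncn (t * s k)) => //; split => //=.
    move: tab => /=; rewrite !in_itv/= => /andP[at_ tb].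
    have ts0 : 0 <= t * s k by rewrite mulr_ge0 ?(ltW (s0 k))// (le_trans a0).
    rewrite ler_pdivrMr// ltr_pdivlMr//.
    by have /andP[-> ->] := truncn_itv ts0.
  apply/measurable_fun_bigcup => [j|j]; first exact: measurableI.
  apply: (@eq_measurable_fun _ _ _ _ _ (fun t : lebesgueR R => F t (z (Num.max a (j%:R / s k))))).
    move=> t; rewrite inE => -[/=]; rewrite !in_itv/= => /andP[at_ tb] /andP[h1 h2].
    have ts0 : 0 <= t * s k by rewrite mulr_ge0 ?(ltW (s0 k))// (le_trans a0).
    rewrite /c; suff -> : Num.truncn (t * s k) = j by [].
    apply/eqP; rewrite truncn_eq//.
    by move: h1 h2; rewrite ler_pdivrMr// ltr_pdivlMr// => -> ->.
  apply: measurable_funS (mF _) => //.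
  by move=> t [/=]; rewrite !in_itv/= => /andP[at_ _] _; rewrite andbT (le_trans a0).
- move=> t /=; rewrite in_itv/= => /andP[at_ tb].
  have t0 := le_trans a0 at_.
  apply: (@cvg_comp _ _ _ (fun k => z (c k t)) (F t) _ (nbhs (z t))); last exact: cF.
  apply/cvg_enorm => e e0.
  have M0 : 0 < `|M| + 1 by rewrite ltr_wpDl.
  near=> k.
  have ts0 : 0 <= t * s k by rewrite mulr_ge0 ?(ltW (s0 k)).
  have /andP[h1 h2] := truncn_itv ts0.
  have ct : c k t <= t by rewrite /c ge_max at_ ler_pdivrMr.
  have tc : t - c k t <= (s k)^-1.
    have : t - (Num.truncn (t * s k))%:R / s k <= (s k)^-1.
      by rewrite lerBlDr -[X in X + _]mul1r -mulrDl ler_pdivlMr// nat1r ltW.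
    have : (Num.truncn (t * s k))%:R / s k <= c k t by rewrite /c le_max lexx orbT.
    by move=> h3; apply: le_trans; rewrite lerD2l lerN2.
  rewrite enorm_distC (le_trans (zM (c k t) t _ ct tb))//; first by rewrite /c le_max lexx.
  apply: (@le_trans _ _ ((`|M| + 1) * (s k)^-1)).
    apply: (@le_trans _ _ ((`|M| + 1) * (t - c k t))).
      by rewrite ler_wpM2r ?subr_ge0//; have := ler_norm M; lra.
    by rewrite ler_wpM2l// ltW.
  rewrite ler_pdivrMr// mulrC -ler_pdivrMr//.
  near: k; apply: filterS (nbhs_infty_ger ((`|M| + 1) / e)) => k.
  by move=> /le_trans; apply; rewrite ler_nat.
Unshelve. all: by end_near. Qed.

Lemma geometric_cvg (u : nat -> 'rV[R]_n) :
  (forall k, enorm (u k.+1 - u k) <= 2^-1 ^+ k) ->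
  exists l, forall k, enorm (u k - l) <= 2 * 2^-1 ^+ k.
Proof.
move=> hu.
(* The subtracted tail makes the induction close: one step costs exactly its decrease. *)
have tele k j : enorm (u (k + j)%N - u k) <= 2 * 2^-1 ^+ k - 2 * 2^-1 ^+ (k + j).
  elim: j => [|j IH]; first by rewrite addn0 !subrr enorm0.
  have := enorm_dist_trans (u (k + j.+1)%N) (u (k + j)%N) (u k).
  have := hu (k + j)%N; rewrite !addnS exprS.
  by move: IH; move: (2^-1 ^+ (k + j)) => y; lra.
have h0 k : 0 <= 2^-1 ^+ k :> R by rewrite exprn_ge0// invr_ge0.
have tele' k j : (k <= j)%N -> enorm (u j - u k) <= 2 * 2^-1 ^+ k.
  by move=> /subnKC <-; have := tele k (j - k)%N; have := h0 (k + (j - k))%N; lra.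
have cvg0 : (fun k => 2 * 2^-1 ^+ k : R) @ \oo --> 0.
  rewrite -[X in _ --> X](mulr0 2); apply: cvgMr.
  by apply: cvg_expr; rewrite ger0_norm ?invr_ge0// invf_lt1 ?ltr1n.
have : cvg (u @ \oo).
  apply: cauchy_cvg; apply/cauchyP => e e0.
  have e20 : 0 < e / 2 by rewrite divr_gt0.
  have [N _ hN] := (cvgrPdist_lt _ _).1 cvg0 _ e20.
  exists (u N); exists N => // j /= Nj.
  rewrite -ball_normE /= distrC (le_lt_trans (norm_le_enorm _))//.
  rewrite (le_lt_trans (tele' _ _ Nj))//.
  have := hN N (leqnn N); rewrite sub0r normrN ger0_norm ?mulr_ge0//; lra.
move=> /cvg_ex[/= l ul]; exists l => k.
apply/ler_addgt0Pr => e e0.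
have /cvg_enorm/(_ e e0)[N _ hN] := ul.
have := enorm_dist_trans (u k) (u (maxn k N)) l.
have := tele' k (maxn k N) (leq_maxl _ _).
by have := hN (maxn k N) (leq_maxr _ _); rewrite (enorm_distC (u k) (u _)) /=; lra.
Qed.

(* Picard iteration on an interval so short that the iteration contracts by
   a factor [1/2] and does not leave the ball of radius [r + 1]. *)
Lemma picard (F : R -> 'rV[R]_n -> 'rV[R]_n) (t1 tau r L M : R) (xi : 'rV[R]_n) :
  0 <= t1 -> 0 < tau -> 0 <= L -> 0 <= M -> enorm xi <= r ->
  M * tau <= 1 -> L * tau <= 2^-1 ->
  (forall xi i, measurable_fun (`[0, +oo[ : set (lebesgueR R))
     (fun t : lebesgueR R => F t xi ord0 i)) ->
  (forall t : R, 0 <= t -> continuous (F t)) ->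
  (forall (t : R) v, 0 <= t -> enorm v <= r + 1 -> enorm (F t v) <= M) ->
  (forall (t : R) v w, 0 <= t -> enorm v <= r + 1 -> enorm w <= r + 1 ->
     enorm (F t v - F t w) <= L * enorm (v - w)) ->
  exists (z : R -> 'rV[R]_n) (E : set R), [/\ z t1 = xi,
    forall p q, t1 <= p -> p <= q -> q <= t1 + tau -> enorm (z q - z p) <= M * (q - p),
    (@completed_lebesgue_measure R).-negligible E &
    forall t, t1 < t < t1 + tau -> ~ E t -> is_derive t 1 z (F t (z t))].
Proof.
move=> t10 tau0 L0 M0 xir Mtau Ltau mF cF FM FL.
pose b := t1 + tau.
have t1b : t1 <= b by rewrite lerDl ltW.
(* The set preserved by the iteration: by [M * tau <= 1] its members stay in the ball of radius
   [r + 1], where [M] and [L] are valid. *)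
pose Q (z : R -> 'rV[R]_n) := z t1 = xi /\
  forall p q, t1 <= p -> p <= q -> q <= b -> enorm (z q - z p) <= M * (q - p).
have Q1 z t : Q z -> t1 <= t -> t <= b -> enorm (z t - xi) <= 1.
  move=> [z1 zM] h1 h2; rewrite -z1 (le_trans (zM _ _ (lexx _) h1 h2))//.
  by apply: le_trans Mtau; rewrite ler_wpM2l// lerBlDl.
have Qr z t : Q z -> t1 <= t -> t <= b -> enorm (z t) <= r + 1.
  move=> Qz h1 h2; have := enorm_subr (z t) xi; have := Q1 _ _ Qz h1 h2; lra.
have QAC z c d : Q z -> t1 <= c -> d <= b -> abs_continuous c d z.
  move=> [_ zM] h1 h2; apply: (@lipschitz_abs_continuous _ _ _ _ _ M) => p q cp pq qd.
  by apply: zM => //; [exact: le_trans cp|exact: le_trans h2].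
have step (z : R -> 'rV[R]_n) : exists z' : R -> 'rV[R]_n, Q z -> Q z' /\ exists E,
    (@completed_lebesgue_measure R).-negligible E /\
    forall t, t1 < t < b -> ~ E t -> is_derive t 1 z' (F t (z t)).
  have [Qz|] := pselect (Q z); last by move=> nQ; exists z.
  have /choice[H hH] : forall i : 'I_n, exists H : R -> R, exists E : set R, [/\ H t1 = 0,
      forall c d, t1 <= c -> c <= d -> d <= b -> - M * (d - c) <= H d - H c <= M * (d - c),
      (@completed_lebesgue_measure R).-negligible E &
      forall t, t1 < t < b -> ~ E t -> is_derive t 1 H (F t (z t) ord0 i)].
    move=> i.
    have [||H [E [H1 H2 H3 H4 _]]] := @exists_primitive R (fun t => F t (z t) ord0 i) t1 b (- M) M t1b.
    - apply: (@measurable_caratheodory_comp (fun t v => F t v ord0 i) z t1 b M) => //.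
        move=> t t0 v; apply: (@continuous_comp _ _ _ (F t) (fun M : 'rV[R]_n => M ord0 i)).
          exact: cF.
        exact: coord_continuous.
      by case: Qz.
    - move=> t /andP[h1 h2]; rewrite -ler_norml (le_trans (enorm_coord _ _))//.
      by apply: FM; [exact: le_trans h1|exact: Qr].
    - by exists H, E.
  have /choice[E hE] := hH.
  pose z' t := xi + \row_i H i t.
  (* The finite family of null sets, padded by empty sets so that countable unions apply. *)
  pose E' k := if insub k is Some i then E i else set0.
  have E'E i t : ~ (\bigcup_k E' k) t -> ~ E i t.
    by move=> nE Et; apply: nE; exists (i : nat) => //; rewrite /E' valK.
  have E0 : (@completed_lebesgue_measure R).-negligible (\bigcup_k E' k).
    apply: negligible_bigcup => k; rewrite /E'; case: insubP => [i _ _|_].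
      by have [] := hE i.
    exact: negligible_set0.
  have z'der t : t1 < t < b -> ~ (\bigcup_k E' k) t -> is_derive t 1 z' (F t (z t)).
    move=> h nE; apply: is_derive_row => i.
    have -> : (fun s => z' s ord0 i) = (fun s => xi ord0 i) + H i.
      by apply/funext => s; rewrite !mxE.
    have [_ _ _ /(_ t h (E'E i t nE)) dH] := hE i.
    rewrite -[X in is_derive _ _ _ X]add0r; exact: is_deriveD.
  exists z' => _; split; last by exists (\bigcup_k E' k).
  split.
    by apply/rowP => i; rewrite !mxE; have [-> _ _ _] := hE i; rewrite addr0.
  move=> p q h1 h2 h3.
  (* The coordinates yield only the Lipschitz constant [n * M]. This suffices for absolute
     continuity, after which the derivative bound sharpens it to [M]. *)
  apply: (ae_derivative_le h2 M0 _ E0).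
    apply: (@lipschitz_abs_continuous _ _ _ _ _ (n%:R * M)) => c d pc cd dq.
    rewrite (le_trans (enorm_le_sum _))//.
    apply: (@le_trans _ _ (\sum_(i < n) M * (d - c))).
      apply: ler_sum => i _; have [_ Hi _ _] := hE i.
      have := Hi c d (le_trans h1 pc) cd (le_trans dq h3).
      by rewrite mulNr -ler_norml !mxE opprD addrACA subrr add0r.
    by rewrite sumr_const card_ord -mulrA mulr_natl.
  move=> t /andP[pt tq] nE; exists (F t (z t)).
    by apply: z'der => //; rewrite (le_lt_trans h1 pt) (lt_le_trans tq h3).
  have t1t : t1 <= t := le_trans h1 (ltW pt).
  apply: FM; first exact: le_trans t1t.
  by apply: Qr => //; exact: le_trans (ltW tq) h3.
have /choice[Phi hPhi] := step.
have contraction z y D : Q z -> Q y -> 0 <= D ->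
    (forall t, t1 <= t -> t <= b -> enorm (z t - y t) <= D) ->
    forall t, t1 <= t -> t <= b -> enorm (Phi z t - Phi y t) <= 2^-1 * D.
  move=> Qz Qy D0 zyD t h1 h2.
  have [Qz' [Ez [Ez0 dz]]] := hPhi z Qz; have [Qy' [Ey [Ey0 dy]]] := hPhi y Qy.
  have := @ae_derivative_le R n t1 t (fun s => Phi z s - Phi y s) (L * D) (Ez `|` Ey) h1.
  rewrite Qz'.1 Qy'.1 subrr subr0 => h.
  have LD : 0 <= L * D by rewrite mulr_ge0.
  apply: (@le_trans _ _ (L * D * (t - t1))).
    apply: h => //; last 2 first.
    - exact: negligibleU.
    - move=> s /andP[s1 s2] /not_orP[nEz nEy]; exists (F s (z s) - F s (y s)).
        have sb : t1 < s < b by rewrite s1 (lt_le_trans s2).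
        by apply: is_deriveB; [exact: dz|exact: dy].
      have t1s := ltW s1; have sb := ltW (lt_le_trans s2 h2).
      apply: (@le_trans _ _ (L * enorm (z s - y s))).
        by apply: FL; [exact: le_trans t1s|exact: Qr|exact: Qr].
      by rewrite ler_wpM2l// zyD.
    apply: (@lipschitz_abs_continuous _ _ _ _ _ (M + M)) => p q tp pq qt.
    rewrite mulrDl.
    have -> : Phi z q - Phi y q - (Phi z p - Phi y p) = (Phi z q - Phi z p) - (Phi y q - Phi y p).
      by rewrite !opprB addrACA [RHS]addrACA; congr (_ + _); rewrite addrC.
    rewrite (le_trans (enormB _ _))//.
    have qb := le_trans qt h2.
    by apply: lerD; [exact: Qz'.2|exact: Qy'.2].
  rewrite mulrAC ler_wpM2r//; apply: le_trans Ltau.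
  by rewrite ler_wpM2l// lerBlDl.
pose z k := iter k Phi (fun=> xi).
have Qz k : Q (z k).
  elim: k => [|k IH]; last exact: (hPhi _ IH).1.
  by split => // p q *; rewrite subrr enorm0 mulr_ge0// subr_ge0.
have h0 k : 0 <= 2^-1 ^+ k :> R by rewrite exprn_ge0// invr_ge0.
have zdiff k t : t1 <= t -> t <= b -> enorm (z k.+1 t - z k t) <= 2^-1 ^+ k.
  move=> h1 h2; elim: k t h1 h2 => [|k IH] t h1 h2.
    by rewrite expr0; exact: (Q1 (z 1%N)).
  by rewrite exprS; exact: (contraction (z k.+1) (z k)).
have /choice[y hy] : forall t, exists l, t1 <= t -> t <= b ->
    forall k, enorm (z k t - l) <= 2 * 2^-1 ^+ k.
  move=> t; have [/andP[h1 h2]|h] := boolP (t1 <= t <= b); last first.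
    by exists 0 => h1 h2; rewrite h1 h2 in h.
  have [l hl] := @geometric_cvg (fun k => z k t) (fun k => zdiff k t h1 h2).
  by exists l.
(* A common tool for passing to the limit; the triangle inequalities below need at most
   [4 * 2^-1 ^+ k], so [6] is ample. *)
have small (c : R) : (forall k, c <= 6 * 2^-1 ^+ k) -> c <= 0.
  move=> hc.
  have : (fun k => 6 * 2^-1 ^+ k : R) @ \oo --> 0.
    rewrite -[X in _ --> X](mulr0 6); apply: cvgMr.
    by apply: cvg_expr; rewrite ger0_norm ?invr_ge0// invf_lt1 ?ltr1n.
  move=> h; rewrite -(cvg_lim _ h)//; apply: limr_ge; first by apply/cvg_ex; exists 0.
  by near=> k; exact: hc.
have Qy : Q y.
  split.
    apply/eqP; rewrite -subr_eq0; apply/eqP/enorm_eq0/small => k.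
    have := hy t1 (lexx _) t1b k; rewrite (Qz k).1 enorm_distC.
    by have := h0 k; lra.
  move=> p q tp pq qb; rewrite -subr_le0; apply: small => k.
  have := hy p tp (le_trans pq qb) k; have := hy q (le_trans tp pq) qb k.
  have := (Qz k).2 p q tp pq qb.
  have := enorm_dist_trans (y q) (z k q) (y p).
  have := enorm_dist_trans (z k q) (z k p) (y p).
  rewrite (enorm_distC (y q) (z k q)); have := h0 k; lra.
have Phiy t : t1 <= t -> t <= b -> Phi y t = y t.
  move=> h1 h2; apply/eqP; rewrite -subr_eq0; apply/eqP/enorm_eq0/small => k.
  have h := contraction (z k) y (2 * 2^-1 ^+ k) (Qz k) Qy (mulr_ge0 (ler0n R 2) (h0 k))
    (fun s h1 h2 => hy s h1 h2 k) t h1 h2.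
  have := hy t h1 h2 k.+1; rewrite exprS.
  have := enorm_dist_trans (Phi y t) (z k.+1 t) (y t).
  rewrite (enorm_distC (Phi y t) (z k.+1 t)); move: h; rewrite -[Phi (z k) t]/(z k.+1 t).
  by have := h0 k; lra.
have [[Py1 PyM] [E [E0 dP]]] := hPhi y Qy.
(* [Phi y] is returned because its derivative is known; it coincides with [y] on the interval. *)
exists (Phi y), E; split => // t tb nE.
have /andP[h1 h2] := tb.
by rewrite Phiy; [exact: dP|exact: ltW|exact: ltW].
Unshelve. all: by end_near. Qed.

End caratheodory.

(** * Impulses and solutions *)

Section impulses.
Variables (R : realType) (gam : set R).
Hypothesis gamP : impulse_times gam.
Implicit Types a b c s t : R.

Lemma impulses_isolated t : exists2 r : R, 0 < r &
  forall s, gam s -> s != t -> r <= `|s - t|.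
Proof.
have [D [tau [_ _ _ _ lp]]] := gamP.
have : ~ limit_point gam t by rewrite lp.
rewrite not_limit_pointE => -[U [r /= r0 rU] hU].
exists r => // s gs st; rewrite leNgt; apply/negP => sr.
have Us : U s by apply: rU; rewrite /ball/= distrC.
by have /eqP := hU s (conj gs Us); rewrite (negbTE st).
Qed.

Lemma impulses_finite a b : finite_set (gam `&` `]a, b]).
Proof.
apply: contrapT => inf.
have [|t] := infinite_bounded_limit_point_nonempty inf.
  exists (`|a| + `|b|); split; first exact: num_real.
  move=> y hy t [_ /=]; rewrite in_itv/= => /andP[h1 h2].
  apply: le_trans (ltW hy); rewrite ler_norml.
  have := ler_norm b; have := ler_norm (- a); rewrite normrN.
  by have := normr_ge0 a; have := normr_ge0 b; lra.
have [D [tau [_ _ _ _ lp]]] := gamP.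
move=> tl; have : limit_point gam t; last by rewrite lp.
by move=> U /tl[y [yt [gy _] Uy]]; exists y.
Qed.

(** The supremum of the impulses in the window is attained, since impulses do not accumulate. *)
Lemma last_impulse a b s0 : gam s0 -> a < s0 -> s0 <= b ->
  exists s, [/\ gam s, a < s, s <= b & forall t, gam t -> ~ (s < t /\ t <= b)].
Proof.
move=> g0 as0 s0b; pose A := gam `&` `]a, b].
have A0 : A s0 by split => //=; rewrite in_itv/= as0.
have Aub : ubound A b by move=> t [_ /=]; rewrite in_itv/= => /andP[].
have supA : has_sup A by split; [exists s0|exists b].
have [r r0 hr] := impulses_isolated (sup A).
have [t [gt /= ht] tr] := sup_adherent r0 supA; rewrite in_itv/= in ht.
have ts : t <= sup A by apply: ub_le_sup; [exists b|split => //=; rewrite in_itv].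
have tE : t = sup A.
  apply/eqP; apply: contraT => /(hr _ gt).
  by rewrite distrC ger0_norm ?subr_ge0//; lra.
have /andP[at_ tb] := ht.
exists t; split => // s gs [ts' sb].
have : s <= sup A by apply: ub_le_sup; [exists b|split => //=; rewrite in_itv/= sb (lt_trans at_)].
by rewrite -tE; lra.
Qed.

Lemma nimpulsesD a b c : a <= b -> b <= c ->
  nimpulses gam `]a, c] = (nimpulses gam `]a, b] + nimpulses gam `]b, c])%N.
Proof.
move=> ab bc; rewrite /nimpulses.
have -> : gam `&` `]a, c] = (gam `&` `]a, b]) `|` (gam `&` `]b, c]).
  rewrite -setIUr; congr (_ `&` _); apply/seteqP; split => t /=; rewrite !in_itv/=.
    by move=> /andP[-> ->]; have [|] := leP t b; [left|right].
  by case=> /andP[h1 h2]; apply/andP; split; lra.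
rewrite fset_setU; [|exact: impulses_finite..].
rewrite cardfsU (_ : (_ `&` _)%fset = fset0) ?cardfs0 ?subn0//.
apply/fsetP => t; rewrite !inE; apply/negP => /andP[].
rewrite !in_fset_set; [|exact: impulses_finite..].
by rewrite !inE/= => -[_ /=] + [_ /=]; rewrite !in_itv/=; lra.
Qed.

Lemma nimpulses0 a b : (forall s, gam s -> ~ (a < s /\ s <= b)) ->
  nimpulses gam `]a, b] = 0%N.
Proof.
move=> h; rewrite /nimpulses (_ : gam `&` _ = set0) ?fset_set0 ?cardfs0//.
apply/seteqP; split => // s [gs /=]; rewrite in_itv/= => /andP[h1 h2].
by have := h s gs; exact.
Qed.

Lemma nimpulses_gt0 a b s : gam s -> a < s -> s <= b ->
  (0 < nimpulses gam `]a, b])%N.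
Proof.
move=> gs as_ sb; rewrite /nimpulses cardfs_gt0; apply/fset0Pn; exists s.
rewrite in_fset_set; last exact: impulses_finite.
by rewrite inE; split => //=; rewrite in_itv/= as_.
Qed.

Lemma nimpulses_le1 a b s : (forall t, gam t -> a < t -> t <= b -> t = s) ->
  (nimpulses gam `]a, b] <= 1)%N.
Proof.
move=> h; rewrite /nimpulses -(cardfs1 s) fsubset_leq_card//.
apply/fsubsetP => t; rewrite in_fset_set; last exact: impulses_finite.
rewrite !inE => -[gt /=]; rewrite in_itv/= => /andP[h1 h2].
by apply/eqP; exact: h.
Qed.

(** Hybrid time, the second argument of [beta] in the stability notions. *)
Definition elapsed a b : R := b - a + (nimpulses gam `]a, b])%:R.

Lemma elapsedD a b c : a <= b -> b <= c -> elapsed a c = elapsed a b + elapsed b c.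
Proof.
by move=> ab bc; rewrite /elapsed (nimpulsesD ab bc) natrD; ring.
Qed.

Lemma elapsed_ge0 a b : a <= b -> 0 <= elapsed a b.
Proof. by move=> ab; rewrite addr_ge0// subr_ge0. Qed.

(** Just before the infimum of the times at which [T] is reached, hybrid time is at most [T]. A time
    [e] slightly after it adds at most one impulse, namely one at the infimum, and at most one unit
    of time; hence the overshoot of at most [2]. *)
Lemma elapsed_window a b T : 0 < T -> a <= b -> T <= elapsed a b ->
  exists s, [/\ a <= s, s <= b, T <= elapsed a s & elapsed a s <= T + 2].
Proof.
move=> T0 ab Tab; pose A := [set s | a <= s <= b /\ T <= elapsed a s].
have Ab : A b by split => //; rewrite ab lexx.
have infA : has_inf A by split; [exists b|exists a => s [/andP[]]].
have [r r0 hr] := impulses_isolated (inf A).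
pose d := Num.min r 1 / 2.
have m0 : 0 < Num.min r 1 by rewrite lt_min r0 ltr01.
have d0 : 0 < d by rewrite divr_gt0.
have dr : d < r by rewrite (@lt_le_trans _ _ (Num.min r 1)) ?ge_min ?lexx// ltr_pdivrMr//; lra.
have d1 : d <= 2^-1.
  by rewrite -[2^-1]mul1r ler_wpM2r ?invr_ge0// ge_min lexx orbT.
have [e [/andP[ae eb] Te] ed] := inf_adherent d0 infA.
have ie : inf A <= e by apply: ge_inf; [exists a => s [/andP[]]|split => //; rewrite ae].
have ai : a <= inf A by apply: lb_le_inf; [exists b|move=> s [/andP[]]].
exists e; split => //.
pose p := Num.max a (inf A - d).
have ap : a <= p by rewrite le_max lexx.
have pi : p <= inf A by rewrite ge_max ai gerBl ltW.
have pd : inf A - d <= p by rewrite le_max lexx orbT.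
have pe : p <= e by exact: le_trans ie.
have ep : elapsed a p <= T.
  rewrite /p; have [_|h] := leP (inf A - d) a.
    rewrite /elapsed nimpulses0; first by rewrite subrr addr0 ltW.
    by move=> s _ []; lra.
  rewrite leNgt; apply/negP => /ltW h'.
  have : inf A <= inf A - d.
    apply: ge_inf; first by exists a => s [/andP[]].
    by split => //; lra.
  by lra.
have : (nimpulses gam `]p, e] <= 1)%N.
  apply: (@nimpulses_le1 _ _ (inf A)) => t gt pt te.
  apply/eqP; apply: contraT => /(hr _ gt); rewrite leNgt => /negP; case.
  by rewrite ltr_norml; lra.
rewrite (elapsedD ap pe) {2}/elapsed -(ler_nat R); lra.
Qed.

End impulses.

(** * Gluing and maximal prolongation of solutions *)

Section solutions.
Variables (R : realType) (n m : nat).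
Implicit Types (S : impulsive_system R n m) (x y z : R -> 'rV[R]_n)
  (u : R -> 'rV[R]_m) (t s a b c d : R) (T : \bar R).

Local Notation nullset := ((@completed_lebesgue_measure R).-negligible).

Lemma nullset1 t : nullset [set t].
Proof. by apply/completed_negligibleP/negligibleP => //; exact: lebesgue_measure_set1. Qed.

Lemma is_derive_near_eq (V : normedModType R) (f g : R -> V) t (l : V) :
  (\forall s \near t, f s = g s) -> is_derive t 1 f l -> is_derive t 1 g l.
Proof.
move=> fg /is_deriveP df; apply/is_deriveP => e e0.
have [r /= r0 hr] := fg; have [r' r'0 hr'] := df e e0.
exists (Num.min r r'); first by rewrite lt_min r0.
move=> h; rewrite lt_min => /andP[h1 /hr'].
rewrite -!hr//=; first by rewrite subrr normr0.
by rewrite /ball/= opprD addrA subrr sub0r normrN.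
Qed.

Lemma abs_continuous_ext a b x y : (forall t, a <= t -> t <= b -> x t = y t) ->
  abs_continuous a b x -> abs_continuous a b y.
Proof.
move=> xy xab e /xab[del del0 h]; exists del => // k p q pq tI hs.
rewrite (eq_bigr (fun i => enorm (x (q i) - x (p i)))); first exact: h.
by move=> i _; have [h1 h2 h3] := pq i; rewrite !xy//; lra.
Qed.

Lemma solution_flow S t0 (x0 : 'rV[R]_n) u x T a b : solution S t0 x0 u x T ->
  t0 <= a -> a <= b -> (b%:E < T)%E ->
  (forall s, impulses S s -> ~ (a < s /\ s <= b)) ->
  abs_continuous a b x /\ exists2 E, nullset E &
    forall t, a < t < b -> ~ E t -> is_derive t 1 x (flow S t (x t) (u t)).
Proof.
move=> [[t0T _] sol _] t0a ab bT nogam.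
have [r r0 hr] := impulses_isolated (impulsesP S) b.
(* The definition of solution controls half-open intervals only. Stretching past [b], up to the
   isolation radius, brings the right end [b] inside. *)
pose T2 : \bar R := Order.min T (b + r)%:E.
have bT2 : (b%:E < T2)%E by rewrite lt_min bT lte_fin ltrDl.
have [| | |AC ae] := sol a T2 t0a => //.
- by rewrite (le_lt_trans _ bT2)// lee_fin.
- by rewrite ge_min lexx.
- move=> s gs [as_]; rewrite lt_min lte_fin => /andP[_ sbr].
  have [sb|sb] := leP s b; first exact: (nogam s).
  by have := hr s gs; rewrite gt_eqF// => /(_ isT); rewrite ger0_norm ?subr_ge0 ?(ltW sb)// lerBrDl leNgt sbr.
split; first by apply: AC.
exists (~` [set t | a <= t /\ (t%:E < T2)%E -> is_derive t 1 x (flow S t (x t) (u t))]) => //.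
move=> t /andP[at_ tb] /contrapT; apply; split; first exact: ltW.
by rewrite (lt_trans _ bT2)// lte_fin.
Qed.

Lemma solution_tail S t0 (x0 : 'rV[R]_n) u x T s : solution S t0 x0 u x T ->
  t0 <= s -> (s%:E < T)%E -> solution S s (x s) u x T.
Proof.
move=> [[t0T _] sol jmp] t0s sT; split => //.
- by move=> t1 t2 st1; apply: sol; exact: le_trans st1.
- by move=> t gt st; apply: jmp => //; exact: le_lt_trans st.
Qed.

(** Absolute continuity and jumps are checked on one local piece at a time. The derivative clause is
    not: its exceptional set depends on the piece, and rational right ends reduce these sets to
    countably many. *)
Lemma solution_glue S t0 (x0 : 'rV[R]_n) u x T : (t0%:E < T)%E ->
  (forall d, t0 <= d -> (d%:E < T)%E -> exists y T', [/\ solution S t0 x0 u y T',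
     (d%:E < T')%E, (T' <= T)%E &
     forall t, t0 <= t -> (t%:E < T')%E -> y t = x t]) ->
  solution S t0 x0 u x T.
Proof.
move=> t0T loc; split.
- split => //; have [y [T' [[[_ <-] _ _] t0T' _ yx]]] := loc t0 (lexx _) t0T.
  by rewrite yx.
- move=> t1 t2 t01 t12 t2T nogam; split.
    move=> c d t1c cd dt2.
    have t0d : t0 <= d by rewrite (le_trans t01)// (le_trans t1c).
    have [y [T' [[[_ _] sol _] dT' T'T yx]]] := loc d t0d (lt_le_trans dt2 t2T).
    have [| | |AC _] := sol t1 (Order.min t2 T') t01 => //.
    + by rewrite lt_min t12 (le_lt_trans _ dT')// lee_fin (le_trans t1c).
    + by rewrite ge_min lexx orbT.
    + by move=> s gs [h1]; rewrite lt_min => /andP[h2 _]; apply: (nogam s gs).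
    apply: (@abs_continuous_ext c d y x); last by apply: AC => //; rewrite lt_min dt2.
    move=> t ct td; apply: yx; first by rewrite (le_trans t01)// (le_trans t1c).
    by rewrite (le_lt_trans _ dT')// lee_fin.
  have key (q : R) : exists E, nullset E /\ forall t, t1 < t -> t < q -> (q%:E < t2)%E -> ~ E t ->
      is_derive t 1 x (flow S t (x t) (u t)).
    have [t1q|] := leP q t1; first by exists set0; split => [|t h1 /(lt_trans h1)]; [exact: negligible_set0|rewrite ltNge t1q].
    have [qt2|] := ltP q%:E t2; last first.
      by move=> h; exists set0; split => [|t _ _ //]; exact: negligible_set0.
    move=> t1q; have t0q : t0 <= q by rewrite (le_trans t01)// ltW.
    have [y [T' [[[_ _] sol _] qT' T'T yx]]] := loc q t0q (lt_le_trans qt2 t2T).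
    have [| | |_ ae] := sol t1 (Order.min t2 T') t01 => //.
    + by rewrite lt_min t12 (lt_trans _ qT')// lte_fin.
    + by rewrite ge_min lexx orbT.
    + by move=> s gs [h1]; rewrite lt_min => /andP[h2 _]; apply: (nogam s gs).
    exists (~` [set t | t1 <= t /\ (t%:E < Order.min t2 T')%E -> is_derive t 1 y (flow S t (y t) (u t))]).
    split => // t t1t tq _ /contrapT /=.
    have tT' : (t%:E < T')%E by rewrite (lt_trans _ qT')// lte_fin.
    rewrite -yx//; last by rewrite (le_trans t01)// ltW.
    rewrite lt_min tT' (lt_trans _ qt2) ?lte_fin// => h.
    apply: is_derive_near_eq (h _); last by split => //; exact: ltW.
    near=> s; apply: yx.
      by rewrite (le_trans t01)//; near: s; exact: lt_le_nbhsr.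
    rewrite (lt_trans _ qT')// lte_fin; near: s; exact: lt_nbhsl.
  have /choice[E hE] : forall k : nat, exists E, nullset E /\ forall t (q : rat),
      choice.unpickle k = Some q -> t1 < t -> t < ratr q -> ((ratr q)%:E < t2)%E -> ~ E t ->
      is_derive t 1 x (flow S t (x t) (u t)).
    move=> k; case: (choice.unpickle k) => [q|]; last first.
      by exists set0; split => //; exact: negligible_set0.
    by have [E [E0 hE]] := key (ratr q); exists E; split => // t _ [<-]; exact: hE.
  (* The derivative is two-sided, and when [t1 = t0] the pieces say nothing to the left of [t1]. *)
  have Enull : nullset ([set t1] `|` \bigcup_k E k).
    apply: negligibleU; first exact: nullset1.
    by apply: negligible_bigcup => k; have [] := hE k.
  apply: negligibleS Enull => t /= /not_implyP[[t1t tt2] nd].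
  apply: contrapT => /not_orP[tt1 nE]; apply: nd.
  have {}t1t : t1 < t by rewrite lt_neqAle t1t andbT; apply/eqP => h; apply: tt1.
  have [d td dt2] : exists2 d, t < d & (d%:E <= t2)%E.
    case: t2 tt2 {t12 t2T nogam key hE} => [r||//] h; first by exists r; rewrite ?lte_fin// in h *.
    by exists (t + 1); rewrite ?ltrDl ?leey.
  have [q] := rat_in_itvoo td; rewrite in_itv/= => /andP[tq qd].
  have [_] := hE (choice.pickle q); apply; [exact: choice.pickleK|by []|exact: tq| |].
    by rewrite (lt_le_trans _ dt2)// lte_fin.
  by move=> Et; apply: nE; exists (choice.pickle q).
- move=> t gt t0t tT.
  have [y [T' [[[_ _] _ jmp] tT' T'T yx]]] := loc t (ltW t0t) tT.
  have [l yl yt] := jmp t gt t0t tT'; exists l; last by rewrite -yx// ltW.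
  apply: cvg_trans yl; apply: near_eq_cvg; near=> s; apply: yx.
    by near: s; exact: nbhs_left_ge.
  by rewrite (lt_trans _ tT')// lte_fin; near: s; exact: nbhs_left_lt.
Unshelve. all: by end_near. Qed.

(** Zorn's lemma among the solutions that extend [x]; an upper bound of a chain is glued from its
    members. This makes the stability hypotheses, stated for maximal solutions, available for every
    solution. *)
Lemma solution_extends_maximal S t0 (x0 : 'rV[R]_n) u x T : solution S t0 x0 u x T ->
  exists y T', [/\ maximal_solution S t0 x0 u y T', (T <= T')%E &
    forall t, t0 <= t -> (t%:E < T)%E -> y t = x t].
Proof.
move=> solx.
pose extends (p q : (R -> 'rV[R]_n) * \bar R) := (p.2 <= q.2)%E /\
  forall t, t0 <= t -> (t%:E < p.2)%E -> q.1 t = p.1 t.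
pose sol := {p : (R -> 'rV[R]_n) * \bar R | solution S t0 x0 u p.1 p.2 /\ extends (x, T) p}.
pose ext (p q : sol) : bool := `[< extends (sval p) (sval q) >].
have extends_trans p q r : extends p q -> extends q r -> extends p r.
  move=> [h1 h2] [h3 h4]; split; first exact: le_trans h3.
  by move=> t t0t tp; rewrite h4 ?h2// (lt_le_trans tp).
pose p0 : sol := exist _ (x, T) (conj solx (conj (lexx T) (fun _ _ _ => erefl))).
have [||A Atot|[[y T'] [soly xy]] ymax] := @ZL_preorder sol p0 ext.
- by move=> p; apply/asboolP.
- by move=> r s t /asboolP h1 /asboolP h2; apply/asboolP; exact: extends_trans h2.
- have [[q0 Aq0]|A0] := pselect (A !=set0); last first.
    by exists p0 => s As; exfalso; apply: A0; exists s.
  (* The common value of the members of the chain defined at [t], well defined because the chain is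
     total; [0] where none is defined. *)
  have /choice[y hy] : forall t, exists v, forall p, A p -> t0 <= t ->
      (t%:E < (sval p).2)%E -> (sval p).1 t = v.
    move=> t; have [[p [Ap t0t tp]]|h] := pselect (exists p, [/\ A p, t0 <= t & (t%:E < (sval p).2)%E]).
      exists ((sval p).1 t) => q Aq _ tq.
      by have [/asboolP[_ ->]|/asboolP[_ <-]] := Atot _ _ Ap Aq.
    by exists 0 => p Ap t0t tp; exfalso; apply: h; exists p.
  pose T' := ereal_sup [set (sval p).2 | p in A].
  have leT' p : A p -> ((sval p).2 <= T')%E by move=> Ap; apply: ereal_sup_ubound; exists p.
  have ltT' d : (d%:E < T')%E -> exists2 p, A p & (d%:E < (sval p).2)%E.
    by move=> /ereal_sup_gt[_ [p Ap <-] dp]; exists p.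
  have soly : solution S t0 x0 u y T'.
    apply: solution_glue.
      have [[[t0q _] _ _] _] := svalP q0.
      exact: lt_le_trans t0q (leT' _ Aq0).
    move=> d t0d /ltT'[p Ap dp]; exists (sval p).1, (sval p).2; split => //.
    - by have [] := svalP p.
    - exact: leT'.
    - by move=> t t0t tp; exact: hy.
  have yext p : A p -> extends (sval p) (y, T').
    by move=> Ap; split => [|t t0t tp] /=; [exact: leT'|apply/esym/hy].
  have xy : extends (x, T) (y, T').
    by apply: extends_trans (yext q0 Aq0); have [] := svalP q0.
  exists (exist _ (y, T') (conj soly xy)) => s As; apply/asboolP; exact: yext.
- exists y, T'; split; [|exact: (proj1 xy)|exact: (proj2 xy)].
  split => // -[w [T2 [solw T'2 wy]]].
  have yw : extends (y, T') (w, T2) by split; [exact: ltW|].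
  have := ymax (exist _ (w, T2) (conj solw (extends_trans _ _ _ xy yw))).
  by move=> /(_ (asboolT yw))/asboolP[/=]; rewrite leNgt T'2.
Qed.

End solutions.

(** * Existence and prolongation of zero-input solutions *)

Section zero_input.
Variables (R : realType) (n m : nat) (S : impulsive_system R n m).
Implicit Types (x y z : R -> 'rV[R]_n) (t s a b c d : R).

Local Notation nullset := ((@completed_lebesgue_measure R).-negligible).
Local Notation u0 := (fun=> 0 : 'rV[R]_m).

Lemma lipschitz_left_limit z a b (M : R) : a < b -> 0 <= M ->
  (forall p q, a <= p -> p <= q -> q < b -> enorm (z q - z p) <= M * (q - p)) ->
  exists l : 'rV[R]_n, z s @[s --> b^'-] --> l.
Proof.
move=> ab M0 zM.
suff : cvg (z s @[s --> b^'-]) by move=> /cvg_ex.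
apply: cauchy_cvg; apply/cauchyP => e e0.
have M1 : 0 < 2 * (M + 1) by lra.
pose s0 := Num.max a (b - e / (2 * (M + 1))).
have s0b : s0 < b by rewrite gt_max ab/= ltrBlDr ltrDl divr_gt0.
have as0 : a <= s0 by rewrite le_max lexx.
have s0' : b - e / (2 * (M + 1)) <= s0 by rewrite le_max lexx orbT.
exists (z s0); suff : \forall s \near b^'-, ball (z s0) e (z s) by [].
near=> s.
have ss : s0 <= s by near: s; exact: nbhs_left_ge.
have sb : s < b by near: s; exact: nbhs_left_lt.
rewrite -ball_normE /= distrC (le_lt_trans (norm_le_enorm _))//.
rewrite (le_lt_trans (zM _ _ as0 ss sb))//.
apply: (@le_lt_trans _ _ ((M + 1) * (e / (2 * (M + 1))))).
  by apply: ler_pM => //; lra.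
have -> : (M + 1) * (e / (2 * (M + 1))) = e / 2 by field; lra.
lra.
Unshelve. all: by end_near. Qed.

Lemma lipschitz_left_limit_le z a b (M : R) (l : 'rV[R]_n) : 0 <= M ->
  (forall p q, a <= p -> p <= q -> q < b -> enorm (z q - z p) <= M * (q - p)) ->
  z s @[s --> b^'-] --> l ->
  forall s, a <= s -> s < b -> enorm (l - z s) <= M * (b - s).
Proof.
move=> M0 zM zl s as_ sb; apply/ler_addgt0Pr => e e0.
have : \forall s' \near b^'-, enorm (z s' - l) <= e by move/cvg_enorm : zl; exact.
move=> zle; near (b^'-) => s'.
have h1 : enorm (z s' - l) <= e by near: s'.
have h2 : s < s' by near: s'; exact: nbhs_left_gt.
have h3 : s' < b by near: s'; exact: nbhs_left_lt.
have := enorm_dist_trans l (z s') (z s).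
have := zM s s' as_ (ltW h2) h3; rewrite (enorm_distC l (z s')).
have : M * (s' - s) <= M * (b - s) by rewrite ler_wpM2l//; lra.
lra.
Unshelve. all: by end_near. Qed.

Hypothesis flow_bounded : forall r : R, 0 <= r -> exists2 M : R, 0 <= M &
  forall t xi, 0 <= t -> enorm xi <= r -> enorm (flow S t xi 0) <= M.
Hypothesis flow_lipschitz : forall r : R, 0 < r -> exists2 L : R, 0 <= L &
  forall t xi1 xi2, 0 <= t -> enorm xi1 <= r -> enorm xi2 <= r ->
    enorm (flow S t xi1 0 - flow S t xi2 0) <= L * enorm (xi1 - xi2).

Lemma local_solution t1 xi : 0 <= t1 -> exists z (T : R) (M : R),
  [/\ solution S t1 xi u0 z T%:E, 0 <= M &
    forall p q, t1 <= p -> p <= q -> q < T -> enorm (z q - z p) <= M * (q - p)].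
Proof.
move=> t10; have r0 := enorm_ge0 xi; set r := enorm xi in r0.
have r10 : 0 < r + 1 by rewrite ltr_wpDl.
have [M M0 hM] := flow_bounded (ltW r10).
have [L L0 hL] := flow_lipschitz r10.
(* Short enough for both requirements of [picard], [M * tau <= 1] and [L * tau <= 2^-1]. *)
pose tau := (M + 2 * L + 1)^-1.
have den0 : 0 < M + 2 * L + 1 by lra.
have tau0 : 0 < tau by rewrite invr_gt0.
have Mtau : M * tau <= 1 by rewrite ler_pdivrMr// mul1r; lra.
have Ltau : L * tau <= 2^-1 by rewrite ler_pdivrMr//; lra.
have [||||z [E [z1 zM E0 dz]]] := @picard R n (fun t v => flow S t v 0) t1 tau r L M xi t10 tau0 L0 M0 (lexx r) Mtau Ltau.
- by move=> v i; exact: flow_measurable.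
- move=> t t0 v.
  have v0 : (w, 0 : 'rV[R]_m) @[w --> v] --> (v, 0 : 'rV[R]_m).
    exact: (cvg_pair (@cvg_id _ (nbhs v)) (@cvg_cst _ _ _ _ (nbhs_filter v))).
  exact: (cvg_comp _ _ v0 (@flow_continuous _ _ _ S t t0 (v, 0))).
- by move=> t v t0 vr; exact: hM.
- by move=> t v w t0 vr wr; exact: hL.
have [e e0 he] := impulses_isolated (impulsesP S) t1.
(* Stopping at the isolation radius leaves no impulse strictly between [t1] and [T]; one at [t1]
   itself triggers no jump, since jumps are imposed only after the initial time. *)
pose T := t1 + Num.min tau e.
have t1T : t1 < T by rewrite ltrDl lt_min tau0.
have Ttau : T <= t1 + tau by rewrite lerD2l ge_min lexx.
have Te : T <= t1 + e by rewrite lerD2l ge_min lexx orbT.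
have zlip p q : t1 <= p -> p <= q -> q < T -> enorm (z q - z p) <= M * (q - p).
  by move=> h1 h2 h3; apply: zM => //; rewrite (le_trans (ltW h3)).
exists z, T, M; split => //; split.
- by rewrite lte_fin.
- move=> a t2 t1a at2 t2T _; split.
    move=> c d ac cd dt2; apply: (@lipschitz_abs_continuous _ _ _ _ _ M) => p q cp pq qd.
    apply: zlip => //; first by rewrite (le_trans t1a)// (le_trans ac).
    by rewrite -lte_fin (lt_le_trans _ t2T)// (le_lt_trans _ dt2)// lee_fin.
  have : nullset (E `|` [set t1]) by apply: negligibleU => //; exact: nullset1.
  apply: negligibleS => t /= /not_implyP[[at_ tt2] nd].
  apply: contrapT => /not_orP[nE tt1]; apply: nd; apply: dz => //.
  apply/andP; split; last by rewrite (lt_le_trans _ Ttau)// -lte_fin (lt_le_trans tt2).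
  by rewrite lt_neqAle (le_trans t1a at_) andbT; apply/eqP => h; apply: tt1.
- move=> t gt t1t; rewrite lte_fin => tT.
  by have := he t gt; rewrite gt_eqF// => /(_ isT); rewrite ger0_norm ?subr_ge0 ?(ltW t1t)//; lra.
Qed.

Lemma bounded_solution_lipschitz t0 (x0 : 'rV[R]_n) z (T : R) r : 0 <= t0 -> 0 <= r ->
  solution S t0 x0 u0 z T%:E ->
  (forall t, t0 <= t -> t < T -> enorm (z t) <= r) ->
  exists2 M : R, 0 <= M & forall a, t0 <= a ->
    (forall s, impulses S s -> ~ (a < s /\ s < T)) ->
    forall p q, a <= p -> p <= q -> q < T -> enorm (z q - z p) <= M * (q - p).
Proof.
move=> t00 r0 solz zr; have [M M0 hM] := flow_bounded r0.
exists M => // a t0a nogam p q ap pq qT.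
have [||||AC [E E0 dz]] := @solution_flow _ _ _ S t0 x0 u0 z T%:E p q solz.
- exact: le_trans ap.
- by [].
- by rewrite lte_fin.
- by move=> s gs [ps sq]; apply: (nogam s gs); split; lra.
apply: (ae_derivative_le pq M0 AC E0) => t tpq nE.
exists (flow S t (z t) 0); first exact: dz.
by apply: hM; [lra|apply: zr; lra].
Qed.

(** Near [T] there are no impulses before [T], so the bounded solution is Lipschitz there and has a
    left limit, from which a local solution is started. The bulk of the proof checks intervals that
    cross [T]. *)
Lemma extend_bounded_solution t0 (x0 : 'rV[R]_n) z (T : R) r : 0 <= t0 -> 0 <= r ->
  solution S t0 x0 u0 z T%:E ->
  (forall t, t0 <= t -> t < T -> enorm (z t) <= r) ->
  exists y (T' : R), [/\ solution S t0 x0 u0 y T'%:E, T < T' &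
    forall t, t0 <= t -> t < T -> y t = z t].
Proof.
move=> t00 r0 solz zr.
have t0T : t0 < T by have [[]] := solz; rewrite lte_fin.
have [M M0 zM] := bounded_solution_lipschitz t00 r0 solz zr.
have [e e0 he] := impulses_isolated (impulsesP S) T.
pose a := Num.max t0 (T - e).
have t0a : t0 <= a by rewrite le_max lexx.
have aT : a < T by rewrite gt_max t0T/= ltrBlDr ltrDl.
have [l zl] : exists l : 'rV[R]_n, z s @[s --> T^'-] --> l.
  apply: (lipschitz_left_limit aT M0 (zM a t0a _)) => s gs [as_ sT].
  have := he s gs; rewrite lt_eqF// => /(_ isT).
  have : T - e <= a by rewrite le_max lexx orbT.
  by rewrite distrC ger0_norm ?subr_ge0 ?(ltW sT)//; lra.
(* The restart state absorbs the jump exactly when [T] is an impulse time; otherwise the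
   concatenation is continuous at [T]. *)
pose zT := if `[< impulses S T >] then l + jump S T l 0 else l.
have T0 : 0 <= T by rewrite (le_trans t00)// ltW.
have [w [T' [M' [solw M'0 wM]]]] := local_solution zT T0.
have [[TT' wT] solw2 jmpw] := solw; rewrite lte_fin in TT'.
have [[_ z0] solz2 jmpz] := solz.
pose y t := if t < T then z t else w t.
have yz t : t < T -> y t = z t by rewrite /y => ->.
have yw t : T <= t -> y t = w t by rewrite /y ltNge => ->.
exists y, T'; split => //; last by move=> t _ /yz.
split; first by rewrite lte_fin (lt_trans t0T TT') yz.
- move=> t1 t2 t01 t12 t2T' nog.
  have loc_z (d : R) : t1 < d -> (d%:E <= t2)%E -> d <= T ->
      (forall c d', t1 <= c -> c <= d' -> d' < d -> abs_continuous c d' y) /\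
      exists2 E, nullset E & forall t, t1 < t -> t < d -> ~ E t ->
        is_derive t 1 y (flow S t (y t) 0).
    move=> t1d dt2 dT; have [|||AC ae] := solz2 t1 d%:E t01.
    + by rewrite lte_fin.
    + by rewrite lee_fin.
    + by move=> s gs [h1 h2]; apply: (nog s gs); split => //; exact: lt_le_trans dt2.
    split.
      move=> c d' tc cd' d'd; apply: abs_continuous_ext (AC c d' tc cd' _); last by rewrite lte_fin.
      by move=> t ct td'; rewrite yz// (le_lt_trans td')// (lt_le_trans d'd).
    exists (~` [set t | t1 <= t /\ (t%:E < d%:E)%E -> is_derive t 1 z (flow S t (z t) 0)]) => //.
    move=> t t1t td /contrapT /= h.
    have tT : t < T by exact: lt_le_trans dT.
    rewrite yz//; apply: is_derive_near_eq (h _); last by split; [exact: ltW|rewrite lte_fin].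
    by near=> s; rewrite yz//; near: s; exact: lt_nbhsl.
  have loc_w (c0 : R) : t1 <= c0 -> (c0%:E < t2)%E -> T <= c0 ->
      (forall c d', c0 <= c -> c <= d' -> (d'%:E < t2)%E -> abs_continuous c d' y) /\
      exists2 E, nullset E & forall t, c0 < t -> (t%:E < t2)%E -> ~ E t ->
        is_derive t 1 y (flow S t (y t) 0).
    move=> t1c c0t2 Tc; have [|||AC ae] := solw2 c0 t2 Tc.
    + by [].
    + by [].
    + by move=> s gs [h1 h2]; apply: (nog s gs); split => //; exact: le_lt_trans h1.
    split.
      move=> c d' tc cd' d'd; apply: abs_continuous_ext (AC c d' tc cd' d'd).
      by move=> t ct td'; rewrite yw//; rewrite (le_trans Tc)// (le_trans tc).
    exists (~` [set t | c0 <= t /\ (t%:E < t2)%E -> is_derive t 1 w (flow S t (w t) 0)]) => //.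
    move=> t t1t td /contrapT /= h.
    have tT : T < t by exact: le_lt_trans t1t.
    rewrite yw ?(ltW tT)//; apply: is_derive_near_eq (h _); last by split => //; exact: ltW.
    by near=> s; rewrite yw//; near: s; exact: lt_le_nbhsr.
  (* An interval with [T] in its interior excludes an impulse at [T]; the two Lipschitz pieces then
     meet continuously and [M + M'] serves for both. *)
  have cross : t1 < T -> (T%:E < t2)%E -> forall c d, t1 <= c -> c < T -> T <= d ->
      (d%:E < t2)%E -> abs_continuous c d y.
    move=> t1T Tt2 c d t1c cT Td dt2.
    have nT : ~ impulses S T by move=> gT; apply: (nog T gT).
    have zTl : zT = l by rewrite /zT asboolF.
    have nogc s : impulses S s -> ~ (c < s /\ s < T).
      move=> gs [cs sT]; apply: (nog s gs); split; first exact: le_lt_trans cs.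
      by rewrite (lt_trans _ Tt2)// lte_fin.
    have zMc := zM c (le_trans t01 t1c) nogc.
    have lMc := lipschitz_left_limit_le M0 zMc zl.
    have dT' : d < T' by rewrite -lte_fin (lt_le_trans dt2).
    apply: (@lipschitz_abs_continuous _ _ _ _ _ (M + M')) => p q cp pq qd.
    have qp0 : 0 <= q - p by rewrite subr_ge0.
    have [qT|Tq] := ltP q T.
      rewrite !yz//; last exact: le_lt_trans qT.
      by rewrite (le_trans (zMc _ _ cp pq qT))// ler_wpM2r// lerDl.
    have qT' : q < T' by exact: le_lt_trans dT'.
    have [pT|Tp] := ltP p T; last first.
      by rewrite !yw// (le_trans (wM _ _ Tp pq qT'))// ler_wpM2r// lerDr.
    rewrite yw// yz// (le_trans (enorm_dist_trans _ (w T) _))//.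
    have := wM T q (lexx _) Tq qT'; have := lMc p cp pT.
    have qT_qp : M' * (q - T) <= M' * (q - p) by rewrite ler_wpM2l// lerD2l lerN2 ltW.
    have Tp_qp : M * (T - p) <= M * (q - p) by rewrite ler_wpM2l// lerD2r.
    rewrite wT zTl mulrDl [M * (q - p) + _]addrC => h1 h2.
    by rewrite lerD// ?(le_trans h1)// (le_trans h2).
  split.
    move=> c d t1c cd dt2.
    have [Tc|cT] := leP T c.
      have [|||AC _] := loc_w c => //; first exact: le_lt_trans dt2.
      by apply: AC.
    have [Td|dT] := leP T d.
      apply: cross => //; first exact: le_lt_trans cT.
      by rewrite (le_lt_trans _ dt2)// lee_fin.
    have [d1 [dd1 d1T d1t2]] : exists d1, [/\ d < d1, d1 <= T & (d1%:E <= t2)%E].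
      case: t2 dt2 {t12 t2T' nog loc_z loc_w cross} => [r'|_|//].
        rewrite lte_fin => dr; exists (Num.min T r').
        by rewrite lt_min dT dr ge_min lexx lee_fin ge_min lexx orbT.
      by exists T; rewrite dT lexx leey.
    have [|||AC _] := loc_z d1 => //.
      by rewrite (le_lt_trans t1c)// (le_lt_trans cd).
    exact: AC.
  have [E E0 hE] : exists2 E, nullset E & forall t, t1 < t -> (t%:E < t2)%E -> t != T ->
      ~ E t -> is_derive t 1 y (flow S t (y t) 0).
    have [Tt1|t1T] := leP T t1.
      have [|||_ [E E0 hE]] := loc_w t1 => //.
      by exists E => // t t1t tt2 _; exact: hE.
    have [t2T|Tt2] := leP t2 T%:E.
      case: t2 t12 t2T {nog t2T' loc_w cross} loc_z => [r'||//]; last by rewrite leye_eq.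
      rewrite lte_fin lee_fin => t1r rT loc_z.
      have [|||_ [E E0 hE]] := loc_z r' => //.
      by exists E => // t t1t; rewrite lte_fin => tr _; exact: hE.
    have [||_ [E1 E10 hE1]] := loc_z T t1T; [exact: ltW|by []|].
    have [|_ [E2 E20 hE2]] := loc_w T (ltW t1T) Tt2; first exact: lexx.
    exists (E1 `|` E2); first exact: negligibleU.
    move=> t t1t tt2 tT /not_orP[nE1 nE2].
    by have [h|h|h] := ltgtP t T; [exact: hE1|exact: hE2|rewrite h eqxx in tT].
  have : nullset (E `|` ([set t1] `|` [set T])).
    by do 2 (apply: negligibleU => //); exact: nullset1.
  apply: negligibleS => t /= /not_implyP[[t1t tt2] nd].
  apply: contrapT => /not_orP[nE /not_orP[nt1 nT]]; apply: nd; apply: hE => //.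
    by rewrite lt_neqAle t1t andbT; apply/eqP => h; apply: nt1.
  exact/eqP.
- move=> t gt t0t tT'.
  have [tT|Tt|tT] := ltgtP t T.
  + have [l' zl' zt] := jmpz t gt t0t tT; exists l'; last by rewrite yz.
    apply: cvg_trans zl'; apply: near_eq_cvg; near=> s; rewrite yz//.
    by apply: lt_trans tT; near: s; exact: nbhs_left_lt.
  + have [l' wl' wt] := jmpw t gt Tt tT'; exists l'; last by rewrite yw ?ltW.
    apply: cvg_trans wl'; apply: near_eq_cvg; near=> s; rewrite yw//.
    by near: s; exact: nbhs_left_ge.
  + move: gt; rewrite tT => gT; exists l.
      apply: cvg_trans zl; apply: near_eq_cvg.
      by apply: filterS (nbhs_left_lt T) => s sT; rewrite yz.
    by rewrite yw// wT /zT asboolT.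
Unshelve. all: by end_near. Qed.

End zero_input.

(** * Input energy *)

Section energy.
Variables (R : realType) (m : nat) (gam : set R) (u : R -> 'rV[R]_m).
Hypothesis uP : input u.
Implicit Types (a b c s t : R) (rho : R -> R).

Lemma input0 : input (fun=> 0 : 'rV[R]_m).
Proof.
split=> [i|a b _].
  rewrite [X in measurable_fun _ X](_ : _ = cst 0); first exact: measurable_cst.
  by apply/funext => t; rewrite mxE.
by exists 0; apply: aeW => t _; rewrite enorm0.
Qed.

(** [rho] is continuous on the nonnegative reals only, but [rho (Num.sqrt y)] is continuous on the
    whole line, since [Num.sqrt] takes nonnegative values and is itself continuous. *)
Lemma measurable_gain rho : class_K rho ->
  measurable_fun (`[0, +oo[%classic : set (lebesgueR R))
    (fun t : lebesgueR R => rho (enorm (u t))).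
Proof.
move=> rhoK.
have cG : continuous (fun y : R => rho (Num.sqrt y)).
  move=> y; apply/cvgrPdist_lt => e e0.
  have [/within_nneg_continuousP rc _ _] := rhoK.
  have [d d0 hd] := rc (Num.sqrt y) e (sqrtr_ge0 _) e0.
  have /cvgrPdist_lt/(_ d d0) := @sqrt_continuous R y.
  by apply: filterS => s sy; rewrite distrC hd ?sqrtr_ge0// distrC.
apply: (@measurableT_comp _ _ _ _ _ _ (fun y : R => rho (Num.sqrt y))).
  exact: continuous_measurable_fun.
apply: measurable_sum => i; apply: measurable_funX; exact: uP.1.
Qed.

Lemma measurable_gain_itv rho a b : class_K rho -> 0 <= a ->
  measurable_fun (`]a, b]%classic : set (lebesgueR R))
    (fun t : lebesgueR R => (rho (enorm (u t)))%:E).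
Proof.
move=> rhoK a0; apply/measurable_EFinP; apply: measurable_funS (measurable_gain rhoK).
  by apply: sub_caratheodory; exact: measurable_itv.
by move=> t /=; rewrite !in_itv/= andbT => /andP[/ltW h _]; exact: le_trans h.
Qed.

Lemma gain_ge0 rho t : class_K rho -> (0 <= (rho (enorm (u t)))%:E)%E.
Proof. by move=> rhoK; rewrite lee_fin class_K_ge0// enorm_ge0. Qed.

Lemma input_energyD rho1 rho2 a b c : class_K rho1 -> class_K rho2 ->
  0 <= a -> a <= b -> b <= c ->
  (input_energy rho1 rho2 gam `]a, c] u =
   input_energy rho1 rho2 gam `]a, b] u + input_energy rho1 rho2 gam `]b, c] u)%E.
Proof.
move=> K1 K2 a0 ab bc; rewrite /input_energy.
have acE : `]a, c]%classic = `]a, b]%classic `|` `]b, c]%classic :> set R.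
  apply/seteqP; split => t /=; rewrite !in_itv/=.
    by move=> /andP[-> ->]; have [|] := leP t b; [left|right].
  by case=> /andP[h1 h2]; apply/andP; split; lra.
have disj : [disjoint `]a, b]%classic & `]b, c]%classic].
  apply/disj_setPS => t /= []; rewrite !in_itv/= => /andP[h1 h2] /andP[h3 h4]; lra.
have mab : measurable (`]a, b]%classic : set (lebesgueR R)).
  by apply: sub_caratheodory; exact: measurable_itv.
have mbc : measurable (`]b, c]%classic : set (lebesgueR R)).
  by apply: sub_caratheodory; exact: measurable_itv.
have mrho : measurable_fun (`]a, b]%classic `|` `]b, c]%classic : set (lebesgueR R))
    (fun t : lebesgueR R => (rho1 (enorm (u t)))%:E).
  by rewrite -acE; exact: measurable_gain_itv.
have rho0 t : (`]a, b]%classic `|` `]b, c]%classic) t -> (0 <= (rho1 (enorm (u t)))%:E)%E.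
  by move=> _; exact: gain_ge0.
rewrite {1}acE (ge0_integral_setU _ mab mbc mrho rho0 disj).
rewrite (esumID `]a, b]%classic); last by move=> t _; exact: gain_ge0.
have -> : gam `&` `]a, c] `&` `]a, b] = gam `&` `]a, b].
  by rewrite -setIA; congr (_ `&` _); rewrite setIC; apply/setIidPl; rewrite acE; exact: subsetUl.
have -> : gam `&` `]a, c] `&` ~` `]a, b] = gam `&` `]b, c].
  rewrite -setIA; congr (_ `&` _); apply/seteqP; split => t /=; rewrite !in_itv/=.
    move=> [/andP[h1 h2] h3]; rewrite h2 andbT ltNge; apply/negP => h4.
    by apply: h3; rewrite h1.
  move=> /andP[h1 h2]; split; first by apply/andP; split; lra.
  by move=> /andP[_]; rewrite leNgt h1.
by rewrite addeACA.
Qed.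

Lemma input_energy_ge0 rho1 rho2 (A : set R) : class_K rho1 -> class_K rho2 ->
  (0 <= input_energy rho1 rho2 gam A u)%E.
Proof.
move=> K1 K2; apply: adde_ge0.
  by apply: integral_ge0 => t _; exact: gain_ge0.
by apply: esum_ge0 => t _; exact: gain_ge0.
Qed.

Lemma gain_le_energy rho1 rho2 a b s : class_K rho1 -> class_K rho2 ->
  gam s -> a < s -> s <= b ->
  ((rho2 (enorm (u s)))%:E <= input_energy rho1 rho2 gam `]a, b] u)%E.
Proof.
move=> K1 K2 gs as_ sb; apply: (@le_trans _ _ (\esum_(t in gam `&` `]a, b]) (rho2 (enorm (u t)))%:E)%E).
  rewrite -(@esum_set1 _ _ s (fun t => (rho2 (enorm (u t)))%:E)); last exact: gain_ge0.
  rewrite (esumID [set s] (gam `&` _)); last by move=> t _; exact: gain_ge0.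
  rewrite (_ : gam `&` `]a, b] `&` [set s] = [set s]).
    by apply: leeDl; apply: esum_ge0 => t _; exact: gain_ge0.
  by apply/seteqP; split => [t []//|t ->]; split => //; split => //=; rewrite in_itv/= as_.
by apply: leeDr; apply: integral_ge0 => t _; exact: gain_ge0.
Qed.

Lemma integral_le_energy rho1 rho2 (A : set R) : class_K rho2 ->
  (\int[completed_lebesgue_measure]_(t in (A : set (lebesgueR R))) (rho1 (enorm (u t)))%:E <=
   input_energy rho1 rho2 gam A u)%E.
Proof. by move=> K2; apply: leeDl; apply: esum_ge0 => t _; exact: gain_ge0. Qed.

Lemma input_energy_mono rho1 rho1' rho2 a b : class_K rho1 -> class_K rho1' -> 0 <= a ->
  (forall r, 0 <= r -> rho1 r <= rho1' r) ->
  (input_energy rho1 rho2 gam `]a, b] u <= input_energy rho1' rho2 gam `]a, b] u)%E.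
Proof.
move=> K1 K1' a0 h; apply: leeD => //; apply: ge0_le_integral.
- by apply: sub_caratheodory; exact: measurable_itv.
- by move=> t _; exact: gain_ge0.
- exact: measurable_gain_itv.
- exact: measurable_gain_itv.
- by move=> t _; rewrite lee_fin h// enorm_ge0.
Qed.

(** The input is bounded only almost everywhere, so the gain is capped at [rho |M|] before taking a
    primitive. The cap changes it on a null set and cannot increase the integral. *)
Lemma gain_primitive rho a b : class_K rho -> 0 <= a -> a <= b ->
  exists (U : R -> R) (K : R) (E : set R), [/\ U a = 0,
    forall c d, a <= c -> c <= d -> d <= b -> 0 <= U d - U c <= K * (d - c),
    (@completed_lebesgue_measure R).-negligible E,
    forall t, a < t < b -> ~ E t -> is_derive t 1 U (rho (enorm (u t))) &
    ((U b)%:E <= \int[completed_lebesgue_measure]_(t in (`]a, b]%classic : set (lebesgueR R)))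
      (rho (enorm (u t)))%:E)%E].
Proof.
move=> rhoK a0 ab; have [M hM] := uP.2 a b a0.
have K0 : 0 <= rho `|M| by apply: class_K_ge0.
pose h t := Num.min (rho (enorm (u t))) (rho `|M|).
have mh : measurable_fun (`[a, b]%classic : set (lebesgueR R)) (h : lebesgueR R -> R).
  apply: (@measurable_minr _ _ _ _ (fun t : lebesgueR R => rho (enorm (u t))) (cst (rho `|M|))); last exact: measurable_cst.
  apply: measurable_funS (measurable_gain rhoK).
    by apply: sub_caratheodory; exact: measurable_itv.
  by move=> t /=; rewrite !in_itv/= andbT => /andP[h1 _]; exact: le_trans h1.
have [|U [E [U0 UK E0 dU iU]]] := @exists_primitive R h a b 0 (rho `|M|) ab mh.
  by move=> t _; rewrite /h le_min class_K_ge0 ?enorm_ge0//= K0 ge_min lexx orbT.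
exists U, (rho `|M|), (E `|` ~` [set t | a <= t <= b -> enorm (u t) <= M]); split => //.
- by move=> c d h1 h2 h3; have := UK c d h1 h2 h3; rewrite mul0r.
- exact: negligibleU.
- move=> t tab /not_orP[nE /contrapT /= uM].
  have /andP[t1 t2] := tab.
  have -> : rho (enorm (u t)) = h t.
    rewrite /h min_l// class_K_le// ?enorm_ge0// (le_trans (uM _)) ?ler_norm//.
    by rewrite (ltW t1) (ltW t2).
  exact: dU.
- rewrite iU// ?ab ?lexx//; apply: ge0_le_integral.
  + by apply: sub_caratheodory; exact: measurable_itv.
  + by move=> t _; rewrite lee_fin le_min class_K_ge0 ?enorm_ge0.
  + apply/measurable_EFinP; apply: measurable_funS mh.
      by apply: sub_caratheodory; exact: measurable_itv.
    exact: subset_itv_oc_cc.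
  + exact: measurable_gain_itv.
  + by move=> t _; rewrite lee_fin /h ge_min lexx.
Qed.

End energy.

Lemma input_energy0 (R : realType) (m : nat) (gam A : set R) rho1 rho2 :
  class_K rho1 -> class_K rho2 ->
  input_energy rho1 rho2 gam A (fun=> 0 : 'rV[R]_m) = 0%E.
Proof.
move=> [_ _ r1] [_ _ r2]; rewrite /input_energy.
rewrite integral0_eq ?add0e; last by move=> t _; rewrite enorm0 r1.
by apply: esum1 => t _; rewrite enorm0 r2.
Qed.

(** * Closeness to the zero-input trajectory *)

Section gronwall.
Variable R : realType.

Lemma ae_nonincreasing_derivative (a b : R) (w : R -> R) (E : set R) : a <= b ->
  abs_continuous_fun a b w -> (@completed_lebesgue_measure R).-negligible E ->
  (forall t, a < t < b -> ~ E t -> exists2 l, is_derive t 1 w l & l <= 0) ->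
  w b <= w a.
Proof.
move=> ab ACw E0 dw; apply: (ae_nonincreasing ab ACw E0) => t tab nE e e0.
have [l dl l0] := dw t tab nE.
have [r r0 hr] := is_derive_straddle dl e0; exists r => // c d _ ct td _ dcr.
have := hr c d ct td dcr; rewrite ler_norml => /andP[_].
have : (d - c) *: l <= 0 by rewrite /GRing.scale/= mulr_ge0_le0//; lra.
by move: ((d - c) *: l) => y; lra.
Qed.

Lemma is_derive_affine (k c t : R) : is_derive t 1 (fun s => k * (s - c)) k.
Proof.
apply/is_deriveP => e e0; exists 1 => // h _.
rewrite (_ : _ - _ = 0) ?normr0 ?mulr_ge0 ?(ltW e0)//.
by rewrite /GRing.scale/=; ring.
Qed.

Variable n : nat.
Implicit Types (x z : R -> 'rV[R]_n).

Lemma is_derive_sqr_enorm x (t : R) v : is_derive t 1 x v ->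
  is_derive t 1 (fun s => enorm (x s) ^+ 2) (2 * \sum_(i < n) x t ord0 i * v ord0 i).
Proof.
move=> dx.
have -> : (fun s => enorm (x s) ^+ 2) = \sum_(i < n) (fun s => x s ord0 i) ^+ 2.
  by apply/funext => s; rewrite sqr_enorm fct_sumE.
rewrite mulr_sumr; apply: is_derive_sum => i.
have := is_deriveX 2 (is_derive_coord i dx).
by rewrite /= expr1 /GRing.scale/= mulrA.
Qed.

(* The squared distance, weighted by [exp (- 2 L (s - a))] to absorb the
   Lipschitz term, grows at most like [4 r h] because [enorm (x s - z s)] is at
   most [2 r]. *)
Lemma gronwall_sqr x z (a b r L K : R) (h U : R -> R) (E : set R) :
  a <= b -> 0 <= r -> 0 <= L ->
  abs_continuous a b x -> abs_continuous a b z ->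
  (forall t, a <= t -> t <= b -> enorm (x t) <= r) ->
  (forall t, a <= t -> t <= b -> enorm (z t) <= r) ->
  (forall c d, a <= c -> c <= d -> d <= b -> 0 <= U d - U c <= K * (d - c)) ->
  (@completed_lebesgue_measure R).-negligible E ->
  (forall t, a < t < b -> ~ E t -> is_derive t 1 U (h t) /\
     exists v w : 'rV[R]_n, [/\ is_derive t 1 x v, is_derive t 1 z w, 0 <= h t &
       enorm (v - w) <= L * enorm (x t - z t) + h t]) ->
  enorm (x b - z b) ^+ 2 <=
    expR (2 * L * (b - a)) * (enorm (x a - z a) ^+ 2 + 4 * r * (U b - U a)).
Proof.
move=> ab r0 L0 ACx ACz xr zr UK E0 dE.
pose q t := enorm (x t - z t) ^+ 2.
pose ex t := expR (- (2 * L) * (t - a)).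
pose W t := q t * ex t - 4 * r * U t.
have y2r t : a <= t -> t <= b -> enorm (x t - z t) <= 2 * r.
  by move=> h1 h2; have := enormB (x t) (z t); have := xr t h1 h2; have := zr t h1 h2; lra.
have ex0 t : 0 <= ex t by exact: expR_ge0.
have ex1 t : a <= t -> ex t <= 1.
  move=> h1; rewrite -[leRHS]expR0 ler_expR mulNr oppr_le0; apply: mulr_ge0; lra.
have exlip c d : a <= c -> c <= d -> 0 <= ex c - ex d <= 2 * L * (d - c).
  move=> ac cd; have -> : ex d = ex c * expR (- (2 * L) * (d - c)).
    by rewrite -expRD; congr expR; ring.
  have := expR_ge1Dx (- (2 * L) * (d - c)).
  have Ldc : 0 <= 2 * L * (d - c) by apply: mulr_ge0; lra.
  have : expR (- (2 * L) * (d - c)) <= 1 by rewrite -[leRHS]expR0 ler_expR !mulNr oppr_le0.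
  move: (expR (- (2 * L) * (d - c))) => y y1 y2.
  have -> : ex c - ex c * y = ex c * (1 - y) by ring.
  apply/andP; split; first by rewrite mulr_ge0 ?ex0//; lra.
  have : ex c * (1 - y) <= 1 * (1 - y) by rewrite ler_wpM2r ?ex1//; lra.
  lra.
have q0 t : 0 <= q t by exact: sqr_ge0.
have ACW : abs_continuous_fun a b W.
  have K0 : 0 <= K * (b - a) by have /andP[h1 h2] := UK a b (lexx _) ab (lexx _); exact: le_trans h2.
  (* The three summands account for the increments of the squared distance, of the exponential
     weight and of [U], in this order. *)
  apply: (@abs_continuous_fun_dominated _ _ a b x z W (4 * r + 8 * r ^+ 2 * L + 4 * r * `|K|)) => //.
    have k2 : 0 <= 8 * r ^+ 2 * L by apply: mulr_ge0 => //; apply: mulr_ge0; rewrite ?exprn_ge0.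
    have k3 : 0 <= 4 * r * `|K| by apply: mulr_ge0 => //; apply: mulr_ge0.
    lra.
  move=> c d ac cd db.
  have ad := le_trans ac cd; have cb := le_trans cd db.
  set D := enorm (x d - x c) + enorm (z d - z c).
  have D0 : 0 <= D by rewrite addr_ge0// enorm_ge0.
  have qlip : `|q d - q c| <= 4 * r * D.
    rewrite /q subr_sqr normrM mulrC; apply: ler_pM => //.
      rewrite ger0_norm ?addr_ge0 ?enorm_ge0//.
      by have := y2r d ad db; have := y2r c ac cb; lra.
    have tri (v w : 'rV[R]_n) : enorm v - enorm w <= enorm (v - w) :> R.
      by have := enorm_subr v w; lra.
    have le1 : enorm ((x d - z d) - (x c - z c)) <= D.
      have -> : (x d - z d) - (x c - z c) = (x d - x c) - (z d - z c).
        by rewrite !opprB addrACA [RHS]addrACA; congr (_ + _); rewrite addrC.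
      exact: enormB.
    rewrite ler_norml; apply/andP; split.
      by have := tri (x c - z c) (x d - z d); rewrite (enorm_distC (x c - z c) (x d - z d)); lra.
    by have := tri (x d - z d) (x c - z c); lra.
  have := exlip c d ac cd => /andP[e1 e2].
  have /andP[u1 u2] := UK c d ac cd db.
  have qc : q c <= 4 * r ^+ 2.
    have := y2r c ac cb; rewrite /q => h1.
    have -> : 4 * r ^+ 2 = (2 * r) ^+ 2 by ring.
    by rewrite ler_pXn2r// nnegrE ?enorm_ge0// mulr_ge0.
  have -> : W d - W c = (q d - q c) * ex d - q c * (ex c - ex d) - 4 * r * (U d - U c).
    by rewrite /W; ring.
  have t1 : `|(q d - q c) * ex d| <= 4 * r * D.
    rewrite normrM (ger0_norm (ex0 d)); apply: le_trans qlip.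
    by rewrite ler_piMr// ex1.
  have t2 : `|q c * (ex c - ex d)| <= 8 * r ^+ 2 * L * (d - c).
    rewrite ger0_norm; last exact: (mulr_ge0 (q0 c) e1).
    have -> : 8 * r ^+ 2 * L * (d - c) = 4 * r ^+ 2 * (2 * L * (d - c)) by ring.
    exact: ler_pM.
  have t3 : `|4 * r * (U d - U c)| <= 4 * r * `|K| * (d - c).
    rewrite ger0_norm ?mulr_ge0// -[leRHS]mulrA ler_wpM2l ?mulr_ge0//.
    rewrite (le_trans u2)// ler_wpM2r ?subr_ge0//; exact: ler_norm.
  rewrite (le_trans (ler_normB _ _))// (le_trans (lerD (ler_normB _ _) (lexx _)))//.
  have dc0 : 0 <= d - c by rewrite subr_ge0.
  have r20 : 0 <= r ^+ 2 by exact: exprn_ge0.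
  have c1 : 0 <= 8 * r ^+ 2 * L * D by rewrite !mulr_ge0.
  have c2 : 0 <= 4 * r * `|K| * D by rewrite !mulr_ge0.
  have c3 : 0 <= 4 * r * (d - c) by rewrite !mulr_ge0.
  lra.
have : W b <= W a.
  apply: (ae_nonincreasing_derivative ab ACW E0) => t tab nE.
  have /andP[/ltW at_ /ltW tb] := tab.
  have [dU [v [w [dx dz h0 vw]]]] := dE t tab nE.
  have dy := is_deriveB dx dz.
  have dq := is_derive_sqr_enorm dy.
  have dex := @is_derive1_comp R expR (fun s => - (2 * L) * (s - a)) t _ _ (is_derive_expR _) (is_derive_affine (- (2 * L)) a t).
  have dqe := is_deriveM dq dex.
  have dW := is_deriveB dqe (is_deriveZ (4 * r) dU).
  eexists; first exact: dW.
  have cs : \sum_(i < n) (x - z) t ord0 i * (v - w) ord0 i <= enorm (x t - z t) * enorm (v - w).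
    exact: cauchy_schwarz_rV.
  have y0 := enorm_ge0 (x t - z t).
  have := ler_wpM2l y0 vw => h1.
  have := ex0 t; have := ex1 t at_; have := y2r t at_ tb.
  rewrite /GRing.scale/= -/(ex t).
  move: cs h1 y0; set s := \sum_(i < n) _; set y := enorm (x t - z t); move: (enorm (v - w)) => N.
  move=> cs h1 y0 y2 e1 e0.
  (* Cauchy-Schwarz gives [2 * s <= 2 * y * (L * y + h t)], and [y <= 2 * r]. The weight in [[0, 1]]
     is then dropped according to the sign of the left-hand side. *)
  have key : 2 * s - 2 * L * y ^+ 2 <= 4 * r * h t.
    have : y * h t <= 2 * r * h t by rewrite ler_wpM2r.
    move: h1; rewrite mulrDr; have -> : y * (L * y) = L * y ^+ 2 by ring.
    lra.
  have h4 : 0 <= 4 * r * h t by rewrite !mulr_ge0.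
  have : ex t * (2 * s - 2 * L * y ^+ 2) <= 4 * r * h t.
    have [h5|h5] := leP 0 (2 * s - 2 * L * y ^+ 2).
      by apply: le_trans key; rewrite ler_piMl.
    by apply: le_trans h4; rewrite mulr_ge0_le0// ltW.
  move: (ex t) => e; lra.
have exa : ex a = 1 by rewrite /ex subrr mulr0 expR0.
rewrite /W exa mulr1 => hW.
have hqb : q b * ex b <= q a + 4 * r * (U b - U a) by lra.
have -> : enorm (x b - z b) ^+ 2 = expR (2 * L * (b - a)) * (q b * ex b).
  rewrite mulrCA; suff -> : expR (2 * L * (b - a)) * ex b = 1 by rewrite mulr1.
  by rewrite /ex -expRD -[RHS]expR0; congr expR; ring.
by rewrite ler_wpM2l// expR_ge0.
Qed.

End gronwall.

Lemma enorm_left_limit_le (R : realType) (n : nat) (x : R -> 'rV[R]_n) (a b r : R)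
    (l : 'rV[R]_n) : a < b -> (forall s, a <= s -> s < b -> enorm (x s) <= r) ->
  x s @[s --> b^'-] --> l -> enorm l <= r.
Proof.
move=> ab xr xl; apply/ler_addgt0Pr => e e0.
have : \forall s \near b^'-, enorm (x s - l) <= e by move/cvg_enorm : xl; exact.
move=> xle; near (b^'-) => s.
have h1 : enorm (x s - l) <= e by near: s.
have h2 : a < s by near: s; exact: nbhs_left_gt.
have h3 : s < b by near: s; exact: nbhs_left_lt.
have := xr s (ltW h2) h3; have := enorm_subr l (x s); rewrite enorm_distC; lra.
Unshelve. all: by end_near. Qed.

Section closeness.
Variables (R : realType) (n m : nat) (Lambda : Type).
Variable S : Lambda -> impulsive_system R n m.
Variables (nu N rho1 rho2 : R -> R).
Hypothesis nuK : class_K nu.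
Hypothesis Nhomo : {in `[0, +oo[ &, {homo N : r s / r <= s}}.
Hypothesis N0 : forall r : R, 0 <= r -> 0 < N r.
Hypothesis flow_growth : forall l (t : R) xi mu, 0 <= t ->
  enorm (flow (S l) t xi mu) <= N (enorm xi) * (1 + nu (enorm mu)).
Hypothesis f_ii : uniform_continuity_at_zero_input (fun l => flow (S l)).
Hypothesis f_iii : uniform_local_lipschitz (fun l => flow (S l)).
Hypothesis g_ii : uniform_continuity_at_zero_input (fun l => jump (S l)).
Hypothesis g_iii : uniform_local_modulus (fun l => jump (S l)).
Hypothesis rho1K : class_K rho1.
Hypothesis rho2K : class_K rho2.
Hypothesis nu_le : forall r : R, 0 <= r -> nu r <= rho1 r.

Local Notation u0 := (fun=> 0 : 'rV[R]_m).

Lemma flow_growth_le r l (t : R) xi mu : 0 <= t -> enorm xi <= r ->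
  enorm (flow (S l) t xi mu) <= N r * (1 + nu (enorm mu)).
Proof.
move=> t0 xir; rewrite (le_trans (flow_growth _ _ _ t0))// ler_wpM2r//.
  by rewrite addr_ge0// class_K_ge0// enorm_ge0.
have r0 : 0 <= r by exact: le_trans (enorm_ge0 _) xir.
by apply: Nhomo => //; apply: in_nneg => //; exact: enorm_ge0.
Qed.

Lemma flow_zero_bounded l (r : R) : 0 <= r -> exists2 M : R, 0 <= M &
  forall (t : R) xi, 0 <= t -> enorm xi <= r -> enorm (flow (S l) t xi 0) <= M.
Proof.
move=> r0; exists (N r); first exact/ltW/N0.
move=> t xi t0 xir; rewrite (le_trans (flow_growth_le _ _ t0 xir))//.
by rewrite enorm0; case: nuK => _ _ ->; rewrite addr0 mulr1.
Qed.

Lemma flow_zero_lipschitz l (r : R) : 0 < r -> exists2 L : R, 0 <= L &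
  forall (t : R) xi1 xi2, 0 <= t -> enorm xi1 <= r -> enorm xi2 <= r ->
    enorm (flow (S l) t xi1 0 - flow (S l) t xi2 0) <= L * enorm (xi1 - xi2).
Proof. by move=> r0; have [L L0 hL] := f_iii r0; exists L => // t *; exact: hL. Qed.

Lemma zero_input_global l (t0 r : R) (x0 : 'rV[R]_n) : 0 <= t0 ->
  (forall z T t, maximal_solution (S l) t0 x0 u0 z T -> t0 <= t -> (t%:E < T)%E ->
    enorm (z t) <= r) ->
  exists z, maximal_solution (S l) t0 x0 u0 z +oo%E.
Proof.
move=> t00 zr.
have [w [T [M [solw _ _]]]] := local_solution (flow_zero_bounded l) (@flow_zero_lipschitz l) x0 t00.
have [z [T' [maxz _ _]]] := solution_extends_maximal solw.
have [solz nomax] := maxz; have [[t0T' _] _ _] := solz.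
have r0 : 0 <= r by apply: le_trans (zr z T' t0 maxz (lexx _) t0T'); exact: enorm_ge0.
exists z; case: T' maxz solz nomax t0T' => [T'| |] maxz solz nomax t0T'; [|exact: maxz|by []].
have [|y [T2 [soly T'T2 yz]]] := extend_bounded_solution (flow_zero_bounded l) (@flow_zero_lipschitz l) t00 r0 solz.
  by move=> t t0t tT'; apply: (zr z T'%:E) => //; rewrite lte_fin.
by exfalso; apply: nomax; exists y, T2%:E.
Qed.

(** For [enorm mu <= d] uniform continuity gives [eta]. Beyond [d] the growth bound gives at most
    [2 * N r * (1 + nu (enorm mu))], where [1 <= rho1 (enorm mu) / rho1 d] and [nu <= rho1].
    Domination of [nu] by the gain enters here. *)
Lemma flow_perturbation (r eta : R) : 0 < r -> 0 < eta -> exists2 kappa : R, 0 <= kappa &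
  forall l (t : R) xi mu, 0 <= t -> enorm xi <= r ->
    enorm (flow (S l) t xi mu - flow (S l) t xi 0) <= eta + kappa * rho1 (enorm mu).
Proof.
move=> r0 eta0; have [d d0 hd] := f_ii r0 eta0.
have rd0 : 0 < rho1 d by exact: class_K_gt0.
have Nr0 : 0 < N r by apply/N0/ltW.
pose k := 2 * N r * ((rho1 d)^-1 + 1).
have k0 : 0 <= k by rewrite !mulr_ge0 ?addr_ge0 ?invr_ge0// ltW.
exists k => // l t xi mu t0 xir.
have mu0 := enorm_ge0 mu; have rmu0 := class_K_ge0 rho1K mu0.
have [mud|dmu] := leP (enorm mu) d.
  by rewrite (le_trans (ltW (hd l t xi mu t0 xir mud)))// lerDl mulr_ge0.
apply: (@le_trans _ _ (k * rho1 (enorm mu))); last by rewrite lerDr ltW.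
have h1 := flow_growth_le l mu t0 xir; have h2 := flow_growth_le l 0 t0 xir.
have := enormB (flow (S l) t xi mu) (flow (S l) t xi 0).
move: h2; rewrite enorm0; have [_ _ ->] := nuK; rewrite addr0 mulr1 => h2 h3.
have h4 : 1 <= (rho1 d)^-1 * rho1 (enorm mu).
  by rewrite mulrC ler_pdivlMr// mul1r class_K_le// ltW.
have h5 := nu_le mu0.
have nu0 := class_K_ge0 nuK mu0.
have h6 : 2 * N r * (1 + nu (enorm mu)) <= k * rho1 (enorm mu).
  rewrite /k -[leRHS]mulrA ler_wpM2l ?mulr_ge0 ?(ltW Nr0)//.
  by rewrite mulrDl mul1r lerD.
have : 0 <= N r * nu (enorm mu) by rewrite mulr_ge0 ?(ltW Nr0).
lra.
Qed.

Lemma flow_close (r H eps : R) : 0 < r -> 0 <= H -> 0 < eps -> exists2 del : R, 0 < del &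
  forall l u x z (xa za : 'rV[R]_n) T T' (a b : R), input u ->
    solution (S l) a xa u x T -> solution (S l) a za u0 z T' ->
    0 <= a -> a <= b -> (b%:E < T)%E -> (b%:E < T')%E -> b - a <= H ->
    (forall s, impulses (S l) s -> ~ (a < s /\ s <= b)) ->
    (forall t, a <= t -> t <= b -> enorm (x t) <= r /\ enorm (z t) <= r) ->
    enorm (x a - z a) <= del ->
    (input_energy rho1 rho2 (impulses (S l)) `]a, b] u <= del%:E)%E ->
    enorm (x b - z b) <= eps.
Proof.
move=> r0 H0 eps0; have [L L0 hL] := f_iii r0.
pose C := expR (2 * L * H); have C0 : 0 < C by exact: expR_gt0.
(* Sized so that the drift due to [eta] contributes at most a quarter of [eps ^+ 2]; [H + 1] because
   [H] may vanish. *)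
pose eta := eps ^+ 2 / (C * (16 * r * (H + 1))).
have den0 : 0 < C * (16 * r * (H + 1)) by rewrite !mulr_gt0// ltr_wpDl.
have e20 : 0 < eps ^+ 2 by exact: exprn_gt0.
have eta0 : 0 < eta by rewrite divr_gt0.
have etaE : C * (4 * r * (eta * H)) <= eps ^+ 2 / 4.
  have -> : eps ^+ 2 / 4 = C * (4 * r * (eta * (H + 1))).
    have H1 : H + 1 != 0 by rewrite gt_eqF// ltr_wpDl.
    by rewrite /eta; field; rewrite ?H1 ?(gt_eqF r0) ?(gt_eqF C0).
  by rewrite ler_wpM2l ?(ltW C0)// ler_wpM2l ?mulr_ge0 ?(ltW r0)// ler_wpM2l ?(ltW eta0)// lerDl.
have [k k0 hk] := flow_perturbation r0 eta0.
have rk0 : 0 <= 4 * r * k by rewrite !mulr_ge0// ltW.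
have den2 : 0 < 2 * C * (1 + 4 * r * k) by rewrite !mulr_gt0// ltr_wpDr.
(* Initial gap and energy together contribute at most half of [eps ^+ 2]; [del <= 1] lets [del]
   bound the squared gap. *)
pose del := Num.min 1 (eps ^+ 2 / (2 * C * (1 + 4 * r * k))).
have del0 : 0 < del by rewrite lt_min ltr01 divr_gt0.
have del1 : del <= 1 by rewrite ge_min lexx.
have delE : C * (del * (1 + 4 * r * k)) <= eps ^+ 2 / 2.
  have : del <= eps ^+ 2 / (2 * C * (1 + 4 * r * k)) by rewrite ge_min lexx orbT.
  rewrite ler_pdivlMr// => h.
  have -> : C * (del * (1 + 4 * r * k)) = del * (2 * C * (1 + 4 * r * k)) / 2 by field.
  by rewrite ler_wpM2r.
exists del => // l u x z xa za T T' a b uP solx solz a0 ab bT bT' baH nogam xzr xza en.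
have [ACx [E1 E10 dx]] := solution_flow solx (lexx a) ab bT nogam.
have [ACz [E2 E20 dz]] := solution_flow solz (lexx a) ab bT' nogam.
have [U [K [E [Ua UK E0 dU Ub]]]] := gain_primitive uP rho1K a0 ab.
have Ubdel : U b <= del.
  rewrite -lee_fin (le_trans Ub)// (le_trans _ en)//.
  exact: integral_le_energy.
have Ub0 : 0 <= U b by have /andP[] := UK a b (lexx _) ab (lexx _); rewrite Ua subr0.
have := @gronwall_sqr R n x z a b r L (eta + k * K) (fun t => eta + k * rho1 (enorm (u t)))
  (fun t => eta * (t - a) + k * U t) (E `|` (E1 `|` E2)) ab (ltW r0) L0 ACx ACz.
have h0 t : 0 <= eta + k * rho1 (enorm (u t)).
  by rewrite addr_ge0 ?(ltW eta0)// mulr_ge0// class_K_ge0// enorm_ge0.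
move=> /(_ _ _ _ _ _)-H1.
have {}H1 : enorm (x b - z b) ^+ 2 <= expR (2 * L * (b - a)) * (enorm (x a - z a) ^+ 2 +
    4 * r * (eta * (b - a) + k * U b - (eta * (a - a) + k * U a))).
  apply: H1.
  - by move=> t h1 h2; have [] := xzr t h1 h2.
  - by move=> t h1 h2; have [] := xzr t h1 h2.
  - move=> c d ac cd db; have /andP[u1 u2] := UK c d ac cd db.
    have e1 : 0 <= eta * (d - c) by rewrite mulr_ge0 ?(ltW eta0)// subr_ge0.
    have e2 : 0 <= k * (U d - U c) by rewrite mulr_ge0.
    have e3 : k * (U d - U c) <= k * (K * (d - c)) by rewrite ler_wpM2l.
    have -> : eta * (d - a) + k * U d - (eta * (c - a) + k * U c) =
      eta * (d - c) + k * (U d - U c) by ring.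
    by rewrite addr_ge0//= mulrDl lerD2l -mulrA.
  - by do 2 (apply: negligibleU => //).
  - move=> t tab /not_orP[nE /not_orP[nE1 nE2]]; split.
      exact: (is_deriveD (is_derive_affine eta a t) (is_deriveZ k (dU t tab nE))).
    have /andP[/ltW at_ /ltW tb] := tab.
    have [xr zr] := xzr t at_ tb; have t0 := le_trans a0 at_.
    exists (flow (S l) t (x t) (u t)), (flow (S l) t (z t) 0); split.
    + exact: dx.
    + exact: dz.
    + exact: h0.
    + rewrite (le_trans (enorm_dist_trans _ (flow (S l) t (x t) 0) _))// addrC lerD//.
        exact: hL.
      exact: hk.
move: H1; rewrite Ua subrr !mulr0 addr0 subr0 => H1.
rewrite -(ler_pXn2r (n := 2))// ?nnegrE ?enorm_ge0 ?(ltW eps0)//.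
apply: le_trans H1 _.
have xz0 := enorm_ge0 (x a - z a).
have sq : enorm (x a - z a) ^+ 2 <= del.
  apply: (@le_trans _ _ (del ^+ 2)); first by rewrite ler_pXn2r// nnegrE// ltW.
  by rewrite expr2 ler_piMr// ltW.
apply: (@le_trans _ _ (C * (del + 4 * r * (eta * H + k * del)))).
  apply: ler_pM.
  - exact: expR_ge0.
  - rewrite addr_ge0 ?exprn_ge0// mulr_ge0 ?mulr_ge0 ?(ltW r0)// addr_ge0// mulr_ge0//.
      exact: ltW.
    by rewrite subr_ge0.
  - by rewrite ler_expR ler_wpM2l// mulr_ge0.
  - rewrite lerD// ler_wpM2l ?mulr_ge0 ?(ltW r0)// lerD// ler_wpM2l// ltW//.
have -> : C * (del + 4 * r * (eta * H + k * del)) =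
  C * (del * (1 + 4 * r * k)) + C * (4 * r * (eta * H)) by ring.
apply: le_trans (lerD delE etaE) _; lra.
Qed.

(* Induction on the number of impulses: the flow after the last impulse is
   handled by [flow_close], the jump by [g_ii] and [g_iii], and what precedes
   it by the induction hypothesis, through left limits. *)
Lemma solutions_close (r H : R) (k : nat) (eps : R) : 0 < r -> 0 <= H -> 0 < eps ->
  exists2 del : R, 0 < del &
  forall l u x z (xa za : 'rV[R]_n) T T' (a b : R), input u ->
    solution (S l) a xa u x T -> solution (S l) a za u0 z T' ->
    0 <= a -> a <= b -> (b%:E < T)%E -> (b%:E < T')%E -> b - a <= H ->
    (nimpulses (impulses (S l)) `]a, b] <= k)%N ->
    (forall t, a <= t -> t <= b -> enorm (x t) <= r /\ enorm (z t) <= r) ->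
    enorm (x a - z a) <= del ->
    (input_energy rho1 rho2 (impulses (S l)) `]a, b] u <= del%:E)%E ->
    enorm (x b - z b) <= eps.
Proof.
move=> r0 H0; elim: k eps => [|k IH] eps eps0.
  have [del del0 hdel] := flow_close r0 H0 eps0; exists del => //.
  move=> l u x z xa za T T' a b uP solx solz a0 ab bT bT' baH nk.
  apply: (hdel l u x z xa za T T' a b) => // s gs [as_ sb].
  by have := nimpulses_gt0 (impulsesP (S l)) gs as_ sb; rewrite ltnNge nk.
have [d1 d10 hd1] := flow_close r0 H0 eps0.
have d130 : 0 < d1 / 3 by rewrite divr_gt0.
have [om [omK _] hom] := g_iii r0.
have [d2' d2'0 hd2'] := class_K_small omK d130.
(* The gap after the jump is split in three: the gap of the left limits, the effect of the input on
   the jump, and the modulus [om] at the gap of the left limits. *)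
pose d2 := Num.min (d1 / 3) d2'.
have d20 : 0 < d2 by rewrite lt_min d130.
have d21 : d2 <= d1 / 3 by rewrite ge_min lexx.
have d22 : d2 <= d2' by rewrite ge_min lexx orbT.
have [dg dg0 hdg] := g_ii r0 d130.
have [d3 d30 hd3] := IH d2 d20.
have rdg0 : 0 < rho2 dg by exact: class_K_gt0.
(* Energy below [rho2 dg] forces [enorm (u tau) <= dg], since the input at an impulse enters the
   energy as a separate term. *)
pose del := Num.min (Num.min d1 d3) (rho2 dg).
have del0 : 0 < del by rewrite !lt_min d10 d30.
have del1 : del <= d1 by rewrite !ge_min lexx.
have del3 : del <= d3 by rewrite !ge_min lexx orbT.
have delg : del <= rho2 dg by rewrite !ge_min lexx orbT.
exists del => // l u x z xa za T T' a b uP solx solz a0 ab bT bT' baH nk xzr xza en.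
have [[s0 [gs0 as0 s0b]]|nogam] :=
    pselect (exists s, [/\ impulses (S l) s, a < s & s <= b]); last first.
  apply: (hd1 l u x z xa za T T' a b) => //.
  - by move=> s gs [h1 h2]; apply: nogam; exists s.
  - exact: le_trans del1.
  - by rewrite (le_trans en)// lee_fin.
have [tau [gtau atau taub lasttau]] := last_impulse (impulsesP (S l)) gs0 as0 s0b.
have gP := impulsesP (S l).
have tau0 : 0 <= tau by rewrite (le_trans a0)// ltW.
have tauT : (tau%:E < T)%E by rewrite (le_lt_trans _ bT)// lee_fin.
have tauT' : (tau%:E < T')%E by rewrite (le_lt_trans _ bT')// lee_fin.
have enD s : a <= s -> s <= b ->
    (input_energy rho1 rho2 (impulses (S l)) `]a, s] u <= del%:E)%E /\
    (input_energy rho1 rho2 (impulses (S l)) `]s, b] u <= del%:E)%E.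
  move=> as_ sb; have := input_energyD (impulses (S l)) uP rho1K rho2K a0 as_ sb.
  move=> enE; move: en; rewrite enE => en; split; apply: le_trans en.
    by apply: leeDl; exact: input_energy_ge0.
  by apply: leeDr; exact: input_energy_ge0.
(* Stopping short of [tau] removes at least one impulse from the window, so at most [k] remain. *)
have before s : a <= s -> s < tau -> enorm (x s - z s) <= d2.
  move=> as_ stau; have sb : s <= b by rewrite (le_trans (ltW stau)).
  apply: (hd3 l u x z xa za T T' a s) => //.
  - by rewrite (lt_trans _ tauT)// lte_fin.
  - by rewrite (lt_trans _ tauT')// lte_fin.
  - by apply: le_trans baH; rewrite lerD2r.
  - have := nimpulsesD gP as_ sb; have := nimpulses_gt0 gP gtau stau taub.
    move: nk; case: (nimpulses _ `]s, b]) => // j nk _ h.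
    by move: nk; rewrite h addnS ltnS; apply: leq_trans; exact: leq_addr.
  - by move=> t at_ ts; apply: xzr => //; exact: le_trans ts _.
  - exact: le_trans del3.
  - by rewrite (le_trans (enD s as_ sb).1)// lee_fin.
have [_ _ jmpx] := solx; have [_ _ jmpz] := solz.
have [lx xlx xtau] := jmpx tau gtau atau tauT.
have [lz zlz ztau] := jmpz tau gtau atau tauT'.
have lxr : enorm lx <= r.
  apply: (enorm_left_limit_le atau _ xlx) => s as_ stau.
  by have [] := xzr s as_ (le_trans (ltW stau) taub).
have lzr : enorm lz <= r.
  apply: (enorm_left_limit_le atau _ zlz) => s as_ stau.
  by have [] := xzr s as_ (le_trans (ltW stau) taub).
have lxz : enorm (lx - lz) <= d2.
  by apply: (enorm_left_limit_le atau before); exact: cvgB.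
have utau : enorm (u tau) <= dg.
  apply: (class_K_le_inv rho2K); first exact: ltW.
  rewrite -lee_fin (le_trans (gain_le_energy u rho1K rho2K gtau atau taub))//.
  by rewrite (le_trans en)// lee_fin.
have xztau : enorm (x tau - z tau) <= d1.
  rewrite xtau ztau.
  have -> : lx + jump (S l) tau lx (u tau) - (lz + jump (S l) tau lz 0) =
    (lx - lz) + (jump (S l) tau lx (u tau) - jump (S l) tau lz 0).
    by rewrite opprD addrACA.
  have h1 := hdg l tau lx (u tau) tau0 lxr utau.
  have h2 := hom l tau lx lz tau0 lxr lzr.
  have h3 := hd2' _ (enorm_ge0 (lx - lz)) (le_trans lxz d22).
  have h4 := enormD (lx - lz) (jump (S l) tau lx (u tau) - jump (S l) tau lz 0).
  have h5 := enorm_dist_trans (jump (S l) tau lx (u tau)) (jump (S l) tau lx 0) (jump (S l) tau lz 0).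
  lra.
apply: (hd1 l u x z (x tau) (z tau) T T' tau b) => //.
- by apply: solution_tail solx _ tauT; exact: ltW.
- by apply: solution_tail solz _ tauT'; exact: ltW.
- by apply: le_trans baH; rewrite lerD2l lerN2 ltW.
- by move=> t taut tb; apply: xzr => //; rewrite (le_trans (ltW atau)).
- by rewrite (le_trans (enD tau (ltW atau) taub).2)// lee_fin.
Qed.

Lemma solutions_close_elapsed (r H eps : R) : 0 < r -> 0 <= H -> 0 < eps ->
  exists2 del : R, 0 < del &
  forall l u x z (xa : 'rV[R]_n) T T' (a b : R), input u ->
    solution (S l) a xa u x T -> solution (S l) a xa u0 z T' ->
    0 <= a -> a <= b -> (b%:E < T)%E -> (b%:E < T')%E ->
    elapsed (impulses (S l)) a b <= H ->
    (forall t, a <= t -> t <= b -> enorm (x t) <= r /\ enorm (z t) <= r) ->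
    (input_energy rho1 rho2 (impulses (S l)) `]a, b] u <= del%:E)%E ->
    enorm (x b - z b) <= eps.
Proof.
move=> r0 H0 eps0.
have [del del0 hdel] := solutions_close (Num.truncn H) r0 H0 eps0.
exists del => // l u x z xa T T' a b uP solx solz a0 ab bT bT' elH xzr.
have ba0 : 0 <= b - a by rewrite subr_ge0.
apply: (hdel l u x z xa xa T T' a b) => //.
- by apply: le_trans elH; rewrite lerDl.
- by rewrite truncn_ge_nat//; apply: le_trans elH; rewrite lerDr.
- by have [[_ ->] _ _] := solx; have [[_ ->] _ _] := solz; rewrite subrr enorm0 ltW.
Qed.

End closeness.

(** * Characterization of strong iISS *)

Section characterization.
Variables (R : realType) (n m : nat) (Lambda : Type).
Variable S : Lambda -> impulsive_system R n m.
Implicit Types (rho alpha : R -> R) (r e tau v : R).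

(* Along some solution starting at a state of norm [r], the state has norm [v]
   after hybrid time [tau], during which the input has energy [e]. *)
Definition response rho1 rho2 r e tau v : Prop :=
  exists l t0 (x0 : 'rV[R]_n) u x T t,
    [/\ 0 <= t0, input u, solution (S l) t0 x0 u x T, t0 <= t & (t%:E < T)%E] /\
    [/\ r = enorm x0, input_energy rho1 rho2 (impulses (S l)) `]t0, t] u = e%:E,
      tau = elapsed (impulses (S l)) t0 t & v = enorm (x t)].

Lemma response_ge0 rho1 rho2 r e tau v : class_K rho1 -> class_K rho2 ->
  response rho1 rho2 r e tau v -> [/\ 0 <= r, 0 <= e, 0 <= tau & 0 <= v].
Proof.
move=> K1 K2 [l [t0 [x0 [u [x [T [t [[t00 uP sol t0t tT] [-> eE -> ->]]]]]]]]].
split; [exact: enorm_ge0| |exact: elapsed_ge0|exact: enorm_ge0].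
by rewrite -lee_fin -eE; exact: input_energy_ge0.
Qed.

Lemma iISS_response beta alpha rho1 rho2 :
  (forall (l : Lambda) (t0 : R) (x0 : 'rV[R]_n) u x (T : \bar R) (t : R),
    0 <= t0 -> input u -> maximal_solution (S l) t0 x0 u x T ->
    t0 <= t -> (t%:E < T)%E ->
    ((alpha (enorm (x t)))%:E <=
      (beta (enorm x0)
        (t - t0 + (nimpulses (impulses (S l)) `]t0, t])%:R))%:E
      + input_energy rho1 rho2 (impulses (S l)) `]t0, t] u)%E) ->
  forall r e tau v, response rho1 rho2 r e tau v -> alpha v <= beta r tau + e.
Proof.
move=> h r e tau v [l [t0 [x0 [u [x [T [t [[t00 uP sol t0t tT] [-> eE -> ->]]]]]]]]].
have [y [T' [maxy TT' yx]]] := solution_extends_maximal sol.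
have := h l t0 x0 u y T' t t00 uP maxy t0t (lt_le_trans tT TT').
by rewrite yx// eE -EFinD lee_fin.
Qed.

Lemma UBEBS_response alpha rho1 rho2 (c : R) :
  (forall (l : Lambda) (t0 : R) (x0 : 'rV[R]_n) u x (T : \bar R) (t : R),
    0 <= t0 -> input u -> maximal_solution (S l) t0 x0 u x T ->
    t0 <= t -> (t%:E < T)%E ->
    ((alpha (enorm (x t)))%:E <=
      (enorm x0)%:E
      + input_energy rho1 rho2 (impulses (S l)) `]t0, t] u + c%:E)%E) ->
  forall r e tau v, response rho1 rho2 r e tau v -> alpha v <= r + e + c.
Proof.
move=> h r e tau v [l [t0 [x0 [u [x [T [t [[t00 uP sol t0t tT] [-> eE _ ->]]]]]]]]].
have [y [T' [maxy TT' yx]]] := solution_extends_maximal sol.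
have := h l t0 x0 u y T' t t00 uP maxy t0t (lt_le_trans tT TT').
by rewrite yx// eE -!EFinD lee_fin.
Qed.

(** Energies are extended reals; an infinite one makes the estimates to be proved trivial, so that
    [response] can deal with real energies. *)
Lemma maximal_response rho1 rho2 l (t0 : R) (x0 : 'rV[R]_n) u x (T : \bar R) (t : R) :
  class_K rho1 -> class_K rho2 ->
  0 <= t0 -> input u -> maximal_solution (S l) t0 x0 u x T ->
  t0 <= t -> (t%:E < T)%E ->
  input_energy rho1 rho2 (impulses (S l)) `]t0, t] u = +oo%E \/
  exists2 e, input_energy rho1 rho2 (impulses (S l)) `]t0, t] u = e%:E &
    response rho1 rho2 (enorm x0) e (elapsed (impulses (S l)) t0 t) (enorm (x t)).
Proof.
move=> K1 K2 t00 uP [sol _] t0t tT.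
have := input_energy_ge0 (impulses (S l)) u `]t0, t] K1 K2.
case eE : (input_energy _ _ _ _ _) => [e| |] // _; [right|by left].
by exists e => //; exists l, t0, x0, u, x, T, t.
Qed.

(** Composing [beta] with the inverse of [alpha] stays in class KL. *)
Lemma iISS_0GUAS : strongly_iISS S -> strongly_0GUAS S.
Proof.
move=> [beta [alpha [rho1 [rho2 [[betaK betaL] alphaK rho1K rho2K h]]]]].
have [chi [chiK chia _]] := class_Kinf_inv alphaK.
have beta_ge0 r t : 0 <= r -> 0 <= t -> 0 <= beta r t.
  by move=> r0 t0; exact: (class_K_ge0 (betaK t t0).1).
exists (fun r t => chi (beta r t)).
  split=> [t t0|r r0]; first exact: class_Kinf_comp chiK (betaK t t0).
  have [bhomo bcvg] := betaL r r0; split.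
    move=> s t s0 t0 st; apply: (class_K_le chiK.1); last exact: bhomo.
    by apply: beta_ge0 => //; move: t0; rewrite in_itv/= andbT.
  apply/cvgrPdist_le => e e0; have [d d0 hd] := class_K_small chiK.1 e0.
  have := (cvgrPdist_le _ _).1 bcvg d d0; move=> bd; near=> t.
  have t0 : 0 <= t by near: t; apply: nbhs_pinfty_ge; rewrite num_real.
  have b0 := beta_ge0 r t r0 t0.
  rewrite sub0r normrN ger0_norm ?(class_K_ge0 chiK.1)//; apply: hd => //.
  have : `|0 - beta r t| <= d by near: t; exact: bd.
  by rewrite sub0r normrN (ger0_norm b0).
move=> l t0 x0 x T t t00 maxx t0t tT.
have := h l t0 x0 _ x T t t00 (input0 _ _) maxx t0t tT.
rewrite input_energy0 ?adde0 ?lee_fin; [|exact: rho1K.1|exact: rho2K.1].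
move=> {}h; rewrite -[leLHS]chia ?enorm_ge0//; apply: (class_K_le chiK.1) => //.
exact: (class_K_ge0 alphaK.1 (enorm_ge0 _)).
Unshelve. all: by end_near. Qed.

(** UBEBS is linear in the initial norm while iISS has [beta r 0]. In terms of [s = r + e], iISS
    yields [alpha v <= beta s 0 + s]: bounded [s] gives bounded [v] and small [s] gives small [v],
    so the minorant lemma provides a new [alpha], with [c = 0]. *)
Lemma iISS_UBEBS : strongly_iISS S -> UBEBS S.
Proof.
move=> [beta [alpha [rho1 [rho2 [[betaK betaL] alphaK rho1K rho2K h]]]]].
have hr := iISS_response h.
pose P s v := exists r e tau, response rho1 rho2 r e tau v /\ s = r + e.
have resp0 := response_ge0 rho1K.1 rho2K.1.
have PE s v : P s v -> [/\ 0 <= s, 0 <= v & alpha v <= beta s 0 + s].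
  move=> [r [e [tau [rp ->]]]]; have [r0 e0 tau0 v0] := resp0 _ _ _ _ rp.
  split => //; first exact: addr_ge0.
  have := hr _ _ _ _ rp.
  have [bhomo _] := betaL r r0.
  have := bhomo 0 tau (in_nneg (lexx 0)) (in_nneg tau0) tau0.
  have : beta r 0 <= beta (r + e) 0.
    by apply: (class_K_le (betaK 0 (lexx 0)).1) => //; rewrite lerDl.
  lra.
have beta0K := (betaK 0 (lexx 0)).1.
have [|M|eps eps0|a aK aP] := @class_Kinf_minorant R P.
- by move=> s v /PE[].
- have [B B0 hB] := alphaK.2 (beta `|M| 0 + `|M|).
  exists B => s v /PE[s0 v0 av] sM; rewrite leNgt; apply/negP => Bv.
  have sM' : s <= `|M| by rewrite (le_trans sM)// ler_norm.
  have := class_K_le beta0K s0 sM'; have := class_K_lt alphaK.1 B0 Bv; lra.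
- have ae0 : 0 < alpha eps / 2 by rewrite divr_gt0// (class_K_gt0 alphaK.1).
  have [d d0 hd] := class_K_small beta0K ae0.
  exists (Num.min d (alpha eps / 2)); first by rewrite lt_min d0.
  move=> s v /PE[s0 v0 av]; rewrite le_min => /andP[sd sa].
  apply: (class_K_le_inv alphaK.1); first exact: ltW.
  by have := hd s s0 sd; lra.
exists a, rho1, rho2, 0; split => // l t0 x0 u x T t t00 uP maxx t0t tT.
have [->|[e eE rp]] := maximal_response rho1K.1 rho2K.1 t00 uP maxx t0t tT.
  exact: leey.
rewrite eE -!EFinD lee_fin addr0; apply: aP.
by exists (enorm x0), e, (elapsed (impulses (S l)) t0 t).
Qed.

(* [rho1] is the UBEBS gain enlarged to dominate the input growth [nu] of the
   flow maps. *)
Section sufficiency.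
Variables (nu N rho1 rho2 alpha : R -> R) (beta : R -> R -> R) (c : R).
Hypothesis nuK : class_K nu.
Hypothesis Nhomo : {in `[0, +oo[ &, {homo N : r s / r <= s}}.
Hypothesis N0 : forall r : R, 0 <= r -> 0 < N r.
Hypothesis flow_growth : forall l (t : R) xi mu, 0 <= t ->
  enorm (flow (S l) t xi mu) <= N (enorm xi) * (1 + nu (enorm mu)).
Hypothesis f_ii : uniform_continuity_at_zero_input (fun l => flow (S l)).
Hypothesis f_iii : uniform_local_lipschitz (fun l => flow (S l)).
Hypothesis g_ii : uniform_continuity_at_zero_input (fun l => jump (S l)).
Hypothesis g_iii : uniform_local_modulus (fun l => jump (S l)).
Hypothesis rho1K : class_K rho1.
Hypothesis rho2K : class_K rho2.
Hypothesis nu_le : forall r : R, 0 <= r -> nu r <= rho1 r.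
Hypothesis alphaK : class_Kinf alpha.
Hypothesis betaKL : class_KL beta.
Hypothesis guas : forall (l : Lambda) (t0 : R) (x0 : 'rV[R]_n) x (T : \bar R) (t : R),
    0 <= t0 -> maximal_solution (S l) t0 x0 (fun=> 0) x T ->
    t0 <= t -> (t%:E < T)%E ->
    enorm (x t) <= beta (enorm x0) (elapsed (impulses (S l)) t0 t).
Hypothesis ubebs : forall r e tau v, response rho1 rho2 r e tau v ->
  alpha v <= r + e + c.

Lemma beta_le r r' t t' : 0 <= r -> r <= r' -> 0 <= t -> t <= t' -> beta r t' <= beta r' t.
Proof.
move=> r0 rr' t0 tt'; have [bK bL] := betaKL.
have [bhomo _] := bL r r0.
apply: (@le_trans _ _ (beta r t)).
  by apply: bhomo => //; apply: in_nneg => //; exact: le_trans tt'.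
by apply: (class_K_le (bK t t0).1).
Qed.

Lemma beta_attractive r e : 0 <= r -> 0 < e -> exists2 t : R, 1 <= t & beta r t <= e.
Proof.
move=> r0 e0; have [bK bL] := betaKL; have [bhomo bcvg] := bL r r0.
have bd : \forall t \near +oo, `|0 - beta r t| <= e := (cvgrPdist_le _ _).1 bcvg e e0.
near (+oo : set_system R) => t.
have t1 : 1 <= t by near: t; apply: nbhs_pinfty_ge; rewrite num_real.
have : `|0 - beta r t| <= e by near: t; exact: bd.
rewrite sub0r normrN => h; exists t => //; exact: le_trans (ler_norm _) h.
Unshelve. all: by end_near. Qed.

Lemma input_energy_split l (u : R -> 'rV[R]_m) (a s b : R) e : input u -> 0 <= a -> a <= s -> s <= b ->
  input_energy rho1 rho2 (impulses (S l)) `]a, b] u = e%:E ->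
  exists e1 e2, [/\ input_energy rho1 rho2 (impulses (S l)) `]a, s] u = e1%:E,
    input_energy rho1 rho2 (impulses (S l)) `]s, b] u = e2%:E,
    0 <= e1, 0 <= e2 & e = e1 + e2].
Proof.
move=> uP a0 as_ sb; rewrite (input_energyD _ uP rho1K rho2K a0 as_ sb).
have := input_energy_ge0 (impulses (S l)) u `]a, s] rho1K rho2K.
have := input_energy_ge0 (impulses (S l)) u `]s, b] rho1K rho2K.
case: (input_energy _ _ _ `]a, s] u) => [e1| |]//; case: (input_energy _ _ _ `]s, b] u) => [e2| |]//.
rewrite !lee_fin => e20 e10 [eE].
by exists e1, e2.
Qed.

Lemma bounded_response M : exists2 B : R, 0 < B & forall r e tau v,
  response rho1 rho2 r e tau v -> r + e <= M -> v <= B.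
Proof.
have [B B0 hB] := alphaK.2 (M + c).
exists (B + 1); first by rewrite ltr_wpDl.
move=> r e tau v rp reM; apply: (@le_trans _ _ B); last by rewrite lerDl.
rewrite leNgt; apply/negP => /(class_K_lt alphaK.1 B0).
by have := ubebs rp; lra.
Qed.

Lemma window_estimate (r H eps : R) : 0 < r -> 0 <= H -> 0 < eps ->
  exists2 del : R, 0 < del & forall l u x (xa : 'rV[R]_n) T (a b : R), input u ->
    solution (S l) a xa u x T -> 0 <= a -> a <= b -> (b%:E < T)%E ->
    elapsed (impulses (S l)) a b <= H ->
    (forall t, a <= t -> t <= b -> enorm (x t) <= r) ->
    (input_energy rho1 rho2 (impulses (S l)) `]a, b] u <= del%:E)%E ->
    enorm (x b) <= beta (enorm (x a)) (elapsed (impulses (S l)) a b) + eps.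
Proof.
(* A radius that contains both trajectories: [r] for the given one, [beta r 0] for the zero-input
   one. *)
move=> r0 H0 eps0; pose r' := Num.max r (beta r 0).
have rr' : r <= r' by rewrite le_max lexx.
have br' : beta r 0 <= r' by rewrite le_max lexx orbT.
have r'0 : 0 < r' by exact: lt_le_trans rr'.
have [del del0 hdel] := solutions_close_elapsed nuK Nhomo N0 flow_growth f_ii f_iii g_ii g_iii
  rho1K rho2K nu_le r'0 H0 eps0.
exists del => // l u x xa T a b uP solx a0 ab bT elH xr en.
have xaE : x a = xa by have [[_ ->] _ _] := solx.
have xar : enorm xa <= r by rewrite -xaE xr.
have bnd z T' t : maximal_solution (S l) a xa (fun=> 0) z T' -> a <= t -> (t%:E < T')%E ->
    enorm (z t) <= beta r 0.
  move=> maxz at_ tT'; apply: le_trans (guas a0 maxz at_ tT') _.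
  by apply: beta_le => //; [exact: enorm_ge0|exact: elapsed_ge0].
have [z maxz] := zero_input_global nuK Nhomo N0 flow_growth f_iii a0 bnd.
have h := guas a0 maxz ab (ltry b); rewrite xaE.
have : enorm (x b - z b) <= eps.
  apply: (hdel l u x z xa T +oo%E a b) => //; first exact: maxz.1.
    exact: ltry.
  move=> t at_ tb; split; first exact: le_trans (xr t at_ tb) rr'.
  exact: le_trans (bnd z _ t maxz at_ (ltry t)) br'.
by have := enorm_subr (x b) (z b); lra.
Qed.

(** The ball of radius [d0] is revisited: a window of hybrid length at least [T1] brings a state of
    norm at most [d0] back to [d0 / 2 + d0 / 2], as long as the energy is at most [d1], and the
    bound on the total energy covers every window. Since [T1 >= 1], each window uses at least one
    unit of hybrid time, so induction on an integer bound terminates. A final stretch of length at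
    most [H] ends within [eps / 2 + eps / 2]. *)
Lemma small_response eps : 0 < eps -> exists2 del : R, 0 < del & forall r e tau v,
  response rho1 rho2 r e tau v -> r <= del -> e <= del -> v <= eps.
Proof.
move=> eps0; have [bK bL] := betaKL.
have [B B0 hB] := bounded_response 2.
have eps20 : 0 < eps / 2 by rewrite divr_gt0.
have [d0 d00 hd0] := class_K_small (bK 0 (lexx 0)).1 eps20.
have d020 : 0 < d0 / 2 by rewrite divr_gt0.
have [T1 T11 hT1] := beta_attractive (ltW d00) d020.
pose H := T1 + 2; have H0 : 0 <= H by rewrite /H; lra.
have m0 : 0 < Num.min (eps / 2) (d0 / 2) by rewrite lt_min eps20.
have [d1 d10 hd1] := window_estimate B0 H0 m0.
have me : Num.min (eps / 2) (d0 / 2) <= eps / 2 by rewrite ge_min lexx.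
have md : Num.min (eps / 2) (d0 / 2) <= d0 / 2 by rewrite ge_min lexx orbT.
have claim (k : nat) l u x (xa : 'rV[R]_n) T (a b : R) e : input u ->
    solution (S l) a xa u x T -> 0 <= a -> a <= b -> (b%:E < T)%E ->
    elapsed (impulses (S l)) a b <= k%:R ->
    (forall t, a <= t -> t <= b -> enorm (x t) <= B) ->
    input_energy rho1 rho2 (impulses (S l)) `]a, b] u = e%:E -> e <= d1 ->
    enorm (x a) <= d0 -> enorm (x b) <= eps.
  elim: k xa a e => [|k IH] xa a e uP solx a0 ab bT elk xB eE ed1 xad0;
  have gP := impulsesP (S l); have el0 := elapsed_ge0 (impulses (S l)) ab;
  (have [elH|Hel] := leP (elapsed (impulses (S l)) a b) H;
    [have h : enorm (x b) <= beta (enorm (x a)) (elapsed (impulses (S l)) a b) + Num.min (eps / 2) (d0 / 2)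
      by apply: (hd1 l u x xa T a b) => //; rewrite eE lee_fin
    |]).
  - have := beta_le (enorm_ge0 (x a)) xad0 (lexx 0) el0.
    have := hd0 d0 (ltW d00) (lexx _); lra.
  - by move: elk; lra.
  - have := beta_le (enorm_ge0 (x a)) xad0 (lexx 0) el0.
    have := hd0 d0 (ltW d00) (lexx _); lra.
  have T10 : 0 < T1 by lra.
  have [|s [as_ sb T1s sH]] := elapsed_window gP T10 ab; first by rewrite /H in Hel; lra.
  have [e1 [e2 [e1E e2E e10 e20 ee]]] := input_energy_split uP a0 as_ sb eE.
  have sT : (s%:E < T)%E by rewrite (le_lt_trans _ bT)// lee_fin.
  apply: (IH (x s) s e2) => //.
  - exact: solution_tail solx as_ sT.
  - exact: le_trans as_.
  - by move: elk; rewrite (elapsedD gP as_ sb) -natr1; lra.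
  - by move=> t st tb; apply: xB => //; exact: le_trans st.
  - lra.
  - have : enorm (x s) <= beta (enorm (x a)) (elapsed (impulses (S l)) a s) + Num.min (eps / 2) (d0 / 2).
      apply: (hd1 l u x xa T a s) => //.
        by move=> t at_ ts; apply: xB => //; exact: le_trans sb.
      by rewrite e1E lee_fin; lra.
    have := beta_le (enorm_ge0 (x a)) xad0 (ltW T10) T1s; lra.
exists (Num.min 1 (Num.min d0 d1)); first by rewrite !lt_min ltr01 d00.
move=> r e tau v [l [t0 [x0 [u [x [T [t [[t00 uP sol t0t tT] [rE eE _ ->]]]]]]]]].
rewrite !le_min => /and3P[r1 rd0 _] /and3P[e1 _ ed1].
have x0E : x t0 = x0 by have [[_ ->] _ _] := sol.
apply: (claim (Num.truncn (elapsed (impulses (S l)) t0 t)).+1 l u x x0 T t0 t e) => //.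
- by apply/ltW/truncnS_gt.
- move=> s t0s st.
  have [e1' [e2' [e1E _ e10 e20 ee]]] := input_energy_split uP t00 t0s st eE.
  apply: (hB r e1' (elapsed (impulses (S l)) t0 s)); last lra.
  exists l, t0, x0, u, x, T, s; split => //; split => //.
  by rewrite (le_lt_trans _ tT)// lee_fin.
- by rewrite x0E -rE.
Qed.

(* UBEBS with [c = 0]. *)
Lemma response_gain : exists2 a : R -> R, class_Kinf a & forall r e tau v,
  response rho1 rho2 r e tau v -> a v <= Num.max r e.
Proof.
pose P s v := exists r e tau, response rho1 rho2 r e tau v /\ s = Num.max r e.
have [|M|eps eps0|a aK aP] := @class_Kinf_minorant R P.
- move=> s v [r [e [tau [rp ->]]]]; have [r0 e0 _ v0] := response_ge0 rho1K rho2K rp.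
  by rewrite le_max r0.
- have [B B0 hB] := bounded_response (M + M).
  exists B => s v [r [e [tau [rp ->]]]]; rewrite ge_max => /andP[rM eM].
  by apply: hB rp _; rewrite lerD.
- have [d d0 hd] := small_response eps0; exists d => // s v [r [e [tau [rp ->]]]].
  by rewrite ge_max => /andP[rd ed]; exact: hd rp rd ed.
by exists a => // r e tau v rp; apply: aP; exists r, e, tau.
Qed.

(* The energy cannot exceed [del] in more than [r / del] windows; in the first
   window where it does not, the state becomes small. *)
Lemma response_attractive (a : R -> R) : class_Kinf a ->
  (forall r e tau v, response rho1 rho2 r e tau v -> a v <= Num.max r e) ->
  forall r eps, 0 < r -> 0 < eps -> exists T : R, forall s e tau v,
    response rho1 rho2 s e tau v -> s <= r -> T <= tau -> a v <= eps + e.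
Proof.
move=> aK aP r eps r0 eps0.
have [B B0 hB] := bounded_response (r + r).
have eps20 : 0 < eps / 2 by rewrite divr_gt0.
have [T1 T11 hT1] := beta_attractive (ltW B0) eps20.
have T10 : 0 < T1 by lra.
pose H := T1 + 2; have H0 : 0 <= H by rewrite /H; lra.
have [del del0 hdel] := window_estimate B0 H0 eps20.
(* An expensive window consumes more than [del] of energy and at most [H] of hybrid time, which
   lowers [j] by one; with [j = 0] the energy is already small enough. *)
have claim (j : nat) l u x (xa : 'rV[R]_n) T (p b : R) e : input u ->
    solution (S l) p xa u x T -> 0 <= p -> p <= b -> (b%:E < T)%E ->
    j.+1%:R * H <= elapsed (impulses (S l)) p b ->
    (forall t, p <= t -> t <= b -> enorm (x t) <= B) ->
    input_energy rho1 rho2 (impulses (S l)) `]p, b] u = e%:E -> e <= j%:R * del ->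
    exists s, [/\ p <= s, s <= b & enorm (x s) <= eps].
  elim: j xa p e => [|j IH] xa p e uP solx p0 pb bT el xB eE ej;
  have gP := impulsesP (S l).
  - have [|s [ps sb T1s sH]] := elapsed_window gP T10 pb.
      by move: el; rewrite mul1r /H; lra.
    have [e1 [e2 [e1E e2E e10 e20 ee]]] := input_energy_split uP p0 ps sb eE.
    have sT : (s%:E < T)%E by rewrite (le_lt_trans _ bT)// lee_fin.
    exists s; split => //.
    have : enorm (x s) <= beta (enorm (x p)) (elapsed (impulses (S l)) p s) + eps / 2.
      apply: (hdel l u x xa T p s) => //.
        by move=> t pt ts; apply: xB => //; exact: le_trans sb.
      by rewrite e1E lee_fin; move: ej; rewrite mul0r; lra.
    have := beta_le (enorm_ge0 (x p)) (xB p (lexx _) pb) (ltW T10) T1s; lra.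
  have jH : 0 <= j%:R * H by rewrite mulr_ge0.
  have elj : j.+1%:R * H + H <= elapsed (impulses (S l)) p b.
    by move: el; rewrite -[j.+2%:R]natr1 mulrDl mul1r.
  have [|s [ps sb T1s sH]] := elapsed_window gP T10 pb.
    have : 0 <= j.+1%:R * H by rewrite mulr_ge0.
    by move: elj; rewrite /H; lra.
  have [e1 [e2 [e1E e2E e10 e20 ee]]] := input_energy_split uP p0 ps sb eE.
  have sT : (s%:E < T)%E by rewrite (le_lt_trans _ bT)// lee_fin.
  have [e1d|de1] := leP e1 del.
    exists s; split => //.
    have : enorm (x s) <= beta (enorm (x p)) (elapsed (impulses (S l)) p s) + eps / 2.
      apply: (hdel l u x xa T p s) => //.
        by move=> t pt ts; apply: xB => //; exact: le_trans sb.
      by rewrite e1E lee_fin.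
    have := beta_le (enorm_ge0 (x p)) (xB p (lexx _) pb) (ltW T10) T1s; lra.
  have [|||s' [ss' s'b xs']] := IH (x s) s e2 uP (solution_tail solx ps sT) (le_trans p0 ps) sb bT _ _ e2E.
  - by move: elj; rewrite (elapsedD gP ps sb) /H; move: sH; rewrite /H; lra.
  - by move=> t st tb; apply: xB => //; exact: le_trans st.
  - by move: ej; rewrite -natr1 mulrDl mul1r; lra.
  by exists s'; split => //; exact: le_trans ss'.
pose J := (Num.truncn (r / del)).+1.
have rJ : r <= J%:R * del by rewrite -ler_pdivrMr//; exact/ltW/truncnS_gt.
exists (J.+1%:R * H) => s e tau v rp sr Ttau.
have [s0 e0 tau0 v0] := response_ge0 rho1K rho2K rp.
(* If [e >= r], the energy also dominates the initial state and [aP] alone gives [a v <= e].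
   Otherwise [e < r] bounds the number of expensive windows independently of [e]. *)
have [re|er] := leP r e.
  have := aP _ _ _ _ rp; rewrite max_r; [lra|exact: le_trans re].
have [l [t0 [x0 [u [x [T [t [[t00 uP sol t0t tT] [sE eE tauE vE]]]]]]]]] := rp.
have [|||p [t0p pt xp]] := claim J l u x x0 T t0 t e uP sol t00 t0t tT _ _ eE.
- by rewrite -tauE.
- move=> q t0q qt.
  have [e1 [e2 [e1E _ e10 e20 ee]]] := input_energy_split uP t00 t0q qt eE.
  apply: (hB s e1 (elapsed (impulses (S l)) t0 q)); last lra.
  exists l, t0, x0, u, x, T, q; split => //; split => //.
  by rewrite (le_lt_trans _ tT)// lee_fin.
- exact: le_trans (ltW er) rJ.
have [e1 [e2 [e1E e2E e10 e20 ee]]] := input_energy_split uP t00 t0p pt eE.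
have pT : (p%:E < T)%E by rewrite (le_lt_trans _ tT)// lee_fin.
(* Restarting the gain estimate at [p] carries the smallness reached there to the final time, up to
   the remaining energy [e2 <= e]. *)
have : a v <= Num.max (enorm (x p)) e2.
  apply: (aP _ _ (elapsed (impulses (S l)) p t)).
  exists l, p, (x p), u, x, T, t; split; split => //.
    exact: le_trans t0p.
  exact: solution_tail sol t0p pT.
by move/le_trans; apply; rewrite ge_max; apply/andP; split; lra.
Qed.

(** The excess [a v - e] of the state over the energy is what a KL function must dominate. It is at
    most the initial norm, since [Num.max r e <= r + e], and it becomes small with hybrid time by
    [response_attractive]; these are the two hypotheses of the majorant lemma. *)
Lemma sufficiency : exists (b : R -> R -> R) (a : R -> R),
  [/\ class_KL b, class_Kinf a & forall r e tau v,
    response rho1 rho2 r e tau v -> a v <= b r tau + e].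
Proof.
have [a aK aP] := response_gain.
pose P s tau w := exists e v, response rho1 rho2 s e tau v /\ w = a v - e.
have [||b bKL bP] := @class_KL_majorant R P.
- move=> s tau w [e [v [rp ->]]]; have [s0 e0 tau0 v0] := response_ge0 rho1K rho2K rp.
  split => //; rewrite lerBlDr (le_trans (aP _ _ _ _ rp))// ge_max.
  by rewrite lerDl e0 lerDr s0.
- move=> r eps r0 eps0; have [T hT] := response_attractive aK aP r0 eps0.
  by exists T => s tau w [e [v [rp ->]]] sr Ttau; rewrite lerBlDr; exact: hT rp sr Ttau.
exists b, a; split => // r e tau v rp.
by rewrite -lerBlDr; apply: bP; exists e, v.
Qed.

End sufficiency.

Lemma GUAS_UBEBS_iISS (f_i : uniform_growth_bound (fun l => flow (S l)))
    (f_ii : uniform_continuity_at_zero_input (fun l => flow (S l)))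
    (f_iii : uniform_local_lipschitz (fun l => flow (S l)))
    (g_ii : uniform_continuity_at_zero_input (fun l => jump (S l)))
    (g_iii : uniform_local_modulus (fun l => jump (S l))) :
  strongly_0GUAS S -> UBEBS S -> strongly_iISS S.
Proof.
move=> [beta betaKL guas] [alpha [rho [rho2 [c [alphaK rhoK rho2K c0 ubebs]]]]].
have [nu [N [nuK Nhomo N0 growth]]] := f_i.
pose rho1 r := rho r + nu r.
have rho1K : class_Kinf rho1 by exact: class_K_add.
have nu_le r : 0 <= r -> nu r <= rho1 r.
  by move=> r0; rewrite lerDr (class_K_ge0 rhoK.1).
have rho_le r : 0 <= r -> rho r <= rho1 r.
  by move=> r0; rewrite lerDl (class_K_ge0 nuK).
have ubebs' r e tau v : response rho1 rho2 r e tau v -> alpha v <= r + e + c.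
  apply: UBEBS_response => l t0 x0 u x T t t00 uP maxx t0t tT.
  rewrite (le_trans (ubebs l t0 x0 u x T t t00 uP maxx t0t tT))// leeD2r// leeD2l//.
  by apply: input_energy_mono => //; [exact: rhoK.1|exact: rho1K.1].
have [b [a [bKL aK h]]] := sufficiency nuK Nhomo N0 growth f_ii f_iii g_ii g_iii
  rho1K.1 rho2K.1 nu_le alphaK betaKL guas ubebs'.
exists b, a, rho1, rho2; split => // l t0 x0 u x T t t00 uP maxx t0t tT.
have [->|[e eE rp]] := maximal_response rho1K.1 rho2K.1 t00 uP maxx t0t tT.
  exact: leey.
by rewrite eE -EFinD lee_fin; exact: h rp.
Qed.

End characterization.

Theorem theorem3p1 (R : realType) (n m : nat) (Lambda : Type)
    (Lambda_nonempty : inhabited Lambda)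
    (S : Lambda -> impulsive_system R n m)
    (f_i : uniform_growth_bound (fun l => flow (S l)))
    (f_ii : uniform_continuity_at_zero_input (fun l => flow (S l)))
    (f_iii : uniform_local_lipschitz (fun l => flow (S l)))
    (g_i : uniform_growth_bound (fun l => jump (S l)))
    (g_ii : uniform_continuity_at_zero_input (fun l => jump (S l)))
    (g_iii : uniform_local_modulus (fun l => jump (S l))) :
  strongly_iISS S <-> strongly_0GUAS S /\ UBEBS S.
Proof.
split; last by case=> guas ubebs; exact: GUAS_UBEBS_iISS.
by move=> h; split; [exact: iISS_0GUAS|exact: iISS_UBEBS].
Qed.
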